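(* Let $(R,\mathfrak m)$ be a two-dimensional Noetherian local ring and let $S$ be a polynomial ring over $R$ in finitely many variables. Let $\sigma,\tau$ be a system of parameters of $R$. Then for every ideal $J\subset S$ and every $i\ge 0$, the set $$\{P\in \operatorname{Ass}_S H^i_J(S) : \tau\in P,\ \sigma\notin P\}$$ is finite.
   Context: All rings are commutative, Noetherian, with unity. $H^i_J(S)$ denotes the $i$-th local cohomology module of $S$ with support in $J$. A system of parameters of the two-dimensional local ring $R$ is a pair $\sigma,\tau\in\mathfrak m$ such that $(\sigma,\tau)R$ is $\mathfrak m$-primary. *)

(* Defs.v *)
From mathcomp Require Import all_boot all_algebra.
From mathcomp Require Import mathcomp_extra boolp classical_sets cardinality.
From mathcomp Require Import mpoly.

Set Implicit Arguments.
Unset Strict Implicit.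
Unset Printing Implicit Defensive.

Import GRing.Theory.
Local Open Scope classical_set_scope.
Local Open Scope ring_scope.

Section Ideals.
Variable A : comNzRingType.
Implicit Types (I J P Q m : set A).

(* The ideals of MathComp ([idealr_closed]) are proper; the unit ideal is
   allowed here. *)
Definition is_ideal I : Prop :=
  [/\ I 0, (forall x y, I x -> I y -> I (x + y))
    & (forall a x, I x -> I (a * x))].

Definition is_prime P : Prop :=
  [/\ is_ideal P, ~ P 1 & forall x y, P (x * y) -> P x \/ P y].

Definition is_maximal m : Prop :=
  [/\ is_ideal m, ~ m 1
    & forall I, is_ideal I -> m `<=` I -> ~ I 1 -> I = m].

Definition ideal_span (X : set A) : set A :=
  [set x | exists (k : nat) (c g : 'I_k -> A),
     (forall j, X (g j)) /\ x = \sum_(j < k) c j * g j].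

Definition ideal_exp J (k : nat) : set A :=
  ideal_span [set x | exists a : 'I_k -> A,
     (forall j, J (a j)) /\ x = \prod_(j < k) a j].

Definition ideal_radical I : set A := [set x | exists k : nat, I (x ^+ k)].

Definition is_primary_to m Q : Prop :=
  [/\ is_ideal Q, ~ Q 1,
      (forall x y, Q (x * y) -> Q x \/ exists k : nat, Q (y ^+ k))
    & ideal_radical Q = m].

Definition is_noetherian : Prop :=
  forall I, is_ideal I -> exists s : seq A, I = ideal_span [set` s].

Definition is_local m : Prop :=
  is_maximal m /\ forall m', is_maximal m' -> m' = m.

Definition has_prime_chain (d : nat) : Prop :=
  exists p : nat -> set A,
    (forall k, (k <= d)%N -> is_prime (p k)) /\
    (forall k, (k < d)%N -> p k `<` p k.+1).

Definition krull_dim_eq (d : nat) : Prop :=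
  has_prime_chain d /\ forall e, has_prime_chain e -> (e <= d)%N.

Definition is_sop2 m (s t : A) : Prop :=
  [/\ m s, m t & is_primary_to m (ideal_span [set s; t])].

End Ideals.

Section Modules.
Variable A : comNzRingType.

Definition annihilator (M : lmodType A) (x : M) : set A :=
  [set a | a *: x = 0].

Definition Ass (M : lmodType A) : set (set A) :=
  [set P | is_prime P /\ exists x : M, P = annihilator x].

Definition is_injective_module (E : lmodType A) : Prop :=
  forall (M N : lmodType A) (u : {linear M -> N}) (g : {linear M -> E}),
    injective u -> exists h : {linear N -> E}, forall x, h (u x) = g x.

Record injective_resolution (M : lmodType A) := InjectiveResolution {
  ires_obj :> nat -> lmodType A;
  ires_diff : forall k, {linear ires_obj k -> ires_obj k.+1};
  ires_aug : {linear M -> ires_obj 0};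
  ires_injective : forall k, is_injective_module (ires_obj k);
  ires_aug_inj : injective ires_aug;
  ires_exact0 : forall x : ires_obj 0,
    ires_diff 0 x = 0 <-> exists y, x = ires_aug y;
  ires_exactS : forall k (x : ires_obj k.+1),
    ires_diff k.+1 x = 0 <-> exists y, x = ires_diff k y
}.

(* The torsion functor Gamma_J. *)
Definition torsion (J : set A) (M : lmodType A) : set M :=
  [set x | exists k : nat, forall a, ideal_exp J k a -> a *: x = 0].

(* Cocycles and coboundaries of the complex Gamma_J(I). *)
Definition torsion_cocycles (J : set A) (M : lmodType A)
    (I : injective_resolution M) (i : nat) : set (I i) :=
  [set x | torsion J x /\ ires_diff I i x = 0].

Definition torsion_coboundaries (J : set A) (M : lmodType A)
    (I : injective_resolution M) (i : nat) : set (I i) :=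
  match i return set (I i) with
  | 0 => [set 0]
  | k.+1 => [set ires_diff I k y | y in torsion J (M := I k)]
  end.

Arguments torsion_cocycles J [M] I i.
Arguments torsion_coboundaries J [M] I i.

(* H is isomorphic to the quotient Z / B of submodules B <= Z of M: the module
   L with the embedding j is Z, and p is the quotient map. *)
Definition is_subquotient (M : lmodType A) (Z B : set M) (H : lmodType A) :
    Prop :=
  exists (L : lmodType A) (j : {linear L -> M}) (p : {linear L -> H}),
    [/\ injective j, range j = Z, range p = setT
      & forall z, p z = 0 <-> B (j z)].

(* H is (isomorphic to) H^i_J(M), where H^i_J is the i-th right derived functor
   of Gamma_J. *)
Definition is_local_cohomology (J : set A) (M : lmodType A) (i : nat)
    (H : lmodType A) : Prop :=
  exists I : injective_resolution M,
    is_subquotient (torsion_cocycles J I i) (torsion_coboundaries J I i) H.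

End Modules.

(* Main.v *)
(* Write S = R[x_1, ..., x_n] and p for the contraction to R of an associated prime P
   with tau in P and sigma not in P. As in Krull's principal ideal theorem, symbolic powers of p
   modulo tau stabilize because R/(sigma, tau) has finite length, so some power of p
   lies in tau R up to elements outside p; hence there are only finitely many such
   p, and it is enough to bound the number of the P contracting to a fixed p.

   Local cohomology is computed by the Cech complex C on generators of J: the
   Koszul homology of S is pro-zero in positive degrees, so injective modules are
   acyclic, and one shifts dimensions along the injective resolution. Classes killed
   by tau come from the Cech complexes of (0 : tau) and of S/tau S, whose
   localizations at p have finite length coefficients.

   On these complexes the Hasse derivatives act. If P_1, ..., P_l are associated
   primes, no P_i contained in P_j for i < j, the elements supported on
   the union of V(P_1), ..., V(P_j) form a strictly increasing chain stable under the
   derivatives. By Joseph's proof of Bernstein's inequality, which works in every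
   characteristic with Hasse derivatives, each step of the chain contributes at least
   t^n to the length of the part of C of order O(t), which is itself O(t^n). Hence l is
   bounded. *)

Require Import Defs.
From HB Require Import structures.
From mathcomp Require Import all_boot all_algebra.
From mathcomp Require Import mathcomp_extra boolp classical_sets functions cardinality.
From mathcomp Require Import mpoly.
From mathcomp Require Import ring zify.

Set Implicit Arguments.
Unset Strict Implicit.
Unset Printing Implicit Defensive.

Import GRing.Theory.
Local Open Scope classical_set_scope.
Local Open Scope ring_scope.

(** * Ideals and Noetherian rings *)

(** No localization and no Cech cohomology module is ever formed. A class is an element modulo a
    submodule [Y], localizing at [p] means allowing multipliers from [R] outside [p], and length
    becomes the bound [plen] on the sizes of [p]-independent sequences. Since associated primes are
    annihilators of elements, a comparison of complexes only has to match each class with one of the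
    same annihilator.

    The obstacle is that [R] localized at [p] need not have finite length, while the count needs
    coefficients that do. The inclusion of [s p^k] in [tau R], with [s] outside [p], gives finite
    length at [p] to both [R / tau R] and [(0 : tau)]; this is why a class killed by [tau] is split
    between the two.

    The exponent [n] comes from comparing squares: there are [t^(2n)] operators [x^a D^b] with
    exponents below [t], and on a piece of length below [t^n] so many operators satisfy a linear
    relation. Degrees grow only linearly in [t] because a Hasse derivative of order [k] raises the
    pole order of a fraction by at most [k]. *)

Section Submodules.
Variables (A : comNzRingType) (M : lmodType A).
Implicit Types (B C : set M) (x y : M).

Definition submod B : Prop :=
  [/\ B 0, (forall x y, B x -> B y -> B (x + y)) & (forall a x, B x -> B (a *: x))].

Lemma submodN B x : submod B -> B x -> B (- x).
Proof. by move=> [_ _ BZ] Bx; rewrite -scaleN1r; apply: BZ. Qed.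

Lemma submodB B x y : submod B -> B x -> B y -> B (x - y).
Proof. by move=> sB Bx By; have [_ BD _] := sB; apply: BD => //; apply: submodN. Qed.

Lemma submod_addr B x y : submod B -> B y -> B (x + y) -> B x.
Proof. by move=> sB By Bxy; rewrite -(addrK y x); apply: submodB. Qed.

Definition adj B y : set M := [set x | exists b a, B b /\ x = b + a *: y].

Lemma submod_adj B y : submod B -> submod (adj B y).
Proof.
case=> B0 BD BZ; split.
- by exists 0, 0; rewrite scale0r addr0.
- move=> _ _ [b [a [Bb ->]]] [c [d [Bc ->]]]; exists (b + c), (a + d).
  by split; [apply: BD | rewrite scalerDl addrACA].
- move=> r _ [b [a [Bb ->]]]; exists (r *: b), (r * a).
  by split; [apply: BZ | rewrite scalerDr scalerA].
Qed.

Lemma sub_adj B y : B `<=` adj B y.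
Proof. by move=> x Bx; exists x, 0; rewrite scale0r addr0. Qed.

Lemma adj_self B y : submod B -> adj B y y.
Proof. by case=> B0 _ _; exists 0, 1; rewrite scale1r add0r. Qed.

Lemma adjS B C y : B `<=` C -> adj B y `<=` adj C y.
Proof. by move=> BC x [b [a [Bb ->]]]; exists b, a; split=> //; apply: BC. Qed.

Lemma adj_min B C y : submod C -> B `<=` C -> C y -> adj B y `<=` C.
Proof.
by move=> [_ CD CZ] BC Cy x [b [a [Bb ->]]]; apply: CD; [apply: BC | apply: CZ].
Qed.

Lemma submod_adjs B ys : submod B -> submod (foldl adj B ys).
Proof. by elim: ys B => //= y ys IH B sB; apply/IH/submod_adj. Qed.

Lemma sub_adjs B ys : B `<=` foldl adj B ys.
Proof. by elim: ys B => [|y ys IH] B x Bx //=; apply/IH/sub_adj. Qed.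

Lemma adjs_min B C ys : submod C -> B `<=` C -> (forall y, y \in ys -> C y) ->
  foldl adj B ys `<=` C.
Proof.
move=> sC; elim: ys B => [|y ys IH] B BC Cys /=; first exact: BC.
apply: IH.
  by apply: adj_min => //; apply: Cys; rewrite mem_head.
by move=> z zys; apply: Cys; rewrite in_cons zys orbT.
Qed.

Lemma mem_adjs B ys y : submod B -> y \in ys -> foldl adj B ys y.
Proof.
elim: ys B => //= z ys IH B sB; rewrite in_cons => /predU1P[->|yys].
  exact/sub_adjs/adj_self.
by apply: IH => //; apply: submod_adj.
Qed.

Definition gen (X : set M) : set M :=
  [set x | forall K, submod K -> X `<=` K -> K x].

Lemma submod_gen X : submod (gen X).
Proof.
split=> [K [] //|x y gx gy K sK XK|a x gx K sK XK].
  by have [_ + _] := sK; apply; [apply: gx | apply: gy].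
by have [_ _] := sK; apply; apply: gx.
Qed.

Lemma gen_min X K : submod K -> X `<=` K -> gen X `<=` K.
Proof. by move=> sK XK x; apply. Qed.

Lemma submod0 : submod [set 0].
Proof.
split=> // [x y /= -> ->|a x /= ->]; first by rewrite addr0.
exact: scaler0.
Qed.

End Submodules.

Section IdealBasics.
Variable A : comNzRingType.
Implicit Types (I J K U V P m : set A).

Lemma ideal_spanE (X : set A) : ideal_span X = gen (M := A^o) X.
Proof.
apply/seteqP; split=> [_ [k [c [g [Xg ->]]]] K sK XK|x].
  have [K0 KD KZ] := sK; apply: (big_ind K) => // j _.
  by apply: (KZ (c j)); apply: XK.
apply; last by move=> y Xy; exists 1, (fun=> 1), (fun=> y); rewrite big_ord1 mul1r.
split.
- by exists 0, (fun=> 0), (fun=> 0); split=> [[]|]; rewrite ?big_ord0.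
- move=> _ _ [k [c [g [Xg ->]]]] [l [d [h [Xh ->]]]].
  exists (k + l), (fun j => match fintype.split j with inl i => c i | inr i => d i end),
    (fun j => match fintype.split j with inl i => g i | inr i => h i end).
  split=> [j|]; first by case: (fintype.split j).
  rewrite big_split_ord /=; congr (_ + _); apply: eq_bigr => j _.
    by rewrite (unsplitK (inl j)).
  by rewrite (unsplitK (inr j)).
- move=> a _ [k [c [g [Xg ->]]]]; exists k, (fun j => a * c j), g; split=> //.
  by rewrite /GRing.scale /= big_distrr; apply: eq_bigr => j _; apply: mulrA.
Qed.

(** Generators are adjoined one at a time from a list, so that arguments about ideals become
    inductions on that list. *)
Definition noeth : Prop := forall I, is_ideal I ->
  exists s : seq A, (forall x, x \in s -> I x) /\ I `<=` foldl (adj (M := A^o)) [set 0] s.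

Lemma noethP : is_noetherian A <-> noeth.
Proof.
split=> nA I idI; have [s] := nA I idI.
  rewrite ideal_spanE => Is; exists s; split=> [x xs|].
    by rewrite Is => K _; apply.
  rewrite Is; apply: (gen_min (M := A^o) (submod_adjs (M := A^o) s (submod0 A^o))).
  by move=> x xs; apply: mem_adjs => //; apply: submod0.
case=> sI Is; exists s; rewrite ideal_spanE; apply/seteqP; split.
  apply: (subset_trans Is); apply: (adjs_min (submod_gen (M := A^o) [set` s])).
    by move=> _ ->; case: (submod_gen (M := A^o) [set` s]).
  by move=> x xs K _; apply.
by apply: (gen_min (M := A^o) idI) => x; apply: sI.
Qed.

Lemma noeth_chain (I : nat -> set A) : noeth -> (forall k, is_ideal (I k)) ->
  (forall k, I k `<=` I k.+1) -> exists k, forall l, I l `<=` I k.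
Proof.
move=> nA idI IS.
have Imono k l : (k <= l)%N -> I k `<=` I l.
  by move=> /subnK <-; elim: (l - k)%N => // d IH; apply: (subset_trans IH); apply: IS.
have [|s [sI Is]] := nA [set x | exists k, I k x].
  split=> [|x y [k Ikx] [l Ily]|a x [k Ikx]].
  - by exists 0%N; case: (idI 0%N).
  - exists (maxn k l); have [_ D _] := idI (maxn k l); apply: D.
      exact: Imono (leq_maxl _ _) _ Ikx.
    exact: Imono (leq_maxr _ _) _ Ily.
  - by exists k; have [_ _] := idI k; apply.
have [k Ik] : exists k, forall x, x \in s -> I k x.
  elim: s sI {Is} => [|x s IH] sI; first by exists 0%N.
  have [|k Ik] := IH; first by move=> y ys; apply: sI; rewrite in_cons ys orbT.
  have [l Il] := sI x (mem_head _ _); exists (maxn k l) => y.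
  rewrite in_cons => /predU1P[->|/Ik Iky]; first exact: Imono (leq_maxr _ _) _ Il.
  exact: Imono (leq_maxl _ _) _ Iky.
exists k => l x Ilx; have /Is : exists k, I k x by exists l.
by apply: (adjs_min (M := A^o)) => // [|_ ->]; [exact: idI | case: (idI k)].
Qed.

Lemma in_maximal I : is_ideal I -> ~ I 1 -> exists m, is_maximal m /\ I `<=` m.
Proof.
move=> idI I1.
(* The alternative [X = set0] covers the empty chain, whose union is empty. *)
pose P (X : set A) := X = set0 \/ [/\ is_ideal X, ~ X 1 & I `<=` X].
have [F FP totF|m [Pm mmax]] := @Zorn_bigcup A P.
  case: (pselect (exists2 X, F X & X !=set0)) => [[X FX X0]|noX]; last first.
    left; apply/seteqP; split=> // x [X FX Xx]; apply: noX.
    by exists X => //; exists x.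
  have PX Y : F Y -> Y !=set0 -> [/\ is_ideal Y, ~ Y 1 & I `<=` Y].
    by move=> FY [y Yy]; case: (FP _ FY) => // Y0; move: Yy; rewrite Y0.
  right; have [[X00 _ _] _ IX] := PX _ FX X0; split.
  - split=> [|x y [Y FY Yx] [Z FZ Zy]|a x [Y FY Yx]]; first by exists X.
      case: (totF _ _ FY FZ) => YZ.
        exists Z => //; have [|[_ ZD _] _ _] := PX _ FZ; first by exists y.
        by apply: ZD => //; apply: YZ.
      exists Y => //; have [|[_ YD _] _ _] := PX _ FY; first by exists x.
      by apply: YD => //; apply: YZ.
    exists Y => //; have [|[_ _ YZ] _ _] := PX _ FY; first by exists x.
    exact: YZ.
  - by move=> [Y FY Y1]; have [|_ ] := PX _ FY; first by exists 1.
  - by move=> x Ix; exists X => //; apply: IX.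
case: Pm => [m0|[idm m1 Im]].
  case: (mmax I); last by right; split.
  by rewrite m0; split=> // /(_ 0); case: idI => I0 _ _; apply.
exists m; split=> //; split=> // K idK mK K1.
apply: contrapT => neqK; apply: (mmax K); last by right; split=> //; apply: subset_trans mK.
by split=> // Km; apply: neqK; apply/seteqP.
Qed.

Lemma local_unit m x : is_local m -> ~ m x -> exists y, y * x = 1.
Proof.
move=> [[idm m1 _] mU] mx; apply: contrapT => nox.
have [||m' [mm' xm']] := @in_maximal [set z | exists y, z = y * x].
- split=> [|_ _ [a ->] [b ->]|a _ [b ->]].
  + by exists 0; rewrite mul0r.
  + by exists (a + b); rewrite mulrDl.
  + by exists (a * b); rewrite mulrA.
- by move=> [y /esym yx]; apply: nox; exists y.
by apply: mx; rewrite -(mU _ mm'); apply: xm'; exists 1; rewrite mul1r.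
Qed.

Lemma local_sub m I : is_local m -> is_ideal I -> ~ I 1 -> I `<=` m.
Proof. by move=> [_ mU] idI I1; have [m' [/mU <-]] := in_maximal idI I1. Qed.

Lemma local_prime m : is_local m -> is_prime m.
Proof.
move=> lm; have [[idm m1 _] _] := lm; split=> // x y mxy.
case: (pselect (m x)) => mx; [by left | right].
have [z zx] := local_unit lm mx; have [_ _ mM] := idm.
by rewrite -(mul1r y) -zx -mulrA; apply: mM.
Qed.

Lemma gen_pow_sub (gs : seq A) U : is_ideal U ->
  (forall g, g \in gs -> exists k, U (g ^+ k)) ->
  exists k, forall l : seq A, size l = k ->
    (forall x, x \in l -> foldl (adj (M := A^o)) [set 0] gs x) -> U (\prod_(x <- l) x).
Proof.
move=> idU; have [U0 UD UM] := idU.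
elim/last_ind: gs => [|gs g IH] Ugs.
  exists 1%N => -[|x []] //= _ /(_ x (mem_head _ _)) ->.
  by rewrite big_seq1.
have [|k Uk] := IH; first by move=> h hgs; apply: Ugs; rewrite mem_rcons in_cons hgs orbT.
have [|t Ut] := Ugs g; first by rewrite mem_rcons mem_head.
exists (t + k)%N => l szl; rewrite foldl_rcons => lJ.
(* Expanding the factors one by one collects [i] factors [g] and a list [bl] from the ideal of the
   other generators. When no factor is left, [t <= i] or [k <= size bl], because the two counts add
   up to [t + k]. *)
have H l' i bl : (i + size bl + size l' = t + k)%N ->
    (forall x, x \in bl -> foldl (adj (M := A^o)) [set 0] gs x) ->
    (forall x, x \in l' -> adj (M := A^o) (foldl (adj (M := A^o)) [set 0] gs) g x) ->
    U (g ^+ i * \prod_(x <- bl) x * \prod_(x <- l') x).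
  elim: l' i bl => [|a l' IHl] i bl.
    rewrite addn0 big_nil mulr1 => sz blJ _.
    case: (leqP t i) => it; first by rewrite -(subnK it) exprD mulrAC; apply: UM.
    have kb : (k <= size bl)%N.
      by rewrite -(leq_add2l t) -sz leq_add2r ltnW.
    apply: (UM); rewrite -(cat_take_drop k bl) big_cat /= mulrC; apply: UM.
    apply: Uk; first by rewrite size_takel.
    by move=> x /mem_take; apply: blJ.
  rewrite /= addnS => sz blJ lJ'; rewrite big_cons.
  have [b [c [Jb ->]]] := lJ' a (mem_head _ _).
  have lJ'' x : x \in l' -> adj (M := A^o) (foldl (adj (M := A^o)) [set 0] gs) g x.
    by move=> xl; apply: lJ'; rewrite in_cons xl orbT.
  set Q := \prod_(x <- l') x; set B := \prod_(x <- bl) x.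
  have -> : g ^+ i * B * ((b + c *: (g : A^o)) * Q) =
      g ^+ i * (b * B) * Q + c * (g ^+ i.+1 * B * Q).
    by rewrite /GRing.scale /= exprS; ring.
  apply: UD; last by apply/UM/IHl => //; rewrite -sz !addSn.
  have -> : (b : A) * B = \prod_(x <- (b : A) :: bl) x by rewrite big_cons.
  apply: IHl => //; first by rewrite /= addnS addSn.
  by move=> x; rewrite in_cons => /predU1P[->|] //; apply: blJ.
by have := H l 0%N [::]; rewrite expr0 big_nil !mul1r => /(_ szl _ lJ); apply.
Qed.

End IdealBasics.

(** * Noetherian polynomial rings *)

Lemma noeth_image (A B : comNzRingType) (h : {rmorphism A -> B}) :
  (forall y, exists x, h x = y) -> noeth A -> noeth B.
Proof.
move=> hsurj nA I [I0 ID IM].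
have [|s [sI Is]] := nA [set x | I (h x)].
  split=> /= [|x y Ix Iy|a x Ix]; first by rewrite rmorph0.
    by rewrite rmorphD; apply: ID.
  by rewrite rmorphM; apply: IM.
exists (map h s); split=> [_ /mapP[x xs ->]|y]; first exact: sI.
have [x <-] := hsurj y; move=> /Is {y}.
apply: (adjs_min (M := A^o) (C := [set x | foldl (adj (M := B^o)) [set 0] (map h s) (h x)])).
- have [C0 CD CZ] := submod_adjs (M := B^o) (map h s) (submod0 B^o).
  split=> /= [|y z Cy Cz|a y Cy]; first by rewrite rmorph0.
    by rewrite rmorphD; apply: CD.
  by rewrite rmorphM; apply: CZ.
- by move=> _ -> /=; rewrite rmorph0; case: (submod_adjs (M := B^o) (map h s) (submod0 B^o)).
- move=> y ys /=; apply: mem_adjs; first exact: submod0.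
  exact: map_f.
Qed.
Arguments adj {A M}.

Lemma mpoly_subring_ind (R : comNzRingType) (n : nat) (P : {mpoly R[n]} -> Prop) :
  (forall c, P c%:MP) -> (forall i, P 'X_i) ->
  (forall p q, P p -> P q -> P (p + q)) -> (forall p q, P p -> P q -> P (p * q)) ->
  forall p, P p.
Proof.
move=> PC PX PD PM p; rewrite (mpolyE p); apply: (big_ind P) => [|x y|m _]; [exact: (PC 0) | exact: PD | ].
 rewrite -mul_mpolyC; apply: (PM) => //.
rewrite mpolyXE_id; apply: (big_ind P) => [|x y|i _]; [exact: (PC 1) | exact: PM | ].
by elim: (m i) => [|k IH]; [exact: (PC 1) | rewrite exprS; exact: PM].
Qed.

Section Hilbert.
Variable A : comNzRingType.
Local Notation span G := (foldl (adj (M := {poly A}^o)) [set 0] G).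

Let submod_span (G : seq {poly A}) : submod (M := {poly A}^o) (span G).
Proof. exact/submod_adjs/submod0. Qed.

Let span_sub (G G' : seq {poly A}) : {subset G <= G'} -> span G `<=` span G'.
Proof.
move=> GG'; apply: (adjs_min (M := {poly A}^o)) => //.
  by move=> _ ->; case: (submod_span G').
by move=> y /GG' yG; apply: (mem_adjs (M := {poly A}^o)) => //; apply: submod0.
Qed.

Theorem hilbert_basis : noeth A -> noeth {poly A}.
Proof.
move=> nA I idI; have [I0 ID IM] := idI.
pose L d : set A := [set c | exists q, [/\ I q, (size q <= d.+1)%N & q`_d = c]].
have idL d : is_ideal (L d).
  split=> [|x y [p [Ip sp px]] [q [Iq sq qy]]|a x [p [Ip sp px]]].
  - by exists 0; rewrite size_poly0 coef0.
  - exists (p + q); split; [exact: ID| |by rewrite coefD px qy].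
    by rewrite (leq_trans (size_polyD _ _)) // geq_max sp.
  - exists (a%:P * p); split; [exact: IM| |by rewrite coefCM px].
    by rewrite mul_polyC (leq_trans (size_scale_leq _ _)).
have LS d : L d `<=` L d.+1.
  move=> x [p [Ip sp px]]; exists ('X * p); split; [exact: IM| |].
    by rewrite (leq_trans (size_polyMleq _ _)) // size_polyX.
  by rewrite coefXM.
have [D LD] := noeth_chain nA idL LS.
have lead d : exists G : seq {poly A}, (forall q, q \in G -> I q) /\
    forall c, L d c -> exists q, [/\ span G q, (size q <= d.+1)%N & q`_d = c].
  have [s [sL Ls]] := nA _ (idL d).
  suff [G [GI Gs]] : exists G : seq {poly A}, (forall q, q \in G -> I q) /\
     forall c, c \in s -> exists q, [/\ span G q, (size q <= d.+1)%N & q`_d = c].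
    exists G; split=> // c /Ls.
    apply: (adjs_min (M := A^o) (C := [set c | exists q,
       [/\ span G q, (size q <= d.+1)%N & q`_d = c]])) => //.
      have [G0 GD GM] := submod_span G.
      split=> [|x y [p [Ip sp px]] [q [Iq sq qy]]|a x [p [Ip sp px]]].
      - by exists 0; rewrite size_poly0 coef0.
      - exists (p + q); split; [exact: GD| |by rewrite coefD px qy].
        by rewrite (leq_trans (size_polyD _ _)) // geq_max sp.
      - exists (a%:P * p); split; [exact: GM| |by rewrite coefCM px].
        by rewrite mul_polyC (leq_trans (size_scale_leq _ _)).
    move=> _ ->; exists 0; rewrite size_poly0 coef0; split=> //.
    by case: (submod_span G).
  elim: s sL {Ls} => [|c s IH] sL; first by exists [::].
  have [|G [GI Gs]] := IH; first by move=> x xs; apply: sL; rewrite in_cons xs orbT.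
  have [q [Iq sq qc]] := sL c (mem_head _ _).
  exists (q :: G); split=> [r|x]; rewrite in_cons => /predU1P[->|] //; first exact: GI.
    exists q; split=> //; apply: (mem_adjs (M := {poly A}^o)); first exact: submod0.
    exact: mem_head.
  move=> /Gs[r [Gr sr rx]]; exists r; split=> //; apply: span_sub Gr.
  by move=> y yG; rewrite in_cons yG orbT.
have [G [GI Gs]] : exists G : seq {poly A}, (forall q, q \in G -> I q) /\
    forall d c, (d <= D)%N -> L d c ->
      exists q, [/\ span G q, (size q <= d.+1)%N & q`_d = c].
  elim: D {LD} => [|D [G [GI Gs]]].
    by have [G [GI Gs]] := lead 0%N; exists G; split=> // d c; rewrite leqn0 => /eqP ->; apply: Gs.
  have [H [HI Hs]] := lead D.+1; exists (G ++ H); split=> [q|d c].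
    by rewrite mem_cat => /orP[/GI|/HI].
  rewrite leq_eqVlt => /predU1P[->|dD].
    move=> /Hs[q [Hq sq qc]]; exists q; split=> //; apply: span_sub Hq.
    by move=> x xH; rewrite mem_cat xH orbT.
  move=> /(Gs _ _ dD)[q [Gq sq qc]]; exists q; split=> //; apply: span_sub Gq.
  by move=> x xH; rewrite mem_cat xH.
exists G; split=> // q Iq; have [k] := ubnP (size q).
elim: k q Iq => // k IH q Iq; rewrite ltnS => sq.
have [G0 GD GM] := submod_span G.
case: k IH sq => [_|k IH sq]; first by rewrite leqn0 size_poly_eq0 => /eqP ->.
(* From degree [D] on no new leading coefficient appears: an element of [span G] of degree at most
   [D], multiplied by a power of ['X], cancels the top coefficient of [q]. *)
have [|g [Gg sg gc]] := Gs (minn k D) q`_k (geq_minr _ _).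
  case: (leqP k D) => kD; first by exists q.
  by apply: (LD k); exists q.
have -> : q = (q - 'X^(k - minn k D) * g) + 'X^(k - minn k D) * g by rewrite subrK.
apply: GD; last exact: GM.
have gI : I g by move: Gg; apply: (adjs_min (M := {poly A}^o)) => // _ ->.
apply: IH; first by rewrite -mulNr; apply: ID => //; apply: IM.
apply/leq_sizeP => j kj; rewrite coefB coefXnM.
have mk : (minn k D <= k)%N := geq_minl _ _.
rewrite ltnNge (leq_trans (leq_subr _ _) kj) /=.
case: (ltngtP k j) kj => // [kj _|<- _]; last by rewrite subKn // gc subrr.
rewrite nth_default ?(leq_trans sq) // nth_default ?subrr // (leq_trans sg) //; lia.
Qed.

End Hilbert.

(** Only a surjection is needed: evaluation at the last variable maps [{poly {mpoly R[n]}}] onto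
    [{mpoly R[n.+1]}]. *)
Lemma noeth_mpoly (R : comNzRingType) n : noeth R -> noeth {mpoly R[n]}.
Proof.
move=> nR; elim: n => [|n IH].
  by apply: (noeth_image (h := @mpolyC 0 R)) => // p; exists (p@_0%MM); apply/esym/nvar0_mpolyC.
apply: (noeth_image (h := horner_eval ('X_ord_max : {mpoly R[n.+1]}) \o
          map_poly (@mwiden n R))) (hilbert_basis IH).
apply: mpoly_subring_ind => [c|i|p q [x <-] [y <-]|p q [x <-] [y <-]].
- by exists (c%:MP)%:P; rewrite /= map_polyC /= /horner_eval hornerC mwidenC.
- case: (unliftP ord_max i) => [j ->|->].
    exists ('X_j)%:P; rewrite /= map_polyC /= /horner_eval hornerC mwidenX mnmwiden1.
    by congr 'X_ _; apply/val_inj; rewrite /= /bump leqNgt ltn_ord.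
  by exists 'X; rewrite /= map_polyX /horner_eval hornerX.
- by exists (x + y); rewrite rmorphD.
- by exists (x * y); rewrite rmorphM.
Qed.

(** * Lengths of localizations *)

Section PIndep.
Variables (R : comNzRingType) (p : set R).

(* plen B A c bounds by c the length of the localization at p of (A + B)/B: a
   sequence is p-independent mod B when each of its terms is nonzero in the
   localization at p modulo B and the previous terms. *)
Fixpoint pindep (M : lmodType R) (B : set M) (ys : seq M) : Prop :=
  if ys is y :: ys' then (forall r, B (r *: y) -> p r) /\ pindep (adj B y) ys'
  else True.

Definition plen (M : lmodType R) (B A : set M) (c : nat) : Prop :=
  forall ys : seq M, (forall y, y \in ys -> A y) -> pindep B ys -> (size ys <= c)%N.

Section Module.
Variable M : lmodType R.
Implicit Types (B C A : set M) (ys us vs : seq M).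

Lemma pindep_anti B C ys : B `<=` C -> pindep C ys -> pindep B ys.
Proof.
elim: ys B C => //= y ys IH B C BC [Cy Cys]; split=> [r /BC|]; first exact: Cy.
by apply: IH Cys; apply: adjS.
Qed.

Lemma pindep_cat B xs ys :
  pindep B (xs ++ ys) <-> pindep B xs /\ pindep (foldl adj B xs) ys.
Proof.
elim: xs B => [|x xs IH] B /=; first by split=> [|[]].
by rewrite IH; split=> [[? []]|[[]]].
Qed.

Lemma plenW B C A A' c c' : C `<=` B -> A' `<=` A -> (c <= c')%N ->
  plen C A c -> plen B A' c'.
Proof.
move=> CB AA' cc' H ys ysA' By; apply: leq_trans cc'; apply: H.
  by move=> y /ysA'/AA'.
exact: pindep_anti By.
Qed.

Hypothesis p_prime : is_prime p.

Lemma pindep_split ys B B' Bu Bv C :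
  submod B -> submod B' -> submod C -> Bu `<=` B' -> Bv `<=` B ->
  (forall x, B' x -> exists c b, [/\ C c, B b & x = c + b]) -> B `<=` B' -> C `<=` B' ->
  pindep B ys -> exists us vs,
  [/\ {subset us <= ys}, (forall v, v \in vs -> C v), pindep Bu us, pindep Bv vs
    & (size us + size vs = size ys)%N].
Proof.
elim: ys B B' Bu Bv => [|y ys IH] B B' Bu Bv sB sB' sC uB vB dec BB' CB' /=.
  by exists [::], [::].
move=> [By indy].
have [_ BD BZ] := sB; have [_ B'D B'Z] := sB'; have [_ CD CZ] := sC.
have dec' x : adj B' y x -> exists c b, [/\ C c, adj B y b & x = c + b].
  move=> [b' [a [/dec[c [b [Cc Bb ->]]] ->]]]; exists c, (b + a *: y).
  by split; [ | exists b, a | rewrite addrA].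
have sB1 := submod_adj y sB; have sB1' := submod_adj y sB'.
have BB1' : adj B y `<=` adj B' y by apply: adjS.
have CB1' : C `<=` adj B' y by apply: (subset_trans CB'); apply: sub_adj.
case: (pselect (forall r, B' (r *: y) -> p r)) => H.
  have [||us [vs [usy vC indu indv sz]]] := IH _ _ (adj Bu y) Bv sB1 sB1' sC _ _ dec' BB1' CB1' indy.
  - exact: adjS.
  - by apply: (subset_trans vB); apply: sub_adj.
  exists (y :: us), vs; split=> //=; last by rewrite addSn sz.
    move=> x; rewrite !in_cons => /predU1P[->|/usy ->]; first by rewrite eqxx.
    by rewrite orbT.
  by split=> // r /uB; apply: H.
move: H => /existsNP[r /not_implyP[/dec[c [b [Cc Bb e]]] pr]].
have ec : c = r *: y - b by rewrite e addrK.
have Bc : adj B y c by exists (- b), r; split; [exact: submodN | rewrite ec addrC].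
have [||us [vs [usy vC indu indv sz]]] :=
  IH _ _ Bu (adj Bv c) sB1 sB1' sC _ _ dec' BB1' CB1' indy.
- by apply: (subset_trans uB); apply: sub_adj.
- apply: adj_min => //; apply: (subset_trans vB); exact: sub_adj.
exists us, (c :: vs); split=> //=; last by rewrite addnS sz.
- by move=> x /usy xys; rewrite in_cons xys orbT.
- by move=> v; rewrite in_cons => /predU1P[->|/vC].
split=> // r' /vB Brc; have [_ _ pp] := p_prime.
have /pp [] // : p (r' * r).
apply: By; rewrite -scalerA; apply: (submod_addr (y := - (r' *: b))) => //.
  by apply: submodN => //; apply: BZ.
by rewrite -scalerBr -ec.
Qed.

Lemma plen_add B C A c1 c2 : submod B -> submod C -> B `<=` C ->
  plen C A c1 -> plen B C c2 -> plen B A (c1 + c2).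
Proof.
move=> sB sC BC H1 H2 ys yA ind.
have [|us [vs [usy vC indu indv <-]]] :=
  pindep_split sB sC sC (@subset_refl _ C) (@subset_refl _ B) _ BC (@subset_refl _ C) ind.
  by move=> x Cx; exists x, 0; rewrite addr0; split=> //; case: sB.
by apply: leq_add; [apply: H1 => // y /usy/yA | apply: H2].
Qed.

Lemma plen_cyclic B e : submod B -> (forall r, p r -> B (r *: e)) -> plen B (adj B e) 1.
Proof.
move=> sB pe [|y [|z ys]] // yA /= [By [Bz _]]; exfalso.
have [_ BD BZ] := sB; have [_ p1 _] := p_prime.
have [b [a [Bb ey]]] := yA y (mem_head _ _).
have [|c [d [Bc ez]]] := yA z; first by rewrite !in_cons eqxx orbT.
(* Modulo [B] one has [a z = d y], so the independence of [z] after [y] forces [a] into [p]; then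
   [y] lies in [B]. *)
have ya : p a.
  apply: Bz; exists (a *: c - d *: b), d; split.
    by apply: submodB => //; apply: BZ.
  by rewrite ez ey !scalerDr !scalerA [d * a]mulrC addrA subrK.
apply: p1; apply: By; rewrite scale1r ey; apply: BD => //; exact: pe.
Qed.

Lemma plen_gens B gs : submod B -> (forall g r, g \in gs -> p r -> B (r *: g)) ->
  plen B (foldl adj B gs) (size gs).
Proof.
elim: gs B => [|g gs IH] B sB pg.
  case=> // y ys /(_ y (mem_head _ _)) /= By [/(_ 1)]; rewrite scale1r => /(_ By) p1.
  by have [_ /(_ p1)] := p_prime.
rewrite /= -addn1; apply: (plen_add (C := adj B g)) => //.
- exact: submod_adj.
- exact: sub_adj.
- apply: IH; first exact: submod_adj.
  by move=> h r hgs pr; apply: sub_adj; apply: pg => //; rewrite in_cons hgs orbT.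
- by apply: plen_cyclic => // r; apply: pg; apply: mem_head.
Qed.

Lemma mem_adjsE B ys x : submod B -> foldl adj B ys x ->
  exists (c : nat -> R) b, B b /\ x = b + \sum_(k < size ys) c k *: ys`_k.
Proof.
move=> sB; elim/last_ind: ys x => [|ys y IH] x.
  by move=> /= Bx; exists (fun=> 0), x; rewrite big_ord0 addr0.
rewrite foldl_rcons => -[b' [a [/IH[c [b [Bb ->]]] ->]]].
exists (fun k => if (k < size ys)%N then c k else a), b; split=> //.
rewrite size_rcons big_ord_recr /= ltnn nth_rcons ltnn eqxx addrA.
by do 2!congr (_ + _); apply: eq_bigr => i _; rewrite nth_rcons ltn_ord.
Qed.

(** The first term that breaks independence gives the relation, and later terms get coefficient 0.
    The coefficient outside [p] is what makes the resulting combination of differential operators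
    nonzero modulo [p]. *)
Lemma pindepPn B ys : submod B -> ~ pindep B ys ->
  exists c : nat -> R, B (\sum_(k < size ys) c k *: ys`_k) /\
    exists2 k, (k < size ys)%N & ~ p (c k).
Proof.
move=> sB; elim/last_ind: ys => [|ys y IH]; first by case.
rewrite -cats1 => /pindep_cat ; rewrite cats1 size_rcons.
case: (pselect (pindep B ys)) => [ind H|/IH[c [Bc [k kys pk]] _]]; last first.
  exists (fun k => if (k < size ys)%N then c k else 0); split.
    rewrite big_ord_recr /= ltnn scale0r addr0.
    rewrite (eq_bigr (fun k : 'I__ => c k *: ys`_k)) // => i _.
    by rewrite nth_rcons ltn_ord.
  by exists k; [exact: ltnW | rewrite kys].
have /existsNP[r /not_implyP[/(mem_adjsE sB)[c [b [Bb e]]] pr]] :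
    ~ (forall r, foldl adj B ys (r *: y) -> p r) by move=> H'; apply: H.
exists (fun k => if (k < size ys)%N then - c k else r); split.
  rewrite big_ord_recr /= ltnn nth_rcons ltnn eqxx e.
  rewrite (eq_bigr (fun k : 'I__ => - (c k *: ys`_k))) => [|i _].
    by rewrite sumrN addrCA addNr addr0.
  by rewrite nth_rcons ltn_ord scaleNr.
by exists (size ys) => //; rewrite ltnn.
Qed.

End Module.

Section Transfer.
Variables (M N : lmodType R) (f : {linear M -> N}).

Lemma plen_preim (B A : set M) (C D : set N) c : submod A ->
  (forall x, A x -> C (f x) -> B x) -> (forall x, A x -> D (f x)) ->
  plen C D c -> plen B A c.
Proof.
move=> sA CB AD H ys yA ind; rewrite -(size_map f); apply: H.
  by move=> _ /mapP[y /yA/AD ? ->].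
elim: ys B C CB yA ind => //= y ys IH B C CB yA [By indy].
have Ay : A y by apply: yA; apply: mem_head.
have [_ AD' AZ] := sA.
split=> [r|].
  by rewrite -linearZ => /(CB _ (AZ r y Ay)) /By.
apply: IH indy; last by move=> x xys; apply: yA; rewrite in_cons xys orbT.
move=> x Ax [b [a [Cb e]]]; exists (x - a *: y), a; split; last by rewrite subrK.
apply: CB; first by apply: submodB => //; apply: AZ.
by rewrite linearB linearZ /= e addrK.
Qed.

End Transfer.

Section VGens.
Variables (M : lmodType R).
Hypothesis p_prime : is_prime p.
Implicit Types (B : set M) (U V : set R).

Definition vadj V B e : set M := [set x | exists b v, [/\ B b, V v & x = b + v *: e]].

Lemma submod_vadj V B e : is_ideal V -> submod B -> submod (vadj V B e).
Proof.
move=> [V0 VD VZ] [B0 BD BZ]; split.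
- by exists 0, 0; rewrite scale0r addr0.
- move=> _ _ [b [a [Bb Va ->]]] [c [d [Bc Vd ->]]]; exists (b + c), (a + d).
  by split; [apply: BD | apply: VD | rewrite scalerDl addrACA].
- move=> r _ [b [a [Bb Va ->]]]; exists (r *: b), (r * a).
  by split; [apply: BZ | apply: VZ | rewrite scalerDr scalerA].
Qed.

Lemma sub_vadj V B e : is_ideal V -> B `<=` vadj V B e.
Proof. by move=> [V0 _ _] x Bx; exists x, 0; rewrite scale0r addr0. Qed.

Lemma sub_vadjs V B es : is_ideal V -> B `<=` foldl (vadj V) B es.
Proof.
move=> idV; elim: es B => [|e es IH] B x Bx //=.
by apply/IH; apply: sub_vadj.
Qed.

Lemma submod_vadjs V B es : is_ideal V -> submod B -> submod (foldl (vadj V) B es).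
Proof. by move=> idV; elim: es B => //= e es IH B sB; apply/IH/submod_vadj. Qed.

Lemma mem_vadjs V B es e v : is_ideal V -> submod B -> e \in es -> V v ->
  foldl (vadj V) B es (v *: e).
Proof.
move=> idV; elim: es B => //= z es IH B sB.
rewrite in_cons => /predU1P[->|ees] Vv; last by apply: IH => //; apply: submod_vadj.
by apply: sub_vadjs => //; exists 0, v; rewrite add0r; split=> //; case: sB.
Qed.

Lemma vadjs_min V B C es : submod C -> B `<=` C ->
  (forall e v, e \in es -> V v -> C (v *: e)) -> foldl (vadj V) B es `<=` C.
Proof.
move=> sC; have [_ CD _] := sC; elim: es B => [|e es IH] B BC VC //=.
apply: IH => [x [b [v [/BC Cb Vv ->]]]|f v fes]; last first.
  by apply: VC; rewrite in_cons fes orbT.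
by apply: CD => //; apply: VC => //; apply: mem_head.
Qed.

(** Multiplication by [e] maps [V/U] onto [(B + V e)/B], and coefficients of an independent sequence
    in the image are independent. *)
Lemma plen_vadj U V B e c : is_ideal V -> submod B -> (forall u, U u -> B (u *: e)) ->
  plen (M := R^o) U V c -> plen B (vadj V B e) c.
Proof.
move=> idV sB UB H ys yA ind.
have key ys' U' B1 : B `<=` B1 -> (forall u, U' u -> B1 (u *: e)) -> submod B1 ->
    pindep B1 ys' -> (forall y, y \in ys' -> vadj V B e y) -> exists vs : seq R^o,
    [/\ size vs = size ys', (forall v, v \in vs -> V v) & pindep (M := R^o) U' vs].
  elim: ys' U' B1 => [|y ys' IH] U' B1 BB1 UB1 sB1 /=; first by exists [::].
  move=> [By indy] yA'; have [b [v [Bb Vv ey]]] := yA' y (mem_head _ _).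
  have [_ B1D B1Z] := sB1.
  have [||||vs [sz vV indv]] := IH (adj (M := R^o) U' v) (adj B1 y) _ _ _ indy _.
  - by apply: (subset_trans BB1); apply: sub_adj.
  - move=> _ [u [a [Uu ->]]]; exists (u *: e - a *: b), a; split.
      by apply: submodB => //; [apply: UB1 | apply: B1Z; apply: BB1].
    by rewrite ey [in RHS]scalerDr scalerA addrA subrK scalerDl.
  - exact: submod_adj.
  - by move=> x xys; apply: yA'; rewrite in_cons xys orbT.
  exists (v :: vs); split=> /=; first by rewrite sz.
    by move=> w; rewrite in_cons => /predU1P[->|/vV].
  split=> // r /UB1 Brv; apply: By; rewrite ey scalerDr scalerA.
  by apply: B1D => //; apply: B1Z; apply: BB1.
have [vs [<- vV indv]] := key ys U B (@subset_refl _ B) UB sB ind yA.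
exact: H.
Qed.

Lemma plen_vadjs U V B es c : is_ideal V -> submod B ->
  (forall e u, e \in es -> U u -> B (u *: e)) ->
  plen (M := R^o) U V c -> plen B (foldl (vadj V) B es) (c * size es).
Proof.
move=> idV + + H; elim: es B => [|e es IH] B sB UB.
  rewrite muln0 => -[|y ys] // yB /= [By _].
  by have [_ []] := p_prime; apply: By; rewrite scale1r; apply: yB; apply: mem_head.
rewrite /= mulnS addnC; apply: (plen_add _ (C := vadj V B e)) => //.
- exact: submod_vadj.
- exact: sub_vadj.
- apply: IH; first exact: submod_vadj.
  by move=> f u fes Uu; apply: sub_vadj => //; apply: UB => //; rewrite in_cons fes orbT.
- by apply: plen_vadj H => // u; apply: UB; apply: mem_head.
Qed.

End VGens.

Section IdealBound.
Hypotheses (nR : noeth R) (p_prime : is_prime p).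

(** Filter [V] by the ideals [W i = U + p^i V]. Each quotient is finitely generated and killed by
    [p], so it has finite length at [p]; the last term [W k] agrees with [U] locally, since [s]
    multiplies it into [U]. *)
Lemma ideal_bound (U V : set R) s k : is_ideal U -> is_ideal V -> U `<=` V -> ~ p s ->
  (forall l v, size l = k -> (forall x, x \in l -> p x) -> V v ->
    U (s * (\prod_(x <- l) x * v))) ->
  exists c, plen (M := R^o) U V c.
Proof.
move=> idU idV UV ps H.
pose W i := gen (M := R^o) [set x | U x \/ exists l v,
  [/\ size l = i, (forall x, x \in l -> p x), V v & x = \prod_(x <- l) x * v]].
have sW i : submod (M := R^o) (W i) by apply: submod_gen.
have UW i : U `<=` W i by move=> x Ux K sK; apply; left.
have VW0 : V `<=` W 0%N.
  by move=> x Vx K sK; apply; right; exists [::], x; rewrite big_nil mul1r.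
have WS i : W i.+1 `<=` W i.
  apply: (gen_min (M := R^o)) => // x [/UW //|[[|a l] [v [//= [sz] lp Vv ->]]]].
  move=> K [K0 KD KZ]; apply; right; exists l, (a * v); split=> //.
  - by move=> y yl; apply: lp; rewrite in_cons yl orbT.
  - by have [_ _] := idV; apply.
  - by rewrite big_cons; ring.
have pW i r x : p r -> W i x -> W i.+1 (r * x).
  move=> pr; apply: (gen_min (M := R^o) (K := [set x | W i.+1 (r * x)])).
    have [W0 WD WZ] := sW i.+1; split=> /= [|y z Wy Wz|a y Wy].
    - by rewrite mulr0.
    - by rewrite mulrDr; apply: WD.
    - by rewrite /GRing.scale /= mulrCA; apply: WZ.
  move=> y [Uy|[l [v [sz lp Vv ->]]]] /=.
    by apply: UW; have [_ _] := idU; apply.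
  move=> K [K0 KD KZ]; apply; right; exists (r :: l), v; split=> //=.
  - by rewrite sz.
  - by move=> z; rewrite in_cons => /predU1P[->|/lp].
  - by rewrite big_cons mulrA.
have [c Hc] : exists c, plen (M := R^o) (W k) (W 0%N) c.
  elim: {H} k => [|i [c Hc]].
    exists 0%N => -[|y ys] // yW /= [Wy _].
    by have [_ []] := p_prime; apply: Wy; rewrite scale1r; apply: yW; apply: mem_head.
  have [gs [gW Wg]] := nR (sW i).
  exists (c + size gs)%N; apply: (plen_add p_prime (sW i.+1) (sW i) (@WS i)) => //.
  have : plen (M := R^o) (W i.+1) (foldl (adj (M := R^o)) (W i.+1) gs) (size gs).
    by apply: plen_gens => // g r ggs pr; apply: pW => //; apply: gW.
  apply: plenW => //; apply: (subset_trans Wg).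
  apply: (adjs_min (M := R^o)).
  - exact: submod_adjs.
  - by move=> _ ->; case: (submod_adjs (M := R^o) gs (sW i.+1)).
  - by move=> y ygs; apply: (mem_adjs (M := R^o)).
exists (c + 0)%N; apply: (@plen_add R^o p_prime U (W k) V c 0 idU (sW k) (@UW k)).
  exact: plenW Hc.
move=> [|y ys] // yW /= [Wy _]; case: ps; apply: Wy.
have /yW : y \in y :: ys by apply: mem_head.
apply: (gen_min (M := R^o) (K := [set x | U (s * x)])).
  have [U0 UD UZ] := idU; split=> /= [|x z Ux Uz|a x Ux].
  - by rewrite mulr0.
  - by rewrite mulrDr; apply: UD.
  - by rewrite /GRing.scale /= mulrCA; apply: UZ.
move=> x [Ux|[l [v [sz lp Vv ->]]]] /=; last exact: H.
by have [_ _] := idU; apply.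
Qed.

End IdealBound.
End PIndep.

(** * Nakayama's lemma and the primes containing [tau] *)

Section Nakayama.
Variable R : comNzRingType.
Implicit Types (p q U V : set R).

(** Generators are eliminated one at a time, with multipliers outside [q] instead of a localization.
    Once the others are controlled modulo [U + q g], one gets [u u1 g = a g] modulo [U] with [a] in
    [q], and [u u1 - a] is a multiplier outside [q]. *)
Lemma nakayama_prime q U (gs : seq R) : is_prime q -> is_ideal U ->
  (forall g, g \in gs -> exists2 u, ~ q u & foldl (vadj (M := R^o) q) U gs (u * g)) ->
  exists2 u, ~ q u & forall g, g \in gs -> U (u * g).
Proof.
move=> pq; have [idq q1 qp] := pq.
elim: gs U => [|g gs IH] U idU Hgs; first by exists 1.
have [_ UD UZ] := idU.
have idU' : is_ideal (vadj (M := R^o) q U g) by apply: (submod_vadj (M := R^o)).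
have [|u qu ugs] := IH _ idU'.
  by move=> h hgs; apply: Hgs; rewrite in_cons hgs orbT.
have [u1 qu1 /= Hg] := Hgs g (mem_head _ _).
have [b [a [Ub qa e]]] : vadj (M := R^o) q U g (u * (u1 * g)).
  have [_ U'D U'Z] := idU'.
  move: Hg; apply: (vadjs_min (M := R^o) (C := [set x | vadj (M := R^o) q U g (u * x)])).
  - split=> /= [|x y Cx Cy|r x Cx]; first by rewrite mulr0; case: idU'.
      by rewrite mulrDr; apply: U'D.
    by rewrite /GRing.scale /= mulrCA; apply: U'Z.
  - by move=> x /= Ux; apply: (U'Z).
  - by move=> h v /ugs U'h _ /=; rewrite /GRing.scale /= mulrCA; apply: U'Z.
have qu2 : ~ q (u * u1 - a).
  move=> q2; have /qp [] // : q (u * u1).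
  by rewrite -(subrK a (u * u1)); have [_ qD _] := idq; apply: qD.
have U2 : U ((u * u1 - a) * g).
  by rewrite mulrBl -mulrA e addrK.
exists ((u * u1 - a) * u) => [|h].
  by case/qp.
rewrite in_cons => /predU1P[->|/ugs[c [d [Uc qd ec]]]].
  by rewrite mulrAC mulrC; apply: UZ.
rewrite -mulrA ec mulrDr; apply: UD; first exact: UZ.
by rewrite /GRing.scale /= mulrCA; apply: (UZ).
Qed.

End Nakayama.

Section KrullPIT.
Variables (R : comNzRingType) (m p : set R) (sigma tau : R).
Hypotheses (nR : noeth R) (lm : is_local m) (sop : is_sop2 m sigma tau).
Hypotheses (pp : is_prime p) (ptau : p tau) (psigma : ~ p sigma).

(* The powers of p modulo tau, and the corresponding symbolic powers. *)
Let pkt k := gen (M := R^o) [set x | x = tau \/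
  exists l, [/\ size l = k, (forall y, y \in l -> p y) & x = \prod_(y <- l) y]].

Let sym k : set R := [set r | exists2 s, ~ p s & pkt k (s * r)].

Let id_pkt k : is_ideal (pkt k). Proof. exact: (submod_gen (M := R^o)). Qed.

Let pktS k : pkt k.+1 `<=` pkt k.
Proof.
apply: (gen_min (M := R^o) (id_pkt k)) => x [->|[[|a l] [//= [sz] lp ->]]].
  by move=> K _; apply; left.
rewrite big_cons; have [_ _] := id_pkt k; apply=> K _; apply; right; exists l.
by split=> // y yl; apply: lp; rewrite in_cons yl orbT.
Qed.

Let id_sym k : is_ideal (sym k).
Proof.
have [_ p1 pM] := pp; have [D0 DD DZ] := id_pkt k; split.
- by exists 1 => //; rewrite mulr0.
- move=> x y [s ps Hs] [t pt Ht]; exists (s * t); first by case/pM.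
  have -> : s * t * (x + y) = t * (s * x) + s * (t * y) by ring.
  by apply: DD; apply: (DZ).
- by move=> a x [s ps Hs]; exists s => //; rewrite mulrCA; apply: DZ.
Qed.

Let sym_sat k s x : ~ p s -> sym k (s * x) -> sym k x.
Proof.
by move=> ps [t pt H]; have [_ _ pM] := pp; exists (t * s); [case/pM | rewrite -mulrA].
Qed.

Let symS k : sym k.+1 `<=` sym k.
Proof. by move=> x [s ps H]; exists s => //; apply: pktS. Qed.

Let sub_sym k : pkt k `<=` sym k.
Proof. by have [_ p1 _] := pp; move=> x H; exists 1; rewrite ?mul1r. Qed.

Let pm : p `<=` m.
Proof. by have [? ? _] := pp; apply: local_sub. Qed.

Let st := ideal_span [set sigma; tau].

Let idst : is_ideal st.
Proof. by rewrite /st ideal_spanE; apply: (submod_gen (M := R^o)). Qed.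

(** Some power of each generator of [m] lies in [(sigma, tau)], hence so does every product of
    enough elements of [m]; [ideal_bound] then applies with multiplier 1. *)
Let st_bound : exists c, plen m (M := R^o) st setT c.
Proof.
have [_ _ [_ st1 _ rad]] := sop; have [[idm m1 _] _] := lm.
have [gs [gm mg]] := nR idm.
have [|k Hk] := gen_pow_sub (gs := gs) idst.
  by move=> g /gm; rewrite -{1}rad => -[j Hj]; exists j.
apply: (ideal_bound (s := 1) (k := k) nR (local_prime lm)) => // l v sz lm' _.
rewrite mul1r mulrC; have [_ _] := idst; apply; apply: Hk => // x /lm'; exact: mg.
Qed.

(* The ideals sym k + (sigma) contain the m-primary ideal (sigma, tau). *)
Let stabilizes : exists k, forall x, sym k x ->
  exists y r, sym k.+1 y /\ x = y + r * sigma.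
Proof.
have [c Hc] := st_bound.
apply: contrapT => /forallNP no.
have /choice [f Hf] : forall k, exists x, sym k x /\
    ~ exists y r, sym k.+1 y /\ x = y + r * sigma.
  by move=> k; have /existsNP[x /not_implyP[Hx Hn]] := no k; exists x.
pose T k : set R := [set x | exists y r, sym k y /\ x = y + r * sigma].
have idT k : is_ideal (T k).
  have [S0 SD SZ] := id_sym k; split.
  - by exists 0, 0; rewrite mul0r addr0.
  - move=> _ _ [y [r [Sy ->]]] [z [t [Sz ->]]]; exists (y + z), (r + t).
    by split; [apply: SD | rewrite mulrDl addrACA].
  - move=> a _ [y [r [Sy ->]]]; exists (a * y), (a * r).
    by split; [apply: SZ | rewrite mulrDr mulrA].
have TS k : T k.+1 `<=` T k.
  by move=> _ [y [r [/symS Sy ->]]]; exists y, r.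
have stT k : st `<=` T k.
  rewrite /st ideal_spanE; apply: (gen_min (M := R^o) (idT k)) => x [->|->].
    by exists 0, 1; rewrite mul1r add0r; split=> //; case: (id_sym k).
  exists tau, 0; rewrite mul0r addr0; split=> //.
  by apply: sub_sym => K _; apply; left.
(* The [f k] are listed by decreasing [k]: the terms already listed lie in [T k.+1], which [f k]
   avoids, and elements outside [m] are units. *)
have key j B : B `<=` T j ->
    pindep m (M := R^o) B [seq f (j - i.+1)%N | i <- iota 0 j].
  elim: j B => [|j IH] B BT //=; rewrite subn1 /=; split=> [r|].
    move=> /BT Tr; apply: contrapT => mr.
    have [s sr] := local_unit lm mr; have [_] := Hf j; apply.
    have [_ _ TZ] := idT j.+1.
    have := TZ s _ Tr; rewrite -[r *: _]/(r * _) mulrA sr mul1r.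
    by case=> y [t [Sy e]]; exists y, t.
  rewrite -[1%N]addn0 iotaDl -map_comp.
  rewrite (eq_map (g := fun i => f (j - i.+1)%N)) => [|i]; last first.
    by rewrite /= add1n subSS.
  apply: IH; apply: (adj_min (M := R^o) (idT j)).
    by apply: (subset_trans BT); apply: TS.
  by exists (f j), 0; rewrite mul0r addr0; have [] := Hf j.
have := Hc [seq f (c.+1 - i.+1)%N | i <- iota 0 c.+1].
rewrite size_map size_iota ltnn => H; suff : false by []; apply: H => //.
exact: key.
Qed.

Theorem krull_pit : exists s k, ~ p s /\
  forall l : seq R, size l = k -> (forall x, x \in l -> p x) ->
  exists b, s * \prod_(x <- l) x = b * tau.
Proof.
have [k Hk] := stabilizes; have [msigma _ _] := sop.
have [[idm m1 _] _] := lm; have [idp p1 pM] := pp.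
have [gs [gsym symg]] := nR (id_sym k).
(* Nakayama at [m]. An element of [sym k] is [y + r sigma] with [y] in [sym k.+1]; as [sigma] is
   outside [p], the factor [r] is again in [sym k], so the second term lies in [m] times [sym k]. *)
have step1 : forall g, g \in gs -> sym k.+1 g.
  have [|u mu ugs] := nakayama_prime (gs := gs) (local_prime lm) (id_sym k.+1).
    move=> g /gsym Sg; exists 1 => //; rewrite mul1r.
    have [y [r [Sy e]]] := Hk g Sg.
    have sV := submod_vadjs (M := R^o) gs idm (id_sym k.+1).
    have [_ VD _] := sV; rewrite e; apply: (VD); first exact: (sub_vadjs (M := R^o)).
    have /symg : sym k r.
      apply: (@sym_sat k sigma) => //; rewrite mulrC.
      have -> : r * sigma = g - y by rewrite e addrC addKr.
      by apply: (submodB (M := R^o) (id_sym k)) => //; apply: symS.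
    apply: (adjs_min (M := R^o)
      (C := [set x | foldl (vadj (M := R^o) m) (sym k.+1) gs (x * sigma)])).
    - have [V0 _ VZ] := sV; split=> /= [|x z Vx Vz|a x Vx]; first by rewrite mul0r.
        by rewrite mulrDl; apply: VD.
      by rewrite -mulrA; apply: VZ.
    - by move=> _ -> /=; rewrite mul0r; case: sV.
    - by move=> h hgs /=; rewrite mulrC; apply: (mem_vadjs (M := R^o)) => //; apply: id_sym.
  by move=> g ggs; apply: (@sym_sat _ u) (ugs g ggs) => /pm.
have sub_next : sym k `<=` sym k.+1.
  apply: (subset_trans symg); apply: (adjs_min (M := R^o) (id_sym k.+1)) => // _ ->.
  by case: (id_sym k.+1).
have [hs [hp ph]] := nR (id_pkt k).
pose tR : set R := [set x | exists b, x = b * tau].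
have idtR : is_ideal tR.
  split=> [|_ _ [a ->] [b ->]|a _ [b ->]]; first by exists 0; rewrite mul0r.
    by exists (a + b); rewrite mulrDl.
  by exists (a * b); rewrite mulrA.
(* Nakayama at [p]. That [sym k] is contained in [sym k.+1] means that, locally at [p], the power
   [p^k] lies in [p^(k+1) + tau R]; hence it lies in [tau R]. *)
have [|u pu uhs] := nakayama_prime (gs := hs) pp idtR.
  move=> g /hp/sub_sym/sub_next[s ps Hs]; exists s => //.
  have sV := submod_vadjs (M := R^o) hs idp idtR.
  move: Hs; apply: (gen_min (M := R^o) sV) => x [->|].
    by apply: (sub_vadjs (M := R^o)) => //; exists 1; rewrite mul1r.
  move=> [[|a l] [//= [sz] lp ->]]; rewrite big_cons.
  have /ph : pkt k (\prod_(y <- l) y).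
    move=> K _; apply; right; exists l; split=> // y yl.
    by apply: lp; rewrite in_cons yl orbT.
  have pa : p a by apply: lp; apply: mem_head.
  apply: (adjs_min (M := R^o)
      (C := [set x | foldl (vadj (M := R^o) p) tR hs (a * x)])).
  - have [V0 VD VZ] := sV; split=> /= [|y z Vx Vz|b y Vx]; first by rewrite mulr0.
      by rewrite mulrDr; apply: VD.
    by rewrite /GRing.scale /= mulrCA; apply: VZ.
  - by move=> _ -> /=; rewrite mulr0; case: sV.
  - by move=> h hgs /=; apply: (mem_vadjs (M := R^o)).
exists u, k; split=> // l sz lp.
have /ph : pkt k (\prod_(y <- l) y) by move=> K _; apply; right; exists l.
apply: (adjs_min (M := R^o) (C := [set x | tR (u * x)])) => //; last first.
  by move=> _ -> /=; exists 0; rewrite mulr0 mul0r.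
have [V0 VD VZ] := idtR; split=> /= [|y z Vx Vz|b y Vx]; first by rewrite mulr0.
  by rewrite mulrDr; apply: VD.
by rewrite /GRing.scale /= mulrCA; apply: VZ.
Qed.

End KrullPIT.

(* If s p is not in p and kills p^k modulo tau, then s p lies in every other prime
   q of X; so the ideals generated by finitely many of the s p form a strictly
   increasing chain. *)
Lemma finite_primes_over (R : comNzRingType) (tau : R) (X : set (set R)) : noeth R ->
  (forall p, X p -> is_prime p /\ p tau) ->
  (forall p, X p -> exists s k, ~ p s /\
    forall l : seq R, size l = k -> (forall x, x \in l -> p x) ->
    exists b, s * \prod_(x <- l) x = b * tau) ->
  finite_set X.
Proof.
move=> nR Xp Xs.
have /choice [s Hs] : forall p, exists s, X p -> exists k, ~ p s /\
    forall l : seq R, size l = k -> (forall x, x \in l -> p x) ->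
    exists b, s * \prod_(x <- l) x = b * tau.
  move=> p; case: (pselect (X p)) => [/Xs[s H]|nX]; last by exists 0.
  by exists s.
have sep p q : X p -> X q -> ~ q (s p) -> p = q.
  move=> Xp' Xq qsp.
  have inc p' q' : X p' -> X q' -> ~ q' (s p') -> p' `<=` q'.
    move=> Xp1 Xq1 nq x px; have [k [_ Hk]] := Hs p' Xp1.
    have [|y|b Hb] := Hk (nseq k x); first by rewrite size_nseq.
      by rewrite mem_nseq => /andP[_ /eqP ->].
    have [[[_ _ qZ] q1 qM] qt] := Xp _ Xq1.
    have : q' (s p' * \prod_(x0 <- nseq k x) x0) by rewrite Hb; apply: qZ.
    case/qM => //; elim: k {Hk Hb} => [|k IH]; first by rewrite big_nil.
    by rewrite big_cons => /qM[].
  apply/seteqP; split; first exact: inc.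
  apply: (inc) => // psq; have [k []] := Hs q Xq.
  by move=> + _; apply; apply: (inc p q).
apply: contrapT => /infiniteP/ppcard_leP[f].
have Xf i : X (f i) by apply: funS.
have finj i j : f i = f j -> i = j by move/(@inj _ _ _ f); apply; rewrite in_setT.
pose I k := foldl (adj (M := R^o)) [set 0] [seq s (f i) | i <- iota 0 k].
have idI k : is_ideal (I k) by apply: (submod_adjs (M := R^o)); apply: submod0.
have IS k : I k.+1 = adj (M := R^o) (I k) (s (f k)).
  by rewrite /I -addn1 iotaD map_cat foldl_cat.
have [|k Ik] := noeth_chain nR idI.
  by move=> k; rewrite IS; apply: (sub_adj (M := R^o)).
have [_ [nfk _]] := Hs _ (Xf k); apply: nfk.
have [[idf _ _] _] := Xp _ (Xf k).
have : I k.+1 (s (f k)) by rewrite IS; apply: (adj_self (M := R^o)); apply: idI.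
move/Ik; apply: (adjs_min (M := R^o)) => //; first by move=> _ ->; case: idf.
move=> _ /mapP[i ik ->]; apply: contrapT => /(sep _ _ (Xf i) (Xf k))/finj ei.
by move: ik; rewrite ei mem_iota add0n ltnn andbF.
Qed.

(** * Koszul complexes and local cohomology *)

Section SubmodType.
Variables (A : comNzRingType) (N : lmodType A) (B : set N).

Definition submod_pred of submod B : {pred N} := fun x => `[< B x >].

Variable sB : submod B.

Lemma submod_pred_closed : submod_closed (submod_pred sB).
Proof.
have [B0 BD BZ] := sB; split; first exact/asboolP.
by move=> a x y /asboolP Bx /asboolP By; apply/asboolP; apply: BD => //; apply: BZ.
Qed.

HB.instance Definition _ := GRing.isSubmodClosed.Build A N (submod_pred sB) submod_pred_closed.

Definition submod_type := {x : N | x \in submod_pred sB}.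
HB.instance Definition _ := [isSub of submod_type for (@sval N (fun x => x \in submod_pred sB))].
HB.instance Definition _ := [Choice of submod_type by <:].
HB.instance Definition _ := [SubChoice_isSubLmodule of submod_type by <:].

(** Injectivity speaks of maps between modules, so [B] is first made a module of its own; [g] only
    has to be linear on [B]. *)
Lemma inj_extend (I : lmodType A) (g : N -> I) : is_injective_module I ->
  (forall a x y, B x -> B y -> g (a *: x + y) = a *: g x + g y) ->
  exists h : {linear N -> I}, forall x, B x -> h x = g x.
Proof.
move=> injI glin.
have subB (x : submod_type) : B (val x) by apply/asboolP; apply: (valP x).
have glin' : linear (fun x : submod_type => g (val x)).
  by move=> a x y; rewrite -glin ?subB//; rewrite linearP.
pose gM := GRing.isLinear.Build _ _ _ _ (fun x : submod_type => g (val x)) glin'.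
pose gL : {linear submod_type -> I} := HB.pack (fun x : submod_type => g (val x)) gM.
have [h Hh] := injI submod_type N (val : {linear submod_type -> N}) gL val_inj.
exists h => x Bx; have Px : x \in submod_pred sB by apply/asboolP.
exact: (Hh (exist _ x Px)).
Qed.

End SubmodType.

Section Lin.
Variables (S : comNzRingType).
Implicit Types M N : lmodType S.

(** A predicate rather than a bundled map, because the maps of complexes below are plain recursive
    functions. *)
Definition lin M N (h : M -> N) := forall a x y, h (a *: x + y) = a *: h x + h y.

Lemma lin0 M N (h : M -> N) : lin h -> h 0 = 0.
Proof. by move=> hl; have := hl (-1) 0 0; rewrite scaleN1r oppr0 addr0 scaleN1r addNr. Qed.
Lemma linZ M N (h : M -> N) a x : lin h -> h (a *: x) = a *: h x.
Proof. by move=> hl; rewrite -[a *: x]addr0 hl lin0 // addr0. Qed.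
Lemma linD M N (h : M -> N) x y : lin h -> h (x + y) = h x + h y.
Proof. by move=> hl; rewrite -[x]scale1r hl !scale1r. Qed.
Lemma linN M N (h : M -> N) x : lin h -> h (- x) = - h x.
Proof. by move=> hl; rewrite -scaleN1r linZ // scaleN1r. Qed.
Lemma linB M N (h : M -> N) x y : lin h -> h (x - y) = h x - h y.
Proof. by move=> hl; rewrite linD // linN. Qed.

Lemma lin_linear M N (h : {linear M -> N}) : lin h.
Proof. by move=> a x y; rewrite linearP. Qed.

End Lin.

Section Cube.
Variable S : comNzRingType.
Implicit Types (fs : seq S) (M N Q : lmodType S).

(* The Koszul/Cech cochains of all degrees: one copy of M for each subset of fs,
   built as an iterated mapping cone so that no signs are needed. *)
Fixpoint K fs M : lmodType S :=
  if fs is _ :: fs' then ((K fs' M * K fs' M)%type : lmodType S) else M.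

Fixpoint Kmap M N (h : M -> N) fs : K fs M -> K fs N :=
  match fs with
  | [::] => h
  | _ :: fs' => fun z => (Kmap h z.1, Kmap h z.2)
  end.

(** [act f] is the map along the edges of direction [f]: multiplication by [f^t] for the Koszul
    complex, a localization map for the Cech complex. *)
Fixpoint Kdiff M (act : S -> M -> M) fs : K fs M -> K fs M :=
  match fs with
  | [::] => fun=> 0
  | f :: fs' => fun z => (Kdiff act z.1, Kmap (act f) z.1 - Kdiff act z.2)
  end.

Fixpoint Kproj M fs k : K fs M -> K fs M :=
  match fs with
  | [::] => fun z => if k is 0 then z else 0
  | _ :: fs' => fun z => (Kproj k z.1, if k is k'.+1 then Kproj k' z.2 else 0)
  end.

(** The transition map from the Koszul complex on the [f^t] to that on the [f^(s+t)]: the component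
    of a subset is multiplied by the [s]-th power of its product. *)
Fixpoint Ktheta M (s : nat) fs : K fs M -> K fs M :=
  match fs with
  | [::] => id
  | f :: fs' => fun z => (Ktheta s z.1, f ^+ s *: Ktheta s z.2)
  end.

Definition kd M (t : nat) fs := @Kdiff M (fun f x => f ^+ t *: x) fs.

Lemma Kmap_lin M N (h : M -> N) fs : lin h -> lin (@Kmap M N h fs).
Proof. by move=> hl; elim: fs => [|f fs IH] //= a [x1 x2] [y1 y2] /=; rewrite !IH. Qed.

Lemma Kmap_comp M N Q (h : M -> N) (g : N -> Q) fs (z : K fs M) :
  Kmap g (Kmap h z) = Kmap (g \o h) z.
Proof. by elim: fs z => [|f fs IH] //= z; rewrite !IH. Qed.

Lemma eq_Kmap M N (h g : M -> N) fs (z : K fs M) : h =1 g -> Kmap h z = Kmap g z.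
Proof. by move=> e; elim: fs z => [|f fs IH] //= z; rewrite !IH. Qed.

Lemma Kmap_scale M a fs (z : K fs M) : Kmap (fun x => a *: x) z = a *: z.
Proof. by elim: fs z => [|f fs IH] //= z; rewrite !IH. Qed.

Lemma Kdiff_lin M (act : S -> M -> M) fs : (forall f, lin (act f)) -> lin (@Kdiff M act fs).
Proof.
move=> al; elim: fs => [|f fs IH] a x y /=; first by rewrite scaler0 addr0.
congr (_, _); first exact: IH.
by rewrite /= (Kmap_lin (al f)) IH scalerBr opprD addrACA.
Qed.

Lemma lin_scale M c : lin (fun x : M => c *: x).
Proof. by move=> a x y; rewrite scalerDr !scalerA mulrC. Qed.

Lemma kd_lin M t fs : lin (@kd M t fs).
Proof. by apply: Kdiff_lin => f; apply: lin_scale. Qed.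

Lemma kdE M t f fs (z : K (f :: fs) M) : kd t z = (kd t z.1, f ^+ t *: z.1 - kd t z.2).
Proof. by rewrite /kd /= Kmap_scale. Qed.

Lemma kd_kd M t fs (z : K fs M) : kd t (kd t z) = 0.
Proof.
elim: fs z => [|f fs IH] // [z1 z2]; rewrite !kdE /= !IH.
by rewrite (linB _ _ (@kd_lin _ _ _)) (linZ _ _ (@kd_lin _ _ _)) IH subr0 subrr.
Qed.

Lemma Kmap_diff M N (h : M -> N) act act' fs (z : K fs M) : lin h ->
  (forall f x, h (act f x) = act' f (h x)) -> Kmap h (Kdiff act z) = Kdiff act' (Kmap h z).
Proof.
move=> hl e; elim: fs z => [|f fs IH] z /=; first by rewrite (lin0 hl).
rewrite !IH (linB _ _ (Kmap_lin hl)) IH.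
by rewrite !Kmap_comp; congr (_, _ - _); apply: eq_Kmap => x; apply: e.
Qed.

Lemma Kmap_kd M N (h : M -> N) t fs (z : K fs M) : lin h ->
  Kmap h (kd t z) = kd t (Kmap h z).
Proof. by move=> hl; apply: Kmap_diff => // f x; rewrite (linZ _ _ hl). Qed.

Lemma Kproj_lin M fs k : lin (@Kproj M fs k).
Proof.
elim: fs k => [|f fs IH] [|k] a x y //=; first by rewrite scaler0 addr0.
  by rewrite IH; congr (_, _); rewrite /= scaler0 addr0.
by rewrite !IH.
Qed.

Lemma Kproj_id M fs k (z : K fs M) : Kproj k (Kproj k z) = Kproj k z.
Proof. by elim: fs k z => [|f fs IH] [|k] z //=; rewrite !IH. Qed.

Lemma Kproj_map M N (h : M -> N) fs k (z : K fs M) : lin h ->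
  Kproj k (Kmap h z) = Kmap h (Kproj k z).
Proof.
move=> hl; elim: fs k z => [|f fs IH] [|k] z //=; rewrite ?IH ?(lin0 hl) //.
by rewrite (lin0 (Kmap_lin hl)).
Qed.

Lemma Kproj_diff M (act : S -> M -> M) fs k (z : K fs M) : (forall f, lin (act f)) ->
  Kproj k (Kdiff act z) = if k is k'.+1 then Kdiff act (Kproj k' z) else 0.
Proof.
move=> al; elim: fs k z => [|f fs IH] [|k] z //=; rewrite !IH //.
rewrite (linB _ _ (@Kproj_lin _ _ _)) Kproj_map // IH; case: k => //.
by rewrite (lin0 (Kdiff_lin al)).
Qed.

Lemma Kproj_kd M t fs k (z : K fs M) :
  Kproj k (kd t z) = if k is k'.+1 then kd t (Kproj k' z) else 0.
Proof. by rewrite /kd Kproj_diff // => f; apply: lin_scale. Qed.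

Lemma Ktheta_lin M s fs : lin (@Ktheta M s fs).
Proof.
elim: fs => [|f fs IH] // a x y /=; rewrite !IH; congr (_, _).
by rewrite /= scalerDr !scalerA [a * _]mulrC.
Qed.

Lemma Kproj_theta M s fs k (z : K fs M) : Kproj k (Ktheta s z) = Ktheta s (Kproj k z).
Proof.
elim: fs k z => [|f fs IH] [|k] z //=; rewrite !IH ?(linZ _ _ (@Kproj_lin _ _ _)) ?IH //.
by rewrite (lin0 (@Ktheta_lin _ _ _)) scaler0.
Qed.

Lemma Kmap_theta M N (h : M -> N) s fs (z : K fs M) : lin h ->
  Kmap h (Ktheta s z) = Ktheta s (Kmap h z).
Proof.
by move=> hl; elim: fs z => [|f fs IH] z //=; rewrite !IH (linZ _ _ (Kmap_lin hl)) IH.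
Qed.

Lemma Ktheta_kd M s t fs (z : K fs M) : Ktheta s (kd t z) = kd (s + t) (Ktheta s z).
Proof.
elim: fs z => [|f fs IH] z //; rewrite !kdE /= !IH; congr (_, _).
rewrite (linB _ _ (@Ktheta_lin _ _ _)) (linZ _ _ (@Ktheta_lin _ _ _)) IH.
by rewrite scalerBr scalerA -exprD (linZ _ _ (@kd_lin _ _ _)).
Qed.

Lemma Ktheta_add M s t fs (z : K fs M) : Ktheta s (Ktheta t z) = Ktheta (s + t) z.
Proof.
elim: fs z => [|f fs IH] z //=; rewrite IH; congr (_, _).
by rewrite (linZ _ _ (@Ktheta_lin _ _ _)) IH scalerA -exprD.
Qed.

Lemma Kmap_kerlift M N Q (h : M -> N) (g : N -> Q) fs (z : K fs N) :
  (forall x, g x = 0 -> exists y, x = h y) -> Kmap g z = 0 -> exists y : K fs M, z = Kmap h y.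
Proof.
move=> ex; elim: fs z => [|f fs IH] z /=; first exact: ex.
move=> [/IH[y1 e1] /IH[y2 e2]]; exists (y1, y2).
by rewrite /= -e1 -e2 -surjective_pairing.
Qed.

Lemma Kmap_zero M N Q (h : M -> N) (g : N -> Q) fs (z : K fs M) : (forall y, g (h y) = 0) ->
  Kmap g (Kmap h z) = 0.
Proof. by move=> e; elim: fs z => [|f fs IH] z //=; rewrite !IH. Qed.

Lemma Kmap_inj M N (h : M -> N) fs : injective h -> injective (@Kmap M N h fs).
Proof.
by move=> hi; elim: fs => [|f fs IH] //= -[x1 x2] [y1 y2] /= [/IH -> /IH ->].
Qed.

Fixpoint Kinj M fs (x : M) : K fs M :=
  match fs with [::] => x | _ :: fs' => (Kinj fs' x, 0) end.

Lemma Kinj_lin M fs : lin (@Kinj M fs).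
Proof.
by elim: fs => [|f fs IH] // a x y /=; rewrite IH; congr (_, _); rewrite addr0; apply: esym; apply: scaler0.
Qed.

Lemma Kproj0 M fs (z : K fs M) : exists x, Kproj 0 z = Kinj fs x.
Proof.
by elim: fs z => [|f fs IH] z /=; [exists z | have [x ->] := IH z.1; exists x].
Qed.

Lemma Kproj_inj M fs (x : M) : Kproj 0 (Kinj fs x) = Kinj fs x.
Proof. by elim: fs => [|f fs IH] //=; rewrite IH. Qed.

Lemma Kinj_injective M fs : injective (@Kinj M fs).
Proof. by elim: fs => [|f fs IH] // x y /= [/IH]. Qed.

Lemma Ktheta_inj M s fs (x : M) : Ktheta s (Kinj fs x) = Kinj fs x.
Proof.
elim: fs => [|f fs IH] //=; rewrite IH (lin0 (@Ktheta_lin _ _ _)) scaler0 //.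
Qed.

Lemma Kmap_Kinj M N (h : M -> N) fs x : lin h -> Kmap h (Kinj fs x) = Kinj fs (h x).
Proof. by move=> hl; elim: fs => [|f fs IH] //=; rewrite IH (lin0 (Kmap_lin hl)). Qed.

Lemma kd_Kinj M t fs (x : M) :
  kd t (Kinj fs x) = 0 <-> forall f, f \in fs -> f ^+ t *: x = 0.
Proof.
elim: fs => [|f fs IH] //; rewrite kdE /= (lin0 (@kd_lin _ _ _)) subr0; split.
  move=> [/IH H1 H2] g; rewrite in_cons => /predU1P[->|]; last exact: H1.
  by apply: (@Kinj_injective _ fs); rewrite (linZ _ _ (@Kinj_lin _ _)) H2 (lin0 (@Kinj_lin _ _)).
move=> H; have -> : kd t (Kinj fs x) = 0.
  by apply/IH => g gfs; apply: H; rewrite in_cons gfs orbT.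
by rewrite -(linZ _ _ (@Kinj_lin _ _)) H ?mem_head // (lin0 (@Kinj_lin _ _)).
Qed.

End Cube.

Section Dual.
Variable S : comNzRingType.
Implicit Types (fs : seq S) (M : lmodType S).
Local Notation KS fs := (K fs S^o).

(* The Koszul homology differential, adjoint to kd for the pairing Kpair. *)
Fixpoint kb (t : nat) fs : KS fs -> KS fs :=
  match fs with
  | [::] => fun=> 0
  | f :: fs' => fun c => (kb t c.1 + f ^+ t *: c.2, - kb t c.2)
  end.

Fixpoint Kpair M fs : K fs M -> KS fs -> M :=
  match fs with
  | [::] => fun z c => (c : S) *: z
  | _ :: fs' => fun z c => Kpair z.1 c.1 + Kpair z.2 c.2
  end.

Lemma kb_lin t fs : lin (@kb t fs).
Proof.
elim: fs => [|f fs IH] a x y /=; first by rewrite scaler0 addr0.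
rewrite !IH; congr (_, _); last by rewrite /= opprD scalerN.
by rewrite /= !scalerDr !scalerA [f ^+ t * a]mulrC addrACA.
Qed.

Lemma Kpair_linl M fs c : lin (fun z : K fs M => Kpair z c).
Proof.
elim: fs c => [|f fs IH] c a x y /=.
  by rewrite scalerDr !scalerA mulrC.
by rewrite !IH scalerDr addrACA.
Qed.

Lemma Kpair_linr M fs (z : K fs M) : lin (Kpair z).
Proof.
elim: fs z => [|f fs IH] z a x y /=; first by rewrite scalerDl scalerA.
by rewrite !IH scalerDr addrACA.
Qed.

Lemma Kpair_kd M t fs (z : K fs M) c : Kpair (kd t z) c = Kpair z (kb t c).
Proof.
elim: fs z c => [|f fs IH] z c; first by rewrite /= scaler0 scale0r.
rewrite kdE /= (linB _ _ (@Kpair_linl _ _ _)) (linZ _ _ (@Kpair_linl _ _ _)) !IH.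
rewrite (linD _ _ (@Kpair_linr _ _ _)) (linZ _ _ (@Kpair_linr _ _ _)).
by rewrite (linN _ (@Kpair_linr _ _ _)) addrA.
Qed.

Lemma Kpair_theta M s fs (z : K fs M) c : Kpair (Ktheta s z) c = Kpair z (Ktheta s c).
Proof.
elim: fs z c => [|f fs IH] z c //=.
by rewrite (linZ _ _ (@Kpair_linl _ _ _)) (linZ _ _ (@Kpair_linr _ _ _)) !IH.
Qed.

Lemma Kpair_proj M k fs (z : K fs M) c : Kpair (Kproj k z) c = Kpair z (Kproj k c).
Proof.
elim: fs k z c => [|f fs IH] [|k] z c //=; rewrite ?IH ?scaler0 ?scale0r //.
by rewrite (lin0 (@Kpair_linl _ _ _)) (lin0 (@Kpair_linr _ _ _)).
Qed.

Lemma Kpair_repr M fs (h : KS fs -> M) : lin h -> exists z, forall c, h c = Kpair z c.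
Proof.
elim: fs h => [|f fs IH] h hl.
  by exists (h 1) => c /=; rewrite -(linZ _ _ hl); congr h; rewrite /GRing.scale /= mulr1.
have [|z1 e1] := IH (fun x => h (x, 0)).
  by move=> a x y; rewrite -hl; congr h; congr (_, _); rewrite /= addr0 scaler0.
have [|z2 e2] := IH (fun x => h (0, x)).
  by move=> a x y; rewrite -hl; congr h; congr (_, _); rewrite /= addr0 scaler0.
exists (z1, z2) => -[x y] /=; rewrite -e1 -e2 -(linD _ _ hl); congr h.
by congr (_, _); rewrite /= ?addr0 ?add0r.
Qed.

Lemma Kpair_inj M fs (z z' : K fs M) : (forall c, Kpair z c = Kpair z' c) -> z = z'.
Proof.
elim: fs z z' => [|f fs IH] z z' e; first by have := e 1; rewrite /= !scale1r.
rewrite (surjective_pairing z) (surjective_pairing z'); congr (_, _); apply: IH => c.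
  have := e (c, 0); rewrite /= !(lin0 (@Kpair_linr _ _ _)) !addr0; exact: id.
have := e (0, c); rewrite /= !(lin0 (@Kpair_linr _ _ _)) !add0r; exact: id.
Qed.

Lemma Kproj_kb t fs k (c : KS fs) : Kproj k (kb t c) = kb t (Kproj k.+1 c).
Proof.
apply: Kpair_inj => x; rewrite Kpair_proj.
have comm (u v : KS fs) : Kpair u v = Kpair v u.
  elim: fs u v {c x} => [|f fs IH] u v /=; first by rewrite /GRing.scale /= mulrC.
  by rewrite IH [Kpair u.2 _]IH.
have e : kd t (Kproj k x) = Kproj k.+1 (kd t x) by rewrite Kproj_kd.
by rewrite comm -Kpair_kd e Kpair_proj Kpair_kd comm.
Qed.

Lemma Ktheta_kb s t fs (c : KS fs) : Ktheta s (kb (s + t) c) = kb t (Ktheta s c).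
Proof.
elim: fs c => [|f fs IH] c //=.
rewrite (linD _ _ (@Ktheta_lin _ _ _ _)) (linZ _ _ (@Ktheta_lin _ _ _ _)) !IH.
rewrite (linN _ (@Ktheta_lin _ _ _ _)) IH (linZ _ _ (@kb_lin _ _)) scalerN.
by rewrite scalerA -exprD addnC.
Qed.

Hypothesis nS : noeth S.

(* The inverse system of the Koszul homology modules H_(k+1)(f^t; S) is pro-zero. *)
Lemma koszul_pro_zero fs k t : exists s, forall c : KS fs, Kproj k.+1 c = c ->
  kb (s + t) c = 0 -> exists e, Ktheta s c = kb t e.
Proof.
elim: fs k t => [|f fs IH] k t.
  by exists 0%N => c /= <- _; exists 0.
have [s1 H1] := IH k t.
(* The cycle condition on a pair [(a, b)] says that [b] is a cycle and that a power of [f] times [b]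
   is a boundary. In positive degree the first fact suffices, by induction. *)
have [s2 H2] : exists s, forall b : KS fs, Kproj k b = b -> kb (s + (s1 + t)) b = 0 ->
    (exists e, f ^+ (s + (s1 + t)) *: b = kb (s + (s1 + t)) e) ->
    exists e, f ^+ s *: Ktheta s b = kb (s1 + t) e.
  set t1 := (s1 + t)%N; case: k {H1} => [|k]; last first.
    have [s Hs] := IH k t1; exists s => b pb zb _.
    have [e ->] := Hs b pb zb; exists (f ^+ s *: e).
    by rewrite (linZ _ _ (@kb_lin _ _)).
  (* In degree 0 the element [b] is a scalar. The colon ideals of the boundaries by [f^i] increase
     with [i], and their stabilization bounds the power of [f] that is needed. *)
  pose Q i := [set x : S | exists e, f ^+ i *: Kinj (M := S^o) fs x = kb t1 e].
  have idQ i : is_ideal (Q i).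
    have il := @Kinj_lin S S^o fs; split.
    - by exists 0; rewrite (lin0 il) (lin0 (@kb_lin _ _)) scaler0.
    - move=> x y [e ex] [e' ey]; exists (e + e').
      by rewrite (linD _ _ (@kb_lin _ _)) -ex -ey -scalerDr (linD _ _ il).
    - move=> a x [e ex]; exists (a *: e).
      by rewrite (linZ _ _ (@kb_lin _ _)) -ex (linZ (M := S^o) a x il) !scalerA mulrC.
  have QS i : Q i `<=` Q i.+1.
    move=> x [e ex]; exists (f *: e).
    by rewrite (linZ _ _ (@kb_lin _ _)) -ex scalerA exprS.
  have [s Hs] := noeth_chain nS idQ QS.
  exists s => b pb _ [e ee]; have [x ex] := Kproj0 b.
  rewrite -pb ex Ktheta_inj; apply: (Hs (s + t1)%N); exists (Ktheta s e).
  by rewrite -Ktheta_kb -ee -pb ex (linZ _ _ (@Ktheta_lin _ _ _ _)) Ktheta_inj.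
exists (s1 + s2)%N => -[a b] pab H.
have pa : Kproj k.+1 a = a := congr1 fst pab.
have pb : Kproj k b = b := congr1 snd pab.
have e12 : (s1 + s2 + t = s2 + (s1 + t))%N by rewrite -addnA addnCA.
rewrite e12 in H.
have za : kb (s2 + (s1 + t)) a + f ^+ (s2 + (s1 + t)) *: b = 0 := congr1 fst H.
have /eqP : - kb (s2 + (s1 + t)) b = 0 := congr1 snd H.
rewrite oppr_eq0 => /eqP zb.
have [|e0 ee0] := H2 b pb zb.
  exists (- a); rewrite (linN _ (@kb_lin _ _)); apply/eqP; rewrite -addr_eq0 addrC.
  exact/eqP.
have [e [ee pe]] : exists e, f ^+ s2 *: Ktheta s2 b = kb (s1 + t) e /\ Kproj k.+1 e = e.
  exists (Kproj k.+1 e0); split; last by rewrite Kproj_id.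
  rewrite -Kproj_kb -ee0 (linZ _ _ (@Kproj_lin _ _ _ _)) Kproj_theta.
  by rewrite pb.
(* The correction by [e] turns the image of [a] into a cycle, to which the induction hypothesis [H1]
   applies. *)
pose a2 := Ktheta s2 a + f ^+ (s1 + t) *: e.
have [||e2 ee2] := H1 a2.
- rewrite /a2 (linD _ _ (@Kproj_lin _ _ _ _)) (linZ _ _ (@Kproj_lin _ _ _ _)).
  by rewrite Kproj_theta pa pe.
- rewrite /a2 (linD _ _ (@kb_lin _ _)) (linZ _ _ (@kb_lin _ _)) -ee -Ktheta_kb.
  rewrite scalerA -exprD -(linZ _ _ (@Ktheta_lin _ _ _ _)) -(linD _ _ (@Ktheta_lin _ _ _ _)).
  by rewrite [(_ + s2)%N]addnC za (lin0 (@Ktheta_lin _ _ _ _)).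
exists (e2, - (f ^+ s1 *: Ktheta s1 e)).
rewrite /= (linN _ (@kb_lin _ _)) opprK (linZ _ _ (@kb_lin _ _)) -Ktheta_kb -ee -ee2 /a2.
rewrite -!Ktheta_add (linD _ _ (@Ktheta_lin _ _ _ _)) !(linZ _ _ (@Ktheta_lin _ _ _ _)).
congr (_, _); last by rewrite scalerA -exprD.
by rewrite scalerN scalerA -exprD addnC addrK.
Qed.

(** Duality with Koszul homology. As that homology is pro-zero, the pairing of [z] with [Ktheta s c]
    depends only on the boundary [kb (s + t) c]. The functional on boundaries so obtained extends by
    injectivity of [I], and the extension is the pairing with some cochain [w]. *)
Lemma koszul_acyclic (I : lmodType S) fs k t (z : K fs I) : is_injective_module I ->
  Kproj k.+1 z = z -> kd t z = 0 ->
  exists s w, Kproj k w = w /\ Ktheta s z = kd (s + t) w.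
Proof.
move=> injI pz dz; have [s Hs] := koszul_pro_zero fs k t.
pose B : set (KS fs) := [set x | exists c, Kproj k.+1 c = c /\ x = kb (s + t) c].
have kl := @kb_lin (s + t) fs; have pl := @Kproj_lin S S^o fs k.+1.
have sB : submod B.
  split; first by exists 0; rewrite (lin0 pl) (lin0 kl).
    move=> _ _ [c [pc ->]] [d [pd ->]]; exists (c + d).
    by rewrite (linD _ _ pl) (linD _ _ kl) pc pd.
  by move=> a _ [c [pc ->]]; exists (a *: c); rewrite (linZ _ _ pl) (linZ _ _ kl) pc.
have /choice [g Hg] : forall x, exists c, B x -> Kproj k.+1 c = c /\ x = kb (s + t) c.
  by move=> x; case: (pselect (B x)) => [[c H]|nB]; [exists c | exists 0].
have wd c c' : Kproj k.+1 c = c -> Kproj k.+1 c' = c' -> kb (s + t) c = kb (s + t) c' ->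
    Kpair z (Ktheta s c) = Kpair z (Ktheta s c').
  move=> pc pc' e; have [||d ed] := Hs (c - c').
  - by rewrite (linB _ _ pl) pc pc'.
  - by rewrite (linB _ _ kl) e subrr.
  apply/eqP; rewrite -subr_eq0 -(linB _ _ (@Kpair_linr _ _ _)).
  rewrite -(linB _ _ (@Ktheta_lin _ _ _ _)) ed -Kpair_kd dz.
  by rewrite (lin0 (@Kpair_linl _ _ _)).
have [a x y Bx By|h Hh] := inj_extend sB (g := fun x => Kpair z (Ktheta s (g x))) injI.
  have [pgx ex] := Hg x Bx; have [pgy ey] := Hg y By.
  have Baxy : B (a *: x + y) by have [_ BD BZ] := sB; apply: BD => //; apply: BZ.
  have [pgs es] := Hg _ Baxy.
  rewrite -(@Kpair_linr _ _ _ _ _ _) -(@Ktheta_lin _ _ _ _ _ _ _); apply: wd => //.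
    by rewrite pl pgx pgy.
  by rewrite kl -ex -ey -es.
have [w Hw] := Kpair_repr (@lin_linear _ _ _ h).
exists s, (Kproj k w); split; first by rewrite Kproj_id.
rewrite -[RHS](Kproj_kd (s + t) k.+1); apply: Kpair_inj => c.
rewrite Kpair_proj Kpair_kd -Hw Hh; last first.
  by exists (Kproj k.+1 c); rewrite Kproj_id.
have [pg eg] : Kproj k.+1 (g (kb (s + t) (Kproj k.+1 c))) = g (kb (s + t) (Kproj k.+1 c))
    /\ kb (s + t) (Kproj k.+1 c) = kb (s + t) (g (kb (s + t) (Kproj k.+1 c))).
  by apply: Hg; exists (Kproj k.+1 c); rewrite Kproj_id.
rewrite -(wd (Kproj k.+1 c)) ?Kproj_id // -Kpair_theta -Kpair_proj Kproj_theta pz.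
by rewrite Kpair_theta.
Qed.

End Dual.

(** * Local cohomology classes as Koszul classes *)

Section DimensionShift.
Variable S : comNzRingType.
Hypothesis nS : noeth S.
Variables (J : set S) (fs : seq S).
Hypotheses (fsJ : forall f, f \in fs -> J f) (Jfs : J `<=` foldl (adj (M := S^o)) [set 0] fs).

Lemma torsionP (M : lmodType S) (x : M) :
  torsion J x <-> exists t, forall f, f \in fs -> f ^+ t *: x = 0.
Proof.
split=> [[k Hk]|[t Ht]].
  exists k => f ffs; apply: Hk; rewrite /ideal_exp ideal_spanE => I _; apply.
  by exists (fun=> f); split=> [_|]; [exact: fsJ | rewrite prodr_const card_ord].
have idA : is_ideal (annihilator x).
  split=> [|a b ax bx|a b bx]; rewrite /annihilator /=.
  - by rewrite scale0r.
  - by rewrite scalerDl ax bx addr0.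
  - by rewrite -scalerA bx scaler0.
have [|k Hk] := gen_pow_sub (gs := fs) idA; first by move=> f ffs; exists t; apply: Ht.
exists k => a; rewrite /ideal_exp ideal_spanE; apply: (gen_min (M := S^o) idA).
move=> _ [b [Jb ->]]; have := Hk [seq b i | i <- enum 'I_k].
rewrite size_map size_enum_ord big_map big_enum; apply=> // _ /mapP[i _ ->].
exact: Jfs.
Qed.

Variables (M : lmodType S) (I : injective_resolution M).

Let D j := lin_linear (ires_diff I j).

(** [z] becomes a coboundary in the direct limit along the maps [Ktheta]; [Zr] restricts the
    admissible primitives. *)
Definition triv (N : lmodType S) t (Zr : K fs N -> Prop) (z : K fs N) :=
  exists s w, Zr w /\ Ktheta s z = kd (s + t) w.

Let cyc j := fun w : K fs (I j) => Kmap (ires_diff I j) w = 0.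

Lemma triv_homog j k t (z : K fs (I j)) : Kproj k.+1 z = z -> triv t (@cyc j) z ->
  exists s w, [/\ cyc w, Kproj k w = w & Ktheta s z = kd (s + t) w].
Proof.
move=> pz [s [w [cw e]]]; exists s, (Kproj k w); split; last 1 first.
- by have := Kproj_kd (s + t) k.+1 w; rewrite -e Kproj_theta pz.
- by rewrite /cyc -(Kproj_map _ _ (@D j)) cw (lin0 (@Kproj_lin _ _ _ _)).
- exact: Kproj_id.
Qed.

(** A zigzag in the double complex. Writing [z = D y], the cochain [kd t y] lies one step lower in
    the resolution and one Koszul degree higher. It is trivial exactly when [z] is, the converse
    direction using acyclicity of injective modules; at the bottom the augmentation lands in [M].
    The multiples [a z] are carried along to keep the annihilator. *)
Lemma dim_shift j k t (z : K fs (I j)) : Kproj k.+1 z = z -> cyc z -> kd t z = 0 ->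
  exists t' (zeta : K fs M), forall a,
    triv t (@cyc j) (a *: z) <-> triv t' (fun=> True) (a *: zeta).
Proof.
elim: j k z => [|j IH] k z pz cz dz.
  have [zeta ez] := Kmap_kerlift (fun x => proj1 (@ires_exact0 _ _ I x)) cz.
  have A := lin_linear (ires_aug I).
  exists t, zeta => a; split=> -[s [w [cw e]]].
    have [w' ew] := Kmap_kerlift (fun x => proj1 (@ires_exact0 _ _ I x)) cw.
    exists s, w'; split=> //; apply: (Kmap_inj (@ires_aug_inj _ _ I)).
    by rewrite Kmap_kd // -ew -e ez -(linZ _ _ (Kmap_lin A)) Kmap_theta.
  exists s, (Kmap (ires_aug I) w); split.
    by apply: Kmap_zero => y; apply/ires_exact0; exists y.
  by rewrite -Kmap_kd // -e Kmap_theta // (linZ _ _ (Kmap_lin A)) -ez.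
have [y0 ey0] := Kmap_kerlift (fun x => proj1 (@ires_exactS _ _ I _ x)) cz.
have [y [ey py]] : exists y, z = Kmap (ires_diff I j) y /\ Kproj k.+1 y = y.
  exists (Kproj k.+1 y0); rewrite Kproj_id; split=> //.
  by rewrite -Kproj_map // -ey0.
have cz' : cyc (kd t y) by rewrite /cyc Kmap_kd // -ey.
have pz' : Kproj k.+2 (kd t y) = kd t y by rewrite Kproj_kd py.
have [t' [zeta H]] := IH k.+1 _ pz' cz' (kd_kd _ _).
exists t', zeta => a; rewrite -H {H IH}.
have DDz w : Kmap (ires_diff I j.+1) (Kmap (ires_diff I j) w : K fs (I j.+1)) = 0.
  by apply: Kmap_zero => v; apply/ires_exactS; exists v.
have L N s := @Ktheta_lin S N s fs; have kl N s := @kd_lin S N s fs.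
have paz : Kproj k.+2 (a *: kd t y) = a *: kd t y.
  by rewrite (linZ _ _ (@Kproj_lin _ _ _ _)) pz'.
split=> [[s [w [cw e]]]|/(triv_homog paz)[s [w [cw pw e]]]].
  have [w' ew] := Kmap_kerlift (fun x => proj1 (@ires_exactS _ _ I _ x)) cw.
  exists s, (Ktheta s (a *: y) - kd (s + t) w'); split.
    rewrite /cyc (linB _ _ (Kmap_lin (@D j))) Kmap_kd // -ew -e Kmap_theta //.
    by rewrite (linZ _ _ (Kmap_lin (@D j))) -ey subrr.
  by rewrite (linB _ _ (kl _ _)) kd_kd subr0 -Ktheta_kd (linZ _ _ (kl _ _)).
pose v := Ktheta s (a *: y) - w.
have pv : Kproj k.+1 v = v.
  by rewrite (linB _ _ (@Kproj_lin _ _ _ _)) Kproj_theta (linZ _ _ (@Kproj_lin _ _ _ _)) py pw.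
have dv : kd (s + t) v = 0.
  by rewrite (linB _ _ (kl _ _)) -Ktheta_kd (linZ _ _ (kl _ _)) e subrr.
have [s' [u [_ eu]]] := koszul_acyclic nS (@ires_injective _ _ I j) pv dv.
exists (s' + s)%N, (Kmap (ires_diff I j) u); split; first exact: DDz.
rewrite -Kmap_kd // -addnA -eu Kmap_theta // /v (linB _ _ (Kmap_lin (@D j))) cw subr0.
by rewrite Kmap_theta // (linZ _ _ (Kmap_lin (@D j))) -ey Ktheta_add.
Qed.

(** A class and its Koszul counterpart have the same annihilator, which is all that associated
    primes see; no isomorphism of cohomology modules is built. *)
Theorem koszul_repr i (z : I i) : @torsion_cocycles S J M I i z ->
  exists t (zeta : K fs M), forall a : S,
    @torsion_coboundaries S J M I i (a *: z) <-> triv t (fun=> True) (a *: zeta).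
Proof.
case: i z => [|j] z [] Tz dz.
  have [x ex] := proj1 (@ires_exact0 _ _ I z) dz.
  exists 0%N, (Kinj fs x) => a; have il := @Kinj_lin S M fs.
  rewrite /= ex -(linZ _ _ (lin_linear (ires_aug I))) -(linZ _ _ il).
  split=> [/eqP|[s [w [_]]]].
    rewrite -(lin0 (lin_linear (ires_aug I))) => /eqP/ires_aug_inj ->.
    by exists 0%N, 0; split=> //; rewrite (lin0 il) (lin0 (@kd_lin _ _ _ _)) (lin0 (@Ktheta_lin _ _ _ _)).
  rewrite Ktheta_inj => /(congr1 (@Kproj _ _ _ 0)); rewrite Kproj_inj Kproj_kd.
  by rewrite -(lin0 il) => /Kinj_injective ->; rewrite (lin0 (lin_linear (ires_aug I))).
have [y ey] := proj1 (@ires_exactS _ _ I _ z) dz.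
have [t Ht] := proj1 (torsionP z) Tz.
have kl N s := @kd_lin S N s fs; have il := @Kinj_lin S (I j) fs.
(* [D y = z] is killed by the [f^t], so the Koszul coboundary of [y] takes values in the kernel of
   [D]. *)
have cz : cyc (kd t (Kinj fs y)).
  by rewrite /cyc Kmap_kd // Kmap_Kinj // -ey; apply/kd_Kinj.
have pz : Kproj 1 (kd t (Kinj fs y)) = kd t (Kinj fs y) by rewrite Kproj_kd Kproj_inj.
have [t' [zeta H]] := dim_shift pz cz (kd_kd _ _).
exists t', zeta => a; rewrite -H {H}.
have paz : Kproj 1 (a *: kd t (Kinj fs y)) = a *: kd t (Kinj fs y).
  by rewrite (linZ _ _ (@Kproj_lin _ _ _ _)) pz.
split=> [[v /torsionP[s Hs] ev]|/(triv_homog paz)[s [w [cw pw e]]]].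
  exists s, (Kinj fs (a *: y - v)); split.
    rewrite /cyc Kmap_Kinj // (linB _ _ (@D j)) (linZ _ _ (@D j)) -ey ev subrr.
    by rewrite (lin0 (@Kinj_lin _ _ _)).
  rewrite (linZ _ _ (@Ktheta_lin _ _ _ _)) Ktheta_kd Ktheta_inj (linB _ _ il) (linB _ _ (kl _ _)).
  have -> : kd (s + t) (Kinj fs v) = 0.
    by apply/kd_Kinj => f ffs; rewrite addnC exprD -scalerA Hs // scaler0.
  by rewrite subr0 (linZ _ _ il) (linZ _ _ (kl _ _)).
have [w0 ew] := Kproj0 w; rewrite pw in ew.
exists (a *: y - w0).
  apply/torsionP; exists (s + t)%N; apply/kd_Kinj.
  rewrite (linB _ _ il) (linB _ _ (kl _ _)) -ew -e (linZ _ _ il) (linZ _ _ (kl _ _)).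
  by rewrite (linZ _ _ (@Ktheta_lin _ _ _ _)) Ktheta_kd Ktheta_inj subrr.
have dw0 : ires_diff I j w0 = 0.
  apply: (@Kinj_injective _ _ fs); rewrite -Kmap_Kinj // -ew.
  by rewrite (lin0 (@Kinj_lin _ _ _)).
by rewrite /= (linB _ _ (@D j)) (linZ _ _ (@D j)) -ey dw0 subr0.
Qed.

End DimensionShift.

(** * Hasse derivatives and Bernstein's inequality *)

Section Restrict.
Variables (R : comNzRingType) (n : nat) (E : lmodType {mpoly R[n]}).
(** Restriction of scalars to [R], on an alias so that both module structures coexist; lengths are
    taken over [R]. *)
Definition res : Type := E.
HB.instance Definition _ := GRing.Zmodule.on res.
Let scale (r : R) (x : res) : res := (r%:MP : {mpoly R[n]}) *: (x : E).
Let scaleA a b v : scale a (scale b v) = scale (a * b) v.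
Proof. by rewrite /scale scalerA -mpolyCM. Qed.
Let scale1 : left_id 1 scale.
Proof. by move=> x; rewrite /scale mpolyC1 scale1r. Qed.
Let scaleDr : right_distributive scale +%R.
Proof. by move=> a x y; rewrite /scale scalerDr. Qed.
Let scaleDl v : {morph scale^~ v : a b / a + b}.
Proof. by move=> a b; rewrite /scale mpolyCD scalerDl. Qed.
HB.instance Definition _ := GRing.Zmodule_isLmodule.Build R res scaleA scale1 scaleDr scaleDl.
Lemma resZ (r : R) (x : res) : r *: x = (r%:MP : {mpoly R[n]}) *: (x : E).
Proof. by []. Qed.
End Restrict.

Lemma triangular_sum (V : zmodType) (F : nat -> nat -> V) k :
  \sum_(b < k.+1) \sum_(a < (k - b).+1) F a b =
  \sum_(m < k.+1) \sum_(b < m.+1) F (m - b)%N b.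
Proof.
pose G b m := F (m - b)%N b.
transitivity (\sum_(0 <= b < k.+1) \sum_(0 <= m < k.+1 | (b <= m)%N) G b m).
  rewrite big_mkord; apply: eq_bigr => b _.
  have bk : (b <= k)%N by rewrite -ltnS.
  rewrite -(big_mkord xpredT (fun a => F a b)) -(big_nat_widenl b 0 k.+1 xpredT) //.
  rewrite -{3}[nat_of_ord b]add0n big_addn subSn //.
  by apply: eq_bigr => a _; rewrite /G addnK.
rewrite (exchange_big_dep_nat xpredT) //= big_mkord; apply: eq_bigr => m _.
rewrite -(big_mkord xpredT (fun b => F (m - b)%N b)).
by rewrite (big_nat_widen _ _ _ _ _ (ltn_ord m)).
Qed.

Lemma mpoly_rmorph_eq (R : comNzRingType) n (T : comNzRingType)
    (f g : {rmorphism {mpoly R[n]} -> T}) :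
  (forall c, f c%:MP = g c%:MP) -> (forall i, f 'X_i = g 'X_i) -> f =1 g.
Proof.
move=> fC fX; apply: mpoly_subring_ind => // p q e e'; first by rewrite !rmorphD e e'.
by rewrite !rmorphM e e'.
Qed.

Section Hasse.
Variables (R : comNzRingType) (n : nat).
Local Notation S := {mpoly R[n]}.
Implicit Types (f g : S) (i j : 'I_n).

(* f |-> f(x + t e_i), whose coefficients are the Hasse derivatives of f. *)
Definition taylor i : S -> {poly S} :=
  mmap (polyC \o @mpolyC n R) (fun j => ('X_j)%:P + (if j == i then 'X else 0)).
HB.instance Definition _ i := GRing.RMorphism.on (taylor i).

Definition hasse i k f : S := (taylor i f)`_k.

Lemma taylorC i c : taylor i c%:MP = (c%:MP)%:P.
Proof. exact: mmapC. Qed.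

Lemma taylorX i j : taylor i 'X_j = ('X_j)%:P + (if j == i then 'X else 0).
Proof. by rewrite /taylor mmapX mmap1U. Qed.

Lemma hdCM i k c f : hasse i k (c%:MP * f) = c%:MP * hasse i k f.
Proof. by rewrite /hasse rmorphM /= taylorC coefCM. Qed.

Lemma hd_sum i k (I : Type) (r : seq I) (P : pred I) (F : I -> S) :
  hasse i k (\sum_(x <- r | P x) F x) = \sum_(x <- r | P x) hasse i k (F x).
Proof. by rewrite /hasse rmorph_sum coef_sum. Qed.

Lemma hd0 i f : hasse i 0 f = f.
Proof.
rewrite /hasse -horner_coef0.
apply: (mpoly_rmorph_eq (f := horner_eval 0 \o taylor i) (g := idfun)) => [c|j].
  by rewrite /= /horner_eval taylorC hornerC.
by rewrite /= /horner_eval taylorX hornerD hornerC; case: eqP; rewrite ?hornerX ?horner0 addr0.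
Qed.

Lemma hd_const i k c : hasse i k c%:MP = if k is 0 then c%:MP else 0.
Proof. by rewrite /hasse taylorC coefC; case: k. Qed.

Lemma hd_var i k j :
  hasse i k 'X_j = if k is k'.+1 then ((k' == 0%N) && (j == i))%:R else 'X_j.
Proof.
case: k => [|k]; first exact: hd0.
rewrite /hasse taylorX coefD coefC /= add0r; case: (j == i); last by rewrite coef0 andbF.
by rewrite coefX eqSS andbT.
Qed.

Lemma hd_mon i k (m : 'X_{1..n}) :
  hasse i k 'X_[m] = ('C(m i, k))%:R *: 'X_[m - U_(i) *+ k].
Proof.
pose m' := [multinom if j == i then 0%N else m j | j < n].
have em : m = (U_(i) *+ m i + m')%MM.
  apply/mnmP => j; rewrite mnmDE mulmnE mnm1E mnmE eq_sym.
  by case: eqP => [->|]; rewrite ?mul1n ?addn0.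
have em' : taylor i 'X_[m'] = ('X_[m'])%:P.
  rewrite mpolyXE_id !rmorph_prod; apply: eq_bigr => j _.
  rewrite !rmorphXn /= taylorX mnmE; case: eqP => _; first by rewrite !expr0.
  by rewrite addr0.
rewrite /hasse {1}em mpolyXD rmorphM /= em' mulrC coefCM -mpolyXn rmorphXn /= taylorX eqxx.
rewrite exprDn coef_sum.
have [km|mk] := leqP k (m i); last first.
  rewrite bin_small // scale0r big1 ?mulr0 // => j _.
  rewrite -polyC_exp coefMn coefCM coefXn; case: eqP => [kj|_]; last by rewrite mulr0 mul0rn.
  by have := ltn_ord j; rewrite -kj ltnS leqNgt mk.
rewrite (bigD1 (Ordinal (km : (k < (m i).+1)%N))) //= big1 ?addr0 => [|j jk].
  rewrite -polyC_exp coefMn coefCM coefXn eqxx mulr1 mulrnAr -scaler_nat.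
  rewrite mpolyXn -mpolyXD; congr (_ *: 'X_[_]).
  apply/mnmP => j; rewrite mnmDE mnmBE !mulmnE mnm1E mnmE eq_sym.
  by case: eqP => [->|_]; rewrite ?mul1n ?add0n // !mul0n addn0 subn0.
rewrite -polyC_exp coefMn coefCM coefXn; case: eqP => [kj|_]; last by rewrite mulr0 mul0rn.
by case/eqP: jk; apply/val_inj.
Qed.

(* x |-> x - t inverts x |-> x + t. *)
Lemma hd_antipode i k f :
  \sum_(b < k.+1) (-1) ^+ b *: hasse i (k - b) (hasse i b f) = if k is 0 then f else 0.
Proof.
pose Phi : {rmorphism S -> {poly S}} :=
  horner_eval 'X \o map_poly (taylor i) \o comp_poly (- 'X) \o taylor i.
have -> : (if k is 0 then f else 0) = f%:P`_k by rewrite coefC; case: k.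
rewrite -(mpoly_rmorph_eq (f := Phi) (g := @polyC S)) /=; last 2 first.
- by move=> c; rewrite taylorC comp_polyC map_polyC /= /horner_eval hornerC taylorC.
- move=> j; rewrite taylorX comp_polyD comp_polyC rmorphD /= map_polyC /= /horner_eval.
  rewrite hornerD hornerC taylorX; case: eqP => _.
    by rewrite comp_polyX rmorphN /= map_polyX hornerN hornerX addrK.
  by rewrite comp_poly0 rmorph0 horner0 !addr0.
have [N [kN sN]] : exists N, (k < N)%N /\ (size (taylor i f) <= N)%N.
  by exists (maxn k.+1 (size (taylor i f))); rewrite leq_max ltnSn leq_maxr.
have -> : taylor i f = \sum_(b < N) hasse i b f *: 'X^b.
  rewrite -[LHS]coefK poly_def (big_ord_widen _ (fun b => (taylor i f)`_b *: 'X^b) sN).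
  rewrite [RHS](bigID (fun b : 'I_N => (b < size (taylor i f))%N)) /= [X in _ + X]big1 ?addr0 //.
  by move=> b; rewrite -leqNgt => sb; rewrite /hasse nth_default // scale0r.
have ev b c : (map_poly (taylor i) ((c *: 'X^b) \Po - 'X)).['X] = (-1) ^+ b *: (taylor i c * 'X^b).
  rewrite comp_polyZ comp_Xn_poly map_polyZ hornerZ rmorphXn rmorphN /= map_polyX.
  rewrite horner_exp hornerN hornerX [(- 'X) ^+ b]exprNn mulrCA -[in LHS]signr_odd -[in RHS]signr_odd.
  by rewrite mulr_sign scaler_sign.
rewrite !rmorph_sum coef_sum /= /horner_eval.
rewrite (big_ord_widen _ (fun b => (-1) ^+ b *: hasse i (k - b) (hasse i b f)) kN).
rewrite [RHS](bigID (fun b : 'I_N => (b < k.+1)%N)) /= [X in _ = _ + X]big1 ?addr0.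
  by apply: eq_bigr => b bk; rewrite ev coefZ coefMXn ltnNge -ltnS bk /=;
    rewrite -[in LHS]signr_odd -[in RHS]signr_odd mulr_sign scaler_sign.
by move=> b; rewrite -leqNgt => kb; rewrite ev coefZ coefMXn kb mulr0.
Qed.

End Hasse.

(** * Operators satisfying the Leibniz rule *)

Section Bernstein.
Variables (R : comNzRingType) (n : nat).
Local Notation S := {mpoly R[n]}.
Variables (E : lmodType S) (D : 'I_n -> nat -> E -> E) (t : nat).
Hypothesis D_add : forall i k x y, D i k (x + y) = D i k x + D i k y.
Hypothesis D_leib : forall i k (f : S) w,
  D i k (f *: w) = \sum_(a < k.+1) hasse i a f *: D i (k - a) w.
Hypothesis D0 : forall i w, D i 0 w = w.
Implicit Types (w z : E) (Y : set E) (m : 'I_n -> nat).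

Lemma D_zero i k : D i k 0 = 0.
Proof. by apply: (addrI (D i k 0)); rewrite -D_add !addr0. Qed.

Lemma D_const i k c w : D i k ((c%:MP : S) *: w) = (c%:MP : S) *: D i k w.
Proof.
rewrite D_leib big_ord_recl subn0 hd_const big1 ?addr0 // => j _.
by rewrite hd_const scale0r.
Qed.

Lemma D_var i j k w : D i k (('X_j : S) *: w) =
  ('X_j : S) *: D i k w + (if (i == j) && (0 < k)%N then D i k.-1 w else 0).
Proof.
rewrite D_leib; case: k => [|k]; first by rewrite big_ord1 hd_var andbF addr0.
rewrite !big_ord_recl /= !hd_var /= big1 => [|a _]; last by rewrite hd_var /= scale0r.
by rewrite addr0 subn0 subSS subn0 andbT eq_sym; case: eqP => _; rewrite ?scale1r ?scale0r.
Qed.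

(** Only orders below [t] count: on the Cech complex the expansions of denominators are truncated at
    order [t]. *)
Definition stable Y := forall i k w, (k < t)%N -> Y w -> Y (D i k w).

(** The Leibniz rule inverted by means of [hd_antipode]. No division occurs, so the characteristic
    does not matter. *)
Lemma inverse_leibniz i k (f : S) w :
  f *: D i k w = \sum_(b < k.+1) ((-1) ^+ b : S) *: D i (k - b) (hasse i b f *: w).
Proof.
transitivity (\sum_(b < k.+1) \sum_(a < (k - b).+1)
    ((-1) ^+ b * hasse i a (hasse i b f)) *: D i (k - (a + b)) w); last first.
  apply: eq_bigr => b _; rewrite D_leib scaler_sumr; apply: eq_bigr => a _.
  by rewrite scalerA -subnDA addnC.
rewrite (triangular_sum (fun a b => ((-1) ^+ b * hasse i a (hasse i b f)) *: D i (k - (a + b)) w)).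
rewrite (eq_bigr (fun m : 'I_k.+1 => (if m == 0%N :> nat then f else 0) *: D i (k - m) w)).
  rewrite big_ord_recl /= subn0 big1 ?addr0 // => m _.
  by rewrite scale0r.
move=> m _.
have := hd_antipode i m f.
have -> : (if nat_of_ord m is 0 then f else 0) = (if m == 0%N :> nat then f else 0) by case: (nat_of_ord m).
move=> <-; rewrite scaler_suml; apply: eq_bigr => b _.
rewrite subnK; last by rewrite -ltnS.
by rewrite -[in LHS]signr_odd -[in RHS]signr_odd mulr_sign scaler_sign.
Qed.

(** In the inverse Leibniz formula the last term is [hasse i k f *: w] up to sign, and the others
    are derivatives of elements already known to lie in [Y]. *)
Lemma leibniz_extract Y i (f : S) w : submod Y -> stable Y ->
  (forall k, (k < t)%N -> Y (f *: D i k w)) -> forall k, (k < t)%N -> Y (hasse i k f *: w).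
Proof.
move=> sY stY H; elim/ltn_ind => k IH kt; have [_ YD YZ] := sY.
have := H k kt; rewrite inverse_leibniz big_ord_recr /= subnn D0 addrC.
set T := \sum_(b < k) _; have YT : Y T.
  have [Y0 _ _] := sY; rewrite /T; apply: (big_ind Y) => // b _; apply: (YZ); apply: stY.
    by apply: leq_ltn_trans kt; apply: leq_subr.
  by apply: IH => //; apply: ltn_trans kt.
move/(submod_addr sY YT).
move=> /(YZ ((-1) ^+ k)).
suff -> : ((-1) ^+ k : S) *: (((-1) ^+ k : S) *: (hasse i k f *: w)) = hasse i k f *: w by [].
by rewrite scalerA -exprD addnn -signr_odd odd_double expr0 scale1r.
Qed.

(** [foldr] here faces [foldl] in [hseq]: the outermost derivative of [w] is the first one to be
    transferred to [f]. *)
Definition dseq (s : seq 'I_n) m w := foldr (fun i w => D i (m i) w) w s.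
Definition hseq (s : seq 'I_n) m (f : S) := foldl (fun f i => hasse i (m i) f) f s.
Definition dmul m w := dseq (enum 'I_n) m w.

Lemma eq_dseq s m m' w : {in s, m =1 m'} -> dseq s m w = dseq s m' w.
Proof.
elim: s => //= i s IH e; rewrite e ?mem_head // IH // => j js.
by apply: e; rewrite in_cons js orbT.
Qed.

Lemma dseq_add s m x y : dseq s m (x + y) = dseq s m x + dseq s m y.
Proof. by elim: s => //= i s ->. Qed.

Lemma dseq_const s m c w : dseq s m ((c%:MP : S) *: w) = (c%:MP : S) *: dseq s m w.
Proof. by elim: s => //= i s ->; rewrite D_const. Qed.

Lemma dseq_stable Y s m w : stable Y -> {in s, forall i, (m i < t)%N} -> Y w -> Y (dseq s m w).
Proof.
move=> stY; elim: s => //= i s IH mt Yw; apply: stY; first by apply: mt; apply: mem_head.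
by apply: IH => // j js; apply: mt; rewrite in_cons js orbT.
Qed.

Definition box m := forall i, (m i < t)%N.

Lemma hseq_extract Y s (f : S) w : submod Y -> stable Y -> uniq s ->
  (forall m, box m -> Y (f *: dseq s m w)) -> forall m, box m -> Y (hseq s m f *: w).
Proof.
move=> sY stY; elim: s f => [|i s IH] f /=; first by move=> _ H m /H.
move=> /andP[is_ us] H m bm; apply: IH => // m' bm'.
apply: (leibniz_extract sY stY) (bm i) => k kt.
pose m2 j := if j == i then k else m' j.
have bm2 : box m2 by move=> j; rewrite /m2; case: eqP.
have := H m2 bm2; rewrite {1}/m2 eqxx (eq_dseq (m' := m')) // => j js.
by rewrite /m2; case: eqP => // ji; rewrite -ji js in is_.
Qed.

Lemma hseq_sum s m (I : Type) (r : seq I) (P : pred I) (F : I -> S) :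
  hseq s m (\sum_(x <- r | P x) F x) = \sum_(x <- r | P x) hseq s m (F x).
Proof. by elim: s F => //= i s IH F; rewrite hd_sum IH. Qed.

Lemma hseqCM s m c (f : S) : hseq s m (c%:MP * f) = c%:MP * hseq s m f.
Proof. by elim: s f => //= i s IH f; rewrite hdCM IH. Qed.

Lemma hseq_small s m (a : 'X_{1..n}) i : uniq s -> i \in s -> (a i < m i)%N ->
  hseq s m 'X_[a] = 0.
Proof.
elim: s a => //= j s IH a /andP[js us]; rewrite hd_mon -mul_mpolyC hseqCM.
rewrite in_cons => /predU1P[->|is_] am.
  by rewrite bin_small // mpolyC0 mul0r.
rewrite IH ?mulr0 //; rewrite mnmBE mulmnE mnm1E; case: eqP => [ji|_].
  by rewrite ji is_ in js.
by rewrite mul0n subn0.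
Qed.

Lemma hseq_diag s m (a : 'X_{1..n}) : uniq s -> {in s, m =1 a} ->
  hseq s m 'X_[a] = 'X_[[multinom if i \in s then 0%N else a i | i < n]].
Proof.
elim: s a => [|j s IH] a /=.
  by move=> _ _; congr 'X_[_]; apply/mnmP => i; rewrite mnmE.
move=> /andP[js us] e; rewrite e ?mem_head // hd_mon binn scale1r (IH _ us).
  congr 'X_[_]; apply/mnmP => i; rewrite !mnmE in_cons.
  have [->|ij] := eqVneq i j; first by rewrite (negPf js) mulmnE mnm1E eqxx mul1n subnn.
  by rewrite /= mulmnE mnm1E eq_sym (negPf ij) mul0n subn0.
move=> i is_; rewrite e ?in_cons ?is_ ?orbT // mnmBE mulmnE mnm1E; case: eqP => [ji|_].
  by rewrite ji is_ in js.
by rewrite mul0n subn0.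
Qed.

Lemma hmul_diag (a : 'X_{1..n}) : hseq (enum 'I_n) a 'X_[a] = 1.
Proof.
rewrite (@hseq_diag _ a) ?enum_uniq // -mpolyX0; congr 'X_[_].
by apply/mnmP => i; rewrite mnmE mem_enum mnm0E.
Qed.

Lemma dseq_var i s (m : 'X_{1..n}) w : uniq s -> dseq s m (('X_i : S) *: w) =
  ('X_i : S) *: dseq s m w +
  (if (i \in s) && (0 < m i)%N then dseq s (m - U_(i))%MM w else 0).
Proof.
elim: s => [|j s IH] /=; first by rewrite addr0.
move=> /andP[js us]; rewrite IH // D_add D_var in_cons -addrA; congr (_ + _).
have e i' : i' \notin s -> dseq s (m - U_(i'))%MM w = dseq s m w.
  move=> is_; apply: eq_dseq => k ks; rewrite mnmBE mnm1E.
  by case: eqP => [ik|_]; [rewrite ik ks in is_ | rewrite subn0].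
rewrite [j == i]eq_sym; have [->|ij] := eqVneq i j.
  rewrite (negPf js) /= D_zero addr0 e // mnmBE mnm1E eqxx subn1.
  by case: ifP.
rewrite /= add0r; case: ifP => // _; last exact: D_zero.
by rewrite mnmBE mnm1E (negPf ij) subn0.
Qed.

Lemma dmul_var i (m : 'X_{1..n}) w : dmul m (('X_i : S) *: w) =
  ('X_i : S) *: dmul m w + (if (0 < m i)%N then dmul (m - U_(i))%MM w else 0).
Proof. by rewrite /dmul dseq_var ?enum_uniq // mem_enum. Qed.

Section Commutators.
Variables (I : finType) (f : I -> S) (mon : I -> 'X_{1..n}).

(** The iterated commutator of the operator [\sum_b f b D^(mon b)] with the variables, taken [u i]
    times with ['X_i]. For Hasse derivatives it carries no numerical factor. *)
Definition opshift (u : 'X_{1..n}) w : E :=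
  \sum_(b | (u <= mon b)%MM) f b *: dmul (mon b - u)%MM w.

Lemma opshift_var u i w :
  opshift u (('X_i : S) *: w) = ('X_i : S) *: opshift u w + opshift (u + U_(i))%MM w.
Proof.
rewrite /opshift scaler_sumr.
have -> : \sum_(b | (u + U_(i) <= mon b)%MM) f b *: dmul (mon b - (u + U_(i)))%MM w =
    \sum_(b | (u <= mon b)%MM)
       (if (0 < (mon b - u)%MM i)%N then f b *: dmul (mon b - u - U_(i))%MM w else 0).
  rewrite -big_mkcondr; apply: eq_big => [b|b _]; last by rewrite submDA.
  rewrite mnmBE subn_gt0; apply/mnm_lepP/andP => [H|[/mnm_lepP H1 H2] j].
    split; first by apply/mnm_lepP => j; apply: leq_trans (H j); rewrite mnmDE leq_addr.
    by apply: leq_trans (H i); rewrite mnmDE mnm1E eqxx addn1.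
  by rewrite mnmDE mnm1E; case: eqP => [<-|_]; rewrite ?addn1 // addn0.
rewrite -big_split; apply: eq_bigr => b _.
rewrite dmul_var scalerDr !scalerA [f b * _]mulrC.
by case: ifP => //; rewrite scaler0.
Qed.

(** A commutator with ['X_i] is a difference of two terms: each lowers the shift [v] by one, and one
    of them raises the monomial [g] by one, so [v + g] stays in the box. *)
Lemma opshift_extract Y w : submod Y ->
  (forall g : 'X_{1..n}, box g -> Y (opshift 0%MM (('X_[g] : S) *: w))) ->
  forall u : 'X_{1..n}, box u -> Y (opshift u w).
Proof.
move=> sY H u bu.
suff G k (v g : 'X_{1..n}) : mdeg v = k -> box (v + g)%MM -> Y (opshift v (('X_[g] : S) *: w)).
  by have := G _ u 0%MM erefl; rewrite addm0 mpolyX0 scale1r; apply.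
elim: k v g => [|k IH] v g.
  by move/eqP; rewrite mdeg_eq0 => /eqP ->; rewrite add0m; apply: H.
move=> dv; have [i vi] : exists i, (0 < v i)%N.
  apply/existsP; apply: contraPT dv; rewrite negb_exists => /forallP z.
  rewrite mdegE big1 // => i _; apply/eqP; rewrite -leqn0 leqNgt; exact: z.
have ev : v = (v - U_(i) + U_(i))%MM.
  by rewrite submK //; rewrite lep1mP -lt0n.
have dv' : mdeg (v - U_(i))%MM = k.
  by apply/eqP; move: dv; rewrite {1}ev mdegD mdeg1 addn1 => -[->].
move=> bvg; rewrite ev.
have -> : opshift (v - U_(i) + U_(i))%MM (('X_[g] : S) *: w) =
    opshift (v - U_(i))%MM (('X_[U_(i) + g] : S) *: w) -
    ('X_i : S) *: opshift (v - U_(i))%MM (('X_[g] : S) *: w).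
  by rewrite mpolyXD -scalerA opshift_var addrC addKr.
apply: submodB => //; first by apply: IH => //; rewrite addmA -ev.
have [_ _ YZ] := sY; apply: YZ; apply: IH => // j.
by apply: leq_ltn_trans (bvg j); rewrite !mnmDE leq_add2r mnmBE leq_subr.
Qed.

End Commutators.
End Bernstein.

Lemma max_pindep (R : comNzRingType) (p : set R) (M : lmodType R) (B W : set M) q :
  (forall ys : seq M, (forall y, y \in ys -> W y) -> pindep p B ys -> (size ys < q)%N) ->
  exists ms : seq M, [/\ forall y, y \in ms -> W y, pindep p B ms &
    forall y, W y -> exists2 r, ~ p r & foldl adj B ms (r *: y)].
Proof.
move=> bound.
suff H k ms : (size ms + k = q)%N -> (forall y, y \in ms -> W y) -> pindep p B ms ->
    exists ms : seq M, [/\ forall y, y \in ms -> W y, pindep p B ms &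
    forall y, W y -> exists2 r, ~ p r & foldl adj B ms (r *: y)].
  by apply: (H q [::]).
elim: k ms => [|k IH] ms sz mW ind.
  by have := bound ms mW ind; rewrite -sz addn0 ltnn.
case: (pselect (forall y, W y -> exists2 r, ~ p r & foldl adj B ms (r *: y))) => H.
  by exists ms.
move/existsNP: H => [y /not_implyP[Wy Hy]].
apply: (IH (rcons ms y)); first by rewrite size_rcons -sz addSnnS.
  by move=> x; rewrite mem_rcons in_cons => /predU1P[->|/mW].
rewrite -cats1; apply/pindep_cat; split=> //=; split=> // r Hr.
by apply: contrapT => pr; apply: Hy; exists r.
Qed.

(** * Joseph's lower bound *)

Section Lower.
Variables (R : comNzRingType) (n : nat) (p : set R).
Local Notation S := {mpoly R[n]}.
Variables (E : lmodType S) (D : 'I_n -> nat -> E -> E) (t : nat).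
Hypothesis D_add : forall i k x y, D i k (x + y) = D i k x + D i k y.
Hypothesis D_leib : forall i k (f : S) w,
  D i k (f *: w) = \sum_(a < k.+1) hasse i a f *: D i (k - a) w.
Hypothesis D0 : forall i w, D i 0 w = w.
Hypothesis p_prime : is_prime p.
Hypothesis t_gt0 : (0 < t)%N.
Implicit Types (w z : E) (Y : set E).

(** [Y] is the preimage of its localization at [p]. *)
Definition saturated Y := forall r w, ~ p r -> Y ((r%:MP : S) *: w) -> Y w.

Lemma submod_res Y : submod Y -> submod (M := res E) Y.
Proof. by move=> [Y0 YD YZ]; split=> // a x Yx; apply: (YZ a%:MP). Qed.

Local Notation bx := {ffun 'I_n -> 'I_t}.
Definition bmon (b : bx) : 'X_{1..n} := [multinom (b i : nat) | i < n].

Lemma box_bmon b : box t (bmon b).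
Proof. by move=> i; rewrite mnmE. Qed.

Lemma box_bmonP (m : 'X_{1..n}) : box t m -> exists b, m = bmon b.
Proof.
move=> bm; exists [ffun i => Ordinal (bm i)].
by apply/mnmP => i; rewrite mnmE ffunE.
Qed.

Lemma bmon_inj : injective bmon.
Proof.
move=> b c e; apply/ffunP => i; apply/val_inj.
by have := congr1 (fun m : 'X_{1..n} => m i) e; rewrite !mnmE.
Qed.

Definition weyl_op (b : bx * bx) w : E := ('X_[bmon b.1] : S) *: dmul D (bmon b.2) w.

Lemma weyl_op_const b c w : weyl_op b ((c%:MP : S) *: w) = (c%:MP : S) *: weyl_op b w.
Proof. by rewrite /weyl_op /dmul dseq_const // !scalerA mulrC. Qed.

Lemma weyl_op_add b x y : weyl_op b (x + y) = weyl_op b x + weyl_op b y.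
Proof. by rewrite /weyl_op /dmul dseq_add // scalerDr. Qed.

Lemma weyl_op_stable Y b w : submod Y -> stable D t Y -> Y w -> Y (weyl_op b w).
Proof.
move=> [_ _ YZ] stY Yw; apply: YZ; apply: (dseq_stable stY) => // i _.
exact: box_bmon.
Qed.

Definition b0 : bx := [ffun=> Ordinal t_gt0].
Lemma bmon0 : bmon b0 = 0%MM.
Proof. by apply/mnmP => i; rewrite mnmE ffunE mnm0E. Qed.

Lemma dmul0 w : dmul D (0%MM : 'X_{1..n}) w = w.
Proof. by rewrite /dmul; elim: (enum _) => //= i s ->; rewrite mnm0E D0. Qed.

Lemma weyl_op0 w : weyl_op (b0, b0) w = w.
Proof. by rewrite /weyl_op /= bmon0 mpolyX0 scale1r dmul0. Qed.

(* Joseph's argument: no combination of the operators that is nonzero mod p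
   annihilates everything obtained from z by these operators. *)
Lemma weyl_op_faithful Y z (c : bx * bx -> R) j0 : submod Y -> stable D t Y -> saturated Y ->
  (forall r, p r -> Y ((r%:MP : S) *: z)) -> ~ p (c j0) ->
  (forall b, Y (\sum_j ((c j)%:MP : S) *: weyl_op j (weyl_op b z))) -> Y z.
Proof.
move=> sY stY satY pz pc H; have [Y0 YD YZ] := sY.
pose f (b : bx) : S := \sum_a (c (a, b))%:MP * 'X_[bmon a].
pose A u w := opshift D f bmon u w.
have A0 w : A 0%MM w = \sum_j ((c j)%:MP : S) *: weyl_op j w.
  rewrite /A /opshift (eq_bigl xpredT) => [|b]; last by apply/mnm_lepP => i; rewrite mnm0E.
  transitivity (\sum_a \sum_b ((c (a, b))%:MP : S) *: weyl_op (a, b) w); last first.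
    by rewrite pair_bigA; apply: eq_bigr => -[].
  rewrite exchange_big; apply: eq_bigr => b _; rewrite subm0 scaler_suml.
  by apply: eq_bigr => a _; rewrite scalerA.
(* A leading term: [bs] of top degree among the derivatives having a coefficient outside [p], then
   [as_] of top degree among the monomials beside it. Commuting with [x^bs] isolates [f bs], and
   differentiating that by [as_] isolates its coefficient; what else remains has coefficients in [p]
   and sends [z] into [Y]. *)
have [bs [as_ [pab bsmax asmax]]] : exists b a, [/\ ~ p (c (a, b)),
    (forall b' a', ~ p (c (a', b')) -> (mdeg (bmon b') <= mdeg (bmon b))%N) &
    (forall a', ~ p (c (a', b)) -> (mdeg (bmon a') <= mdeg (bmon a))%N)].
  pose Pb b := [exists a, `[< ~ p (c (a, b)) >]].
  have Pb0 : Pb j0.2 by apply/existsP; exists j0.1; apply/asboolP; rewrite -surjective_pairing.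
  case: (arg_maxnP (fun b => mdeg (bmon b)) Pb0) => b /existsP[a0 Pa0] bmax.
  case: (arg_maxnP (P := fun a => `[< ~ p (c (a, b)) >]) (fun a => mdeg (bmon a)) Pa0) => a /asboolP Pa amax.
  exists b, a; split=> // [b' a' H'|a' H'].
    by apply: bmax; apply/existsP; exists a'; apply/asboolP.
  by apply: amax; apply/asboolP.
have pd d : box t d -> forall r, p r -> Y ((r%:MP : S) *: dmul D d z).
  move=> bd r pr; rewrite -dseq_const //; apply: (dseq_stable stY) => [i _|]; first exact: bd.
  exact: pz.
have fY d : box t d -> Y (f bs *: dmul D d z).
  move=> bd; have [d' ed] : exists d' : bx, d =1 bmon d'.
    by exists [ffun i => Ordinal (bd i)] => i; rewrite mnmE ffunE.
  have -> : dmul D d z = dmul D (bmon d') z by apply: eq_dseq => i _; apply: ed.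
  have : Y (A (bmon bs) (dmul D (bmon d') z)).
    apply: (opshift_extract (t := t)) => // [g bg|]; last exact: box_bmon.
    have [g' ->] := box_bmonP bg.
    by rewrite -/(A 0%MM _) A0; apply: (H (g', d')).
  rewrite /A /opshift (bigD1 bs) /=; last exact: lepm_refl.
  have -> : (bmon bs - bmon bs = 0)%MM by apply/mnmP => i; rewrite mnmBE mnm0E subnn.
  rewrite dmul0; apply: submod_addr => //.
  apply: (big_ind Y) => // b /andP[le_b neq_b]; rewrite scaler_suml.
  apply: (big_ind Y) => // a _; rewrite mulrC -scalerA; apply: YZ.
  have pab' : p (c (a, b)).
    apply: contrapT => npab; have := bsmax _ _ npab.
    rewrite -(submK le_b) mdegD leqNgt -{1}[mdeg (bmon bs)]add0n ltn_add2r lt0n mdeg_eq0.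
    move/negPn/eqP => e0; case/eqP: neq_b; apply: bmon_inj.
    by rewrite -(submK le_b) e0 add0m.
  rewrite -dseq_const //; apply: (dseq_stable stY) => [i _|].
    by rewrite mnmBE (leq_ltn_trans (leq_subr _ _)) //; apply: box_bmon.
  apply: (pd (bmon d')) => //; exact: box_bmon.
have Yh := hseq_extract D_leib D0 sY stY (enum_uniq _) fY (@box_bmon as_).
apply: (satY (c (as_, bs))) => //.
move: Yh; rewrite hseq_sum (bigD1 as_) //= scalerDl hseqCM hmul_diag mulr1.
apply: submod_addr => //; rewrite scaler_suml; apply: (big_ind Y) => // a neq_a.
rewrite hseqCM; case: (pselect (p (c (a, bs)))) => [pa|npa].
  by rewrite mulrC -scalerA; apply: YZ; apply: pz.
have [i ai] : exists i, (bmon a i < bmon as_ i)%N.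
  apply/existsP; apply: contraR neq_a; rewrite negb_exists => /forallP le_a.
  have le_as : (bmon as_ <= bmon a)%MM by apply/mnm_lepP => i; rewrite leqNgt.
  have := asmax _ npa.
  rewrite -(submK le_as) mdegD leqNgt -{1}[mdeg (bmon as_)]add0n ltn_add2r lt0n mdeg_eq0.
  move/negPn/eqP => e0; apply/eqP; apply: bmon_inj.
  by rewrite -(submK le_as) e0 add0m.
have -> : hseq (enum 'I_n) (bmon as_) 'X_[bmon a] = 0 :> S.
  by apply: hseq_small ai; rewrite ?enum_uniq ?mem_enum.
by rewrite mulr0 scale0r.
Qed.

(** Put [q = t^n] and suppose that [W] has length below [q] modulo [Y]. Let [ms] be maximal
    independent among the elements that all operators send into [W]. The [q^2] operators evaluated
    on [ms] lie in a module of length at most [(q-1)^2], so some combination, nonzero modulo [p],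
    kills [ms] modulo [Y]. By maximality it locally kills every [weyl_op b z], which contradicts
    [weyl_op_faithful]. *)
Lemma bernstein_lower Y z (W : set (res E)) : submod Y -> stable D t Y -> saturated Y ->
  ~ Y z -> (forall r, p r -> Y ((r%:MP : S) *: z)) -> submod W ->
  (forall a b, W (weyl_op a (weyl_op b z))) ->
  exists ys : seq (res E), [/\ size ys = (t ^ n)%N, forall y, y \in ys -> W y &
    pindep p (M := res E) Y ys].
Proof.
move=> sY stY satY nYz pz sW Wz; have sYr := submod_res sY.
apply: contrapT => no.
have bound (ys : seq (res E)) : (forall y, y \in ys -> W y) ->
    pindep p (M := res E) Y ys -> (size ys < t ^ n)%N.
  move=> yW ind; rewrite ltnNge; apply/negP => le; apply: no.
  exists (take (t ^ n) ys); split; first by rewrite size_takel.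
    by move=> y /mem_take/yW.
  by move: ind; rewrite -{1}(cat_take_drop (t ^ n) ys) => /pindep_cat[].
have q_gt0 : (0 < t ^ n)%N by rewrite expn_gt0 t_gt0.
have plq : plen p (M := res E) Y W (t ^ n).-1.
  by move=> ys yW ind; rewrite -ltnS prednK //; apply: bound.
pose W1 : set (res E) := [set y | forall a, W (weyl_op a y)].
have [W0 WD WZ] := sW.
have sW1 : submod W1.
  split=> [a|x y Wx Wy a|r x Wx a].
  - by have := weyl_op_const a 0 0; rewrite mpolyC0 !scale0r => ->.
  - by rewrite weyl_op_add; apply: (WD _ _ (Wx a) (Wy a)).
  - by rewrite resZ weyl_op_const; apply: (WZ r _ (Wx a)).
have W1W y : W1 y -> W y by move=> /(_ (b0, b0)); rewrite weyl_op0.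
have [ms [msW1 indm maxm]] : exists ms : seq (res E), [/\ forall y, y \in ms -> W1 y,
    pindep p (M := res E) Y ms &
    forall y, W1 y -> exists2 r, ~ p r & foldl (adj (M := res E)) Y ms (r *: y)].
  apply: (max_pindep (q := (t ^ n)%N)) => ys yW; apply: bound => y /yW; exact: W1W.
have szm : (size ms <= (t ^ n).-1)%N.
  by apply: plq => // y /msW1/W1W.
pose E' : lmodType R := {ffun 'I_(size ms) -> res E}.
(* A filtration of the tuples in [W] that replaces [W] by [Y] one coordinate at a time. *)
pose B k : set E' := [set v | (forall i, W (v i)) /\ forall i : 'I_(size ms), (i < k)%N -> Y (v i)].
have sB k : submod (B k).
  have [Y0 YD YZ] := sYr; split.
  - by split=> i; rewrite ffunE.
  - move=> u v [Wu Yu] [Wv Yv]; split=> i; rewrite ffunE; first exact: WD.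
    by move=> ik; apply: YD; [apply: Yu | apply: Yv].
  - move=> a u [Wu Yu]; split=> i; rewrite ffunE; first exact: WZ.
    by move=> ik; apply: YZ; apply: Yu.
have BS k : B k.+1 `<=` B k.
  by move=> v [Wv Yv]; split=> // i ik; apply: Yv; apply: ltnW.
have evl (i : 'I_(size ms)) : linear (fun v : E' => v i) by move=> a u v; rewrite !ffunE.
have plB k : (k <= size ms)%N -> plen p (B k) (B 0%N) (k * (t ^ n).-1).
  elim: k => [|k IH] kms.
    rewrite mul0n => -[|y ys] // yB /= [By _]; have [_ []] := p_prime.
    by apply: By; rewrite scale1r; apply: yB; apply: mem_head.
  rewrite mulSn addnC; apply: (plen_add p_prime (sB k.+1) (sB k) (@BS k)).
    by apply: IH; apply: ltnW.
  pose ev : {linear E' -> res E} := HB.pack (fun v : E' => v (Ordinal kms))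
    (GRing.isLinear.Build _ _ _ _ (fun v : E' => v (Ordinal kms)) (evl (Ordinal kms))).
  apply: (plen_preim (f := ev) (sB k) _ _ plq) => [v [Wv Yv] Yk|v [Wv _]]; last exact: Wv.
  split=> // i; rewrite ltnS leq_eqVlt => /predU1P[ik|]; last exact: Yv.
  by have -> : i = Ordinal kms by apply: val_inj.
pose V (j : bx * bx) : E' := [ffun k : 'I__ => weyl_op j ms`_k].
have nind : ~ pindep p (B (size ms)) [seq V j | j <- enum {: bx * bx}].
  move=> ind; have := plB _ (leqnn _) _ _ ind.
  rewrite size_map -cardE card_prod !card_ffun !card_ord => H.
  have : (t ^ n * t ^ n <= size ms * (t ^ n).-1)%N.
    apply: H => _ /mapP[j _ ->]; split=> // i; rewrite ffunE.
    by apply: msW1; apply: mem_nth.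
  rewrite leqNgt; apply/negP; rewrite negbK.
  apply: (@leq_ltn_trans ((t ^ n).-1 * (t ^ n).-1)); first by rewrite leq_mul2r szm orbT.
  by case: (t ^ n)%N q_gt0 => // q _ /=; rewrite ltn_mul.
have [c0 [Bc [k0 k0s pk0]]] := pindepPn (sB _) nind.
pose c j := c0 (index j (enum {: bx * bx})).
have Ysum k : Y (\sum_j ((c j)%:MP : S) *: weyl_op j ms`_k).
  have [kms|kms] := ltnP k (size ms); last first.
    rewrite nth_default //; case: sY => Y0 _ _; rewrite big1 // => j _.
    by have := weyl_op_const j 0 0; rewrite mpolyC0 !scale0r => ->; rewrite scaler0.
  have [_ /(_ (Ordinal kms) kms)] := Bc.
  rewrite sum_ffunE; congr Y.
  rewrite -[RHS](big_enum _ _ xpredT) (big_nth (b0, b0)) big_mkord size_map.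
  apply: eq_bigr => i _; rewrite !ffunE (nth_map (b0, b0)) // ffunE resZ.
  by rewrite /c index_uniq ?enum_uniq.
case: nYz; pose j0 := nth (b0, b0) (enum {: bx * bx}) k0.
have ks : (k0 < size (enum {: bx * bx}))%N by rewrite size_map in k0s.
apply: (weyl_op_faithful (c := c) (j0 := j0)) => // [|b].
  by rewrite /c index_uniq ?enum_uniq.
pose A w := \sum_j ((c j)%:MP : S) *: weyl_op j w.
have AZ r w : A ((r%:MP : S) *: w) = (r%:MP : S) *: A w.
  rewrite scaler_sumr; apply: eq_bigr => j _.
  by rewrite weyl_op_const !scalerA; congr ((_ * _) *: _); apply: mulrC.
have AD x y : A (x + y) = A x + A y.
  by rewrite -big_split; apply: eq_bigr => j _; rewrite weyl_op_add scalerDr.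
have W1b : W1 (weyl_op b z) by move=> a; apply: Wz.
have [r pr] := maxm _ W1b.
have [Y0 YD YZ] := sY.
have sA : submod (M := res E) [set w | Y (A w)].
  split=> /= [|x y Ax Ay|a x Ax].
  - by have := AZ 0 0; rewrite mpolyC0 !scale0r => ->.
  - by rewrite AD; apply: YD.
  - by rewrite resZ AZ; apply: (YZ a%:MP).
move/(adjs_min sA) => Yr; apply: (satY r) => //; rewrite -AZ; apply: Yr.
  move=> y Yy; apply: (big_ind Y) => // j _; apply: (YZ (c j)%:MP).
  exact: weyl_op_stable.
by move=> _ /(nthP 0)[k _ <-]; apply: Ysum.
Qed.

Section Chain.
Variables (Y0 : set E) (l : nat) (P : nat -> set S) (z : nat -> E) (W : set (res E)) (c : nat).
Hypotheses (sY0 : submod Y0) (stY0 : stable D t Y0).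
Hypothesis P_prime : forall i, (i < l)%N -> is_prime (P i).
Hypothesis P_contr : forall i r, (i < l)%N -> P i r%:MP <-> p r.
Hypothesis P_ann : forall i a, (i < l)%N -> Y0 (a *: z i) <-> P i a.
Hypothesis P_order : forall i j, (i < j)%N -> (j < l)%N -> ~ (P i `<=` P j).
Hypotheses (sW : submod W) (Wz : forall i a b, (i < l)%N -> W (weyl_op a (weyl_op b (z i)))).
Hypothesis plW : plen p (M := res E) Y0 W c.

(* Elements supported on the union of the V(P i), i < j, up to elements of R outside p. *)
Let G j : set E := [set y | forall q, (forall i, (i < j)%N -> P i q) ->
  exists r k, ~ p r /\ Y0 ((r%:MP * q ^+ k : S) *: y)].

Let sG j : submod (G j).
Proof.
have [Y00 YD YZ] := sY0; have [_ p1 pM] := p_prime; split.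
- by move=> q _; exists 1, 0%N; rewrite scaler0.
- move=> x y Gx Gy q Hq; have [r [k [pr Yx]]] := Gx q Hq; have [r' [k' [pr' Yy]]] := Gy q Hq.
  exists (r * r'), (k + k')%N; split; first by case/pM.
  rewrite scalerDr; apply: YD.
    have -> : ((r * r')%:MP * q ^+ (k + k') : S) = (r'%:MP * q ^+ k') * (r%:MP * q ^+ k).
      by rewrite mpolyCM exprD; ring.
    by rewrite -scalerA; apply: YZ.
  have -> : ((r * r')%:MP * q ^+ (k + k') : S) = (r%:MP * q ^+ k) * (r'%:MP * q ^+ k').
    by rewrite mpolyCM exprD; ring.
  by rewrite -scalerA; apply: YZ.
- move=> a x Gx q Hq; have [r [k [pr Yx]]] := Gx q Hq; exists r, k; split=> //.
  by rewrite scalerA mulrC -scalerA; apply: YZ.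
Qed.

Let Gsat j r (q : S) k y : ~ p r -> (forall i, (i < j)%N -> P i q) ->
  (forall q', (forall i, (i < j)%N -> P i q') -> exists r' k', ~ p r' /\
     Y0 ((r'%:MP * q' ^+ k' : S) *: ((r%:MP * q ^+ k : S) *: y))) ->
  exists r' k', ~ p r' /\ Y0 ((r'%:MP * q ^+ k' : S) *: y).
Proof.
move=> pr Hq /(_ q Hq)[r' [k' [pr' Yy]]]; have [_ _ pM] := p_prime.
exists (r' * r), (k' + k)%N; split; first by case/pM.
by move: Yy; rewrite scalerA mpolyCM exprD mulrACA.
Qed.

Let satG j : saturated (G j).
Proof.
move=> r w pr Gw q Hq; apply: (@Gsat j r q 0) => // q' /Gw.
by rewrite expr0 mulr1.
Qed.

Let subG j : Y0 `<=` G j.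
Proof.
move=> y Yy q _; have [_ p1 _] := p_prime; exists 1, 0%N; split=> //.
by rewrite mpolyC1 mul1r expr0 scale1r.
Qed.

(** Differentiating [r q^e y] expresses [r q^e] times a derivative of [y] through lower derivatives,
    which are in [G j] by induction. A further multiplier then brings the result into [Y0], and
    [Gsat] merges the two multipliers. *)
Let stG j : stable D t (G j).
Proof.
move=> i k y + Gy; elim/ltn_ind: k => k IH kt q Hq.
have [r [e [pr Yy]]] := Gy q Hq.
apply: (@Gsat j r q e) => //; suff : G j ((r%:MP * q ^+ e : S) *: D i k y) by [].
have : G j (D i k ((r%:MP * q ^+ e : S) *: y)) by apply: subG; apply: stY0.
have [G0 GD GZ] := sG j.
rewrite D_leib big_ord_recl hd0 subn0; apply: submod_addr => //.
apply: (big_ind (G j)) => // a _; apply: GZ; apply: IH.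
  by rewrite /= /bump /= add1n ltn_subrL /=; case: (k) a => [[]|].
by apply: leq_ltn_trans kt; apply: leq_subr.
Qed.

Lemma chain_bound : (l * t ^ n <= c)%N.
Proof.
have [_ p1 pM] := p_prime; have [Y00 YD YZ] := sY0.
have mono j : G j `<=` G j.+1.
  by move=> y Gy q Hq; apply: Gy => i ij; apply: Hq; apply: ltnW.
suff [ys [sz yW ind]] : exists ys : seq (res E), [/\ size ys = (l * t ^ n)%N,
    forall y, y \in ys -> (W `&` G l) y & pindep p (M := res E) Y0 ys].
  by rewrite -sz; apply: plW => // y /yW[].
have : (l <= l)%N by [].
move: {1 3 4}l => j; elim: j => [|j IH] jl.
  by exists [::]; rewrite mul0n.
have [ys [sz yW ind]] := IH (ltnW jl).
have nGz : ~ G j (z j).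
  (* [q] is a product of elements, one from each earlier [P i], chosen outside [P j] thanks to
     [P_order]. *)
  have [q [Hq nPq]] : exists q, (forall i, (i < j)%N -> P i q) /\ ~ P j q.
    have [[_ _ PjZ] Pj1 PjM] := P_prime jl.
    have : (j <= j)%N by [].
    move: {1 3}j => m; elim: m => [|m IHm] mj; first by exists 1.
    have [q [Hq nPq]] := IHm (ltnW mj).
    have /existsNP[a /not_implyP[Pa nPa]] := P_order mj jl.
    exists (q * a); split=> [i|/PjM[]] //; rewrite ltnS leq_eqVlt => /predU1P[->|im].
      have [[_ _ PZ] _ _] := P_prime (ltn_trans mj jl); exact: PZ.
    have [[_ _ PZ] _ _] := P_prime (ltn_trans im (ltn_trans mj jl)).
    by rewrite mulrC; apply: PZ; apply: Hq.
  move=> /(_ q Hq)[r [k [pr]]]; rewrite P_ann //.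
  have [_ Pj1 PjM] := P_prime jl.
  case/PjM; first by rewrite P_contr.
  by elim: k => [|k IHk]; rewrite ?expr0 // exprS => /PjM[].
have pGz r : p r -> G j ((r%:MP : S) *: z j).
  by move=> pr; apply: subG; apply/P_ann => //; apply/P_contr.
have Gz : G j.+1 (z j).
  move=> q /(_ j (ltnSn j)) Pq; exists 1, 1%N; split=> //.
  by rewrite P_ann // mpolyC1 mul1r expr1.
have sGr := submod_res (sG j.+1).
have [||ys' [sz' yW' ind']] :=
  bernstein_lower (W := W `&` G j.+1) (sG j) (@stG j) (@satG j) nGz pGz.
- have [W0 WD WZ] := sW; have [G0 GD GZ] := sGr; split=> //.
  + by move=> x y [Wx Gx] [Wy Gy]; split; [apply: WD | apply: GD].
  + by move=> a x [Wx Gx]; split; [apply: WZ | apply: GZ].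
- move=> a b; split; first exact: Wz.
  have stj := @stG j.+1; apply: (weyl_op_stable _ (sG _) stj).
  exact: (weyl_op_stable _ (sG _) stj Gz).
exists (ys ++ ys'); split; first by rewrite size_cat sz sz' mulSn addnC.
  by move=> y; rewrite mem_cat => /orP[/yW[Wy /mono Gy]|/yW'].
apply/pindep_cat; split=> //; apply: (pindep_anti _ ind').
apply: adjs_min; [exact: submod_res | exact: subG | by move=> y /yW[]].
Qed.

End Chain.
End Lower.

(** * The Cech complex *)

Lemma poly_subring_ind (A : comNzRingType) (P : {poly A} -> Prop) :
  (forall c, P c%:P) -> P 'X ->
  (forall p q, P p -> P q -> P (p + q)) -> (forall p q, P p -> P q -> P (p * q)) ->
  forall p, P p.
Proof.
move=> PC PX PD PM p; elim/poly_ind: p => [|p c IH]; first exact: (PC 0).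
by apply: PD => //; apply: PM.
Qed.

Lemma ideal_congrM (A : comNzRingType) (I : set A) a b c d : is_ideal I ->
  I (a - c) -> I (b - d) -> I (a * b - c * d).
Proof.
move=> [_ ID IM] Iac Ibd; have -> : a * b - c * d = b * (a - c) + c * (b - d) by ring.
by apply: ID; apply: IM.
Qed.

Section Loc.
Variables (R : comNzRingType) (n : nat).
Local Notation S := {mpoly R[n]}.
Local Notation Su := {poly S}.
Implicit Types (f g : S) (q : Su) (Q : {poly Su}).

(* S_g is modelled by S[u] with u = 1/g, working modulo the ideal (1 - g u). *)
Definition loc_rel g : set Su := [set q | exists h, q = (1 - g *: 'X) * h].

Lemma rel_ideal g : is_ideal (loc_rel g).
Proof.
split=> [|_ _ [h ->] [h' ->]|a _ [h ->]].
- by exists 0; rewrite mulr0.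
- by exists (h + h'); rewrite mulrDr.
- by exists (a * h); rewrite mulrCA.
Qed.

Lemma rel_submod g : submod (M := (Su : lmodType S)) (loc_rel g).
Proof.
have [r0 rD rM] := rel_ideal g; split=> // a x rx.
by rewrite -mul_polyC; apply: rM.
Qed.

(** The localization map from [S_g] to [S_(g f)]: since [1/g = f/(g f)], the variable [u] goes to
    [f u]. *)
Definition sig f : Su -> Su := comp_poly (f *: 'X).
HB.instance Definition _ f := GRing.RMorphism.on (sig f).

Lemma sigC f c : sig f c%:P = c%:P. Proof. exact: comp_polyC. Qed.
Lemma sigX f : sig f 'X = f *: 'X. Proof. exact: comp_polyX. Qed.
Lemma sig_lin f : lin (sig f).
Proof. by move=> a x y; rewrite -!mul_polyC rmorphD rmorphM /= sigC. Qed.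

Lemma sig_rel f g q : loc_rel g q -> loc_rel (g * f) (sig f q).
Proof.
move=> [h ->]; exists (sig f h); rewrite rmorphM rmorphB rmorph1 /=; congr (_ * _).
by rewrite -mul_polyC rmorphM /= sigC sigX mul_polyC scalerA.
Qed.

Section Order.
Variable t : nat.
Hypothesis t_gt0 : (0 < t)%N.
Variables (i : 'I_n).

Definition inc f : {poly Su} := map_poly polyC (taylor i f).
HB.instance Definition _ := GRing.RMorphism.copy inc (map_poly polyC \o taylor i).

Lemma coef_inc f k : (inc f)`_k = (hasse i k f)%:P.
Proof. by rewrite coef_map. Qed.

(** With [u = 1/g], the Taylor expansion of [g] equals [g (1 - dev g)]. As [dev g] has no constant
    term, the geometric series inverting it may be cut after [t] terms. *)
Definition dev g : {poly Su} := ('X : Su)%:P * (g%:P%:P - inc g).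
Definition Uinv g : {poly Su} := ('X : Su)%:P * \sum_(j < t) dev g ^+ j.

(* The Taylor expansion of 1/g up to order t. *)
Definition T g : Su -> {poly Su} := fun q => (map_poly inc q).[Uinv g].
HB.instance Definition _ g := GRing.RMorphism.copy (T g) (horner_eval (Uinv g) \o map_poly inc).

Lemma TC g c : T g c%:P = inc c.
Proof. by rewrite /T map_polyC hornerC. Qed.
Lemma TX g : T g 'X = Uinv g.
Proof. by rewrite /T map_polyX hornerX. Qed.

Lemma TD g p q : T g (p + q) = T g p + T g q.
Proof. exact: (rmorphD (T g)). Qed.
Lemma TM g p q : T g (p * q) = T g p * T g q.
Proof. exact: (rmorphM (T g)). Qed.

Definition loc_hasse g k q : Su := (T g q)`_k.

Lemma DD_add g k q q' : loc_hasse g k (q + q') = loc_hasse g k q + loc_hasse g k q'.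
Proof. by rewrite /loc_hasse TD coefD. Qed.

Lemma DD_leib g k f q : loc_hasse g k (f *: q) = \sum_(a < k.+1) hasse i a f *: loc_hasse g (k - a) q.
Proof.
rewrite /loc_hasse -mul_polyC TM TC coefM; apply: eq_bigr => a _.
by rewrite coef_inc mul_polyC.
Qed.

Lemma dev0 g : (dev g)`_0 = 0.
Proof. by rewrite coefCM coefB coefC coef_inc hd0 subrr mulr0. Qed.

Lemma DD0 g q : loc_hasse g 0 q = q.
Proof.
have e (r : {poly Su}) : r`_0 = horner_eval 0 r :> Su by rewrite /horner_eval horner_coef0.
rewrite /loc_hasse; elim/poly_subring_ind: q => [c||p q ep eq|p q ep eq].
- by rewrite TC coef_inc hd0.
- rewrite TX /Uinv coefCM; case: t t_gt0 => // t' _.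
  rewrite big_ord_recl expr0 coefD coef1 /= coef_sum big1 ?addr0 ?mulr1 // => j _.
  by rewrite e rmorphXn /= -e dev0 exprS mul0r.
- by rewrite TD coefD; congr (_ + _).
- by rewrite TM coefM big_ord1; congr (_ * _).
Qed.

Definition relt g : set {poly Su} := [set Q | forall k, (k < t)%N -> loc_rel g Q`_k].

Lemma relt_ideal g : is_ideal (relt g).
Proof.
have [r0 rD rM] := rel_ideal g; split=> [k _|Q Q' rQ rQ' k kt|P Q rQ k kt].
- by rewrite coef0.
- by rewrite coefD; apply: rD; [apply: rQ | apply: rQ'].
- rewrite coefM; apply: (big_ind (loc_rel g)) => // j _; apply: rM; apply: rQ.
  exact: leq_ltn_trans (leq_subr _ _) kt.
Qed.

(** The truncated geometric series leaves the error [dev g ^+ t], which is divisible by the [t]-th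
    power of the Taylor variable. *)
Lemma Uinv_rel g : relt g (1 - inc g * Uinv g).
Proof.
pose G : {poly Su} := g%:P%:P; pose X' : {poly Su} := ('X : Su)%:P.
pose s := \sum_(j < t) dev g ^+ j.
have es : (1 - dev g) * s = 1 - dev g ^+ t.
  by rewrite -[in RHS](expr1n _ t) subrXX /s; congr (_ * _); apply: eq_bigr => j _;
    rewrite expr1n mul1r.
have -> : 1 - inc g * Uinv g = (1 - G * X') * s + dev g ^+ t.
  have e : dev g ^+ t = 1 - (1 - dev g) * s by rewrite es opprB addrCA subrr addr0.
  rewrite e /Uinv -/s -/X' /dev -/G -/X'; ring.
have [_ rD rM] := relt_ideal g; apply: rD.
  rewrite mulrC; apply: rM => k _; rewrite /G /X' -polyCM -polyC1 -polyCB coefC.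
  case: k => [|k] /=; last by case: (rel_ideal g).
  by exists 1; rewrite mulr1 mul_polyC.
move=> k kt; suff -> : (dev g ^+ t)`_k = 0 by case: (rel_ideal g).
have [D ->] : exists D, dev g = D * 'X.
  exists (\poly_(k < size (dev g)) (dev g)`_k.+1); apply/polyP => -[|j].
    by rewrite dev0 coefMX.
  rewrite coefMX coef_poly /=; case: ltnP => // sj.
  by rewrite nth_default // ltnW.
by rewrite exprMn coefMXn kt.
Qed.

Lemma DD_rel g k q : (k < t)%N -> loc_rel g q -> loc_rel g (loc_hasse g k q).
Proof.
move=> kt [h ->]; rewrite /loc_hasse TM; have [_ rD rM] := relt_ideal g.
suff : relt g (T g (1 - g *: 'X) * T g h) by apply.
rewrite mulrC; apply: rM.
have -> : T g (1 - g *: 'X) = 1 - inc g * Uinv g.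
  by rewrite -mul_polyC -polyC1 -mulN1r -polyC1 -polyCN TD !TM !TC TX !rmorphN !rmorph1 mulN1r.
exact: Uinv_rel.
Qed.

Lemma map_sig_relt f g Q : relt g Q -> relt (g * f) (map_poly (sig f) Q).
Proof. by move=> rQ k kt; rewrite coef_map; apply: sig_rel; apply: rQ. Qed.

Lemma map_sig_inc f h : map_poly (sig f) (inc h) = inc h.
Proof. by apply/polyP => k; rewrite coef_map !coef_inc /= sigC. Qed.

Lemma DD_sig f g k q : (k < t)%N -> loc_rel (g * f) (loc_hasse (g * f) k (sig f q) - sig f (loc_hasse g k q)).
Proof.
have [r0 rD rM] := relt_ideal (g * f).
have rB Q Q' : relt (g * f) Q -> relt (g * f) Q' -> relt (g * f) (Q - Q').
  by move=> rQ rQ'; apply: rD => //; rewrite -mulN1r; apply: rM.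
suff H : relt (g * f) (T (g * f) (sig f q) - map_poly (sig f) (T g q)).
  by move=> kt; have := H k kt; rewrite coefB coef_map.
elim/poly_subring_ind: q => [c||p q ep eq|p q ep eq].
- by rewrite sigC !TC map_sig_inc subrr.
- rewrite sigX -mul_polyC TM TC !TX.
  (* Both [y1] and [y2] invert [inc g] modulo the relations below order [t], and inverses are
     unique. *)
  set y1 := inc f * _; set y2 := map_poly _ _.
  have e1 : relt (g * f) (1 - inc g * y1).
    by rewrite mulrA -rmorphM; apply: Uinv_rel.
  have e2 : relt (g * f) (1 - inc g * y2).
    have := map_sig_relt f (Uinv_rel g).
    by rewrite rmorphB rmorph1 rmorphM /= map_sig_inc.
  have -> : y1 - y2 = y1 * (1 - inc g * y2) - y2 * (1 - inc g * y1) by ring.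
  by apply: rB; apply: rM.
- rewrite (rmorphD (sig f)) !TD (rmorphD (map_poly (sig f))) opprD addrACA.
  by apply: rD; [exact: ep | exact: eq].
- rewrite (rmorphM (sig f)) !TM (rmorphM (map_poly (sig f))).
  exact: (ideal_congrM (relt_ideal _) ep eq).
Qed.

End Order.
End Loc.

Section CechD.
Variables (R : comNzRingType) (n : nat).
Local Notation S := {mpoly R[n]}.
Local Notation Su := ({poly S} : lmodType S).
Implicit Types (fs : seq S) (g : S).

(* The component of a subset I of fs stands for the localization of S at g times the
   product of I. *)
Fixpoint cech_rel fs g : set (K fs Su) :=
  match fs with
  | [::] => loc_rel g
  | f :: fs' => fun z => cech_rel g z.1 /\ cech_rel (g * f) z.2
  end.

Fixpoint cech_hasse t (i : 'I_n) (k : nat) fs g : K fs Su -> K fs Su :=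
  match fs with
  | [::] => loc_hasse t i g k
  | f :: fs' => fun z => (cech_hasse t i k g z.1, cech_hasse t i k (g * f) z.2)
  end.

Definition cech_diff fs := @Kdiff S Su (fun f => sig f) fs.

Lemma KN_submod fs g : submod (@cech_rel fs g).
Proof.
elim: fs g => [|f fs IH] g /=; first exact: rel_submod.
have [A0 AD AZ] := IH g; have [B0 BD BZ] := IH (g * f).
split=> [|x y [? ?] [? ?]|a x [? ?]]; split.
- exact: A0.
- exact: B0.
- exact: AD.
- exact: BD.
- exact: AZ.
- exact: BZ.
Qed.

Lemma KD_add t i k fs g (x y : K fs Su) :
  cech_hasse t i k g (x + y) = cech_hasse t i k g x + cech_hasse t i k g y.
Proof.
elim: fs g x y => [|f fs IH] g x y /=; first exact: DD_add.
by rewrite !IH.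
Qed.

Lemma KD_sub t i k fs g (x y : K fs Su) :
  cech_hasse t i k g (x - y) = cech_hasse t i k g x - cech_hasse t i k g y.
Proof. by apply: (addIr (cech_hasse t i k g y)); rewrite -KD_add !subrK. Qed.

Lemma KD_leib t i k fs g (f : S) (w : K fs Su) :
  cech_hasse t i k g (f *: w) = \sum_(a < k.+1) hasse i a f *: cech_hasse t i (k - a) g w.
Proof.
elim: fs g w => [|h fs IH] g w /=; first exact: DD_leib.
rewrite !IH; elim/big_ind3: _ => [|x1 x2 x y1 y2 y e1 e2|a _].
- by [].
- by rewrite -e1 -e2.
- by [].
Qed.

Lemma KD0 t i fs g (w : K fs Su) : (0 < t)%N -> cech_hasse t i 0 g w = w.
Proof.
move=> t0; elim: fs g w => [|h fs IH] g w /=; first exact: DD0.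
by rewrite !IH -surjective_pairing.
Qed.

Lemma KD_N t i k fs g (w : K fs Su) : (k < t)%N -> cech_rel g w -> cech_rel g (cech_hasse t i k g w).
Proof.
move=> kt; elim: fs g w => [|h fs IH] g w /=; first exact: DD_rel.
by move=> [/IH ? /IH ?].
Qed.

Lemma sig_N fs g f (w : K fs Su) : cech_rel g w -> cech_rel (g * f) (Kmap (sig f) w).
Proof.
elim: fs g w => [|h fs IH] g w /=; first exact: sig_rel.
by move=> [/IH ? /IH ?]; split=> //; rewrite mulrAC.
Qed.

Lemma KD_sig t i k fs g f (w : K fs Su) : (k < t)%N ->
  cech_rel (g * f) (cech_hasse t i k (g * f) (Kmap (sig f) w) - Kmap (sig f) (cech_hasse t i k g w)).
Proof.
move=> kt; elim: fs g w => [|h fs IH] g w /=; first exact: DD_sig.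
by split; [exact: IH | rewrite mulrAC; exact: IH].
Qed.

Lemma Kd_lin fs : lin (@cech_diff fs).
Proof. by apply: Kdiff_lin => f; apply: sig_lin. Qed.

Lemma Kd_N fs g (w : K fs Su) : cech_rel g w -> cech_rel g (cech_diff w).
Proof.
elim: fs g w => [|h fs IH] g w /=; first by move=> _; case: (rel_submod g).
move=> [N1 N2]; split; first exact: IH.
apply: submodB; [exact: KN_submod | exact: sig_N | exact: IH].
Qed.

Lemma KD_d t i k fs g (w : K fs Su) : (k < t)%N ->
  cech_rel g (cech_hasse t i k g (cech_diff w) - cech_diff (cech_hasse t i k g w)).
Proof.
move=> kt; elim: fs g w => [|h fs IH] g w /=.
  have -> : loc_hasse t i g k 0 = 0 by apply: (addrI (loc_hasse t i g k 0)); rewrite -DD_add !addr0.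
  by rewrite subr0; case: (rel_submod g).
split; first exact: IH.
rewrite /= KD_sub opprD addrACA -opprD; apply: submodB; first exact: KN_submod.
  exact: KD_sig.
exact: IH.
Qed.

(* Modulo cech_rel, the coboundaries and the sums of a cocycle and a multiple of tau. *)
Definition cech_bound fs : set (K fs Su) := [set q | exists w, cech_rel 1 (q - cech_diff w)].
Definition cech_cycle_mod fs (tau : R) : set (K fs Su) :=
  [set q | exists v, cech_rel 1 (cech_diff (q - (tau%:MP : S) *: v))].

Lemma KB_submod fs : submod (@cech_bound fs).
Proof.
have [N0 ND NZ] := KN_submod fs 1; have dl := @Kd_lin fs; split.
- by exists 0; rewrite (lin0 dl) subr0.
- move=> x y [v Nv] [w Nw]; exists (v + w); rewrite (linD _ _ dl) opprD addrACA.
  exact: ND.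
- by move=> a x [v Nv]; exists (a *: v); rewrite (linZ _ _ dl) -scalerBr; apply: NZ.
Qed.

Lemma KZ_submod fs tau : submod (@cech_cycle_mod fs tau).
Proof.
have [N0 ND NZ] := KN_submod fs 1; have dl := @Kd_lin fs; split.
- by exists 0; rewrite scaler0 subr0 (lin0 dl).
- move=> x y [v Nv] [w Nw]; exists (v + w); rewrite scalerDr opprD addrACA (linD _ _ dl).
  exact: ND.
- move=> a x [v Nv]; exists (a *: v).
  rewrite scalerA mulrC -scalerA -scalerBr (linZ _ _ dl); exact: NZ.
Qed.

Lemma KN_KB fs : @cech_rel fs 1 `<=` @cech_bound fs.
Proof. by move=> q Nq; exists 0; rewrite (lin0 (@Kd_lin fs)) subr0. Qed.

Lemma KN_KZ fs tau : @cech_rel fs 1 `<=` @cech_cycle_mod fs tau.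
Proof. by move=> q Nq; exists 0; rewrite scaler0 subr0; apply: Kd_N. Qed.

Lemma KB_stable t fs : stable (fun i k => @cech_hasse t i k fs 1) t (@cech_bound fs).
Proof.
move=> i k w kt [v Nv]; exists (cech_hasse t i k 1 v).
have -> : cech_hasse t i k 1 w - cech_diff (cech_hasse t i k 1 v) =
    cech_hasse t i k 1 (w - cech_diff v) +
    (cech_hasse t i k 1 (cech_diff v) - cech_diff (cech_hasse t i k 1 v)).
  by rewrite KD_sub addrA subrK.
have [_ ND _] := KN_submod fs 1; apply: ND; [exact: KD_N | exact: KD_d].
Qed.

Lemma KZ_stable t fs tau : stable (fun i k => @cech_hasse t i k fs 1) t (@cech_cycle_mod fs tau).
Proof.
move=> i k w kt [v Nv]; exists (cech_hasse t i k 1 v).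
have <- : cech_hasse t i k 1 ((tau%:MP : S) *: v) = (tau%:MP : S) *: cech_hasse t i k 1 v.
  exact: (@D_const _ _ _ (fun i k => @cech_hasse t i k fs 1) (fun i k f w => KD_leib t i k 1 f w)).
rewrite -KD_sub; set x := w - _ in Nv *.
have -> : cech_diff (cech_hasse t i k 1 x) =
    cech_hasse t i k 1 (cech_diff x) - (cech_hasse t i k 1 (cech_diff x) - cech_diff (cech_hasse t i k 1 x)).
  by rewrite subKr.
by apply: submodB; [exact: KN_submod | exact: KD_N | exact: KD_d].
Qed.

End CechD.

(** * Degree bounds and the upper bound for lengths *)

Section Degree.
Variables (R : comNzRingType) (n : nat).
Local Notation S := {mpoly R[n]}.
Implicit Types (c : S).

Definition mdeg_le (a : nat) c := forall m, c@_m != 0 -> (mdeg m <= a)%N.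

Lemma mbW a b c : (a <= b)%N -> mdeg_le a c -> mdeg_le b c.
Proof. by move=> ab H m /H ma; apply: leq_trans ab. Qed.

Lemma mb0 a : mdeg_le a 0.
Proof. by move=> m; rewrite mcoeff0 eqxx. Qed.

Lemma mbC a r : mdeg_le a r%:MP.
Proof.
by move=> m; rewrite mcoeffC; case: (m =P 0%MM) => [->|]; rewrite ?mdeg0 // mulr0 eqxx.
Qed.

Lemma mbX a m : (mdeg m <= a)%N -> mdeg_le a 'X_[m].
Proof. by move=> ma m'; rewrite mcoeffX; case: (m =P m') => [<- //|_]; rewrite eqxx. Qed.

Lemma mbD a b c : mdeg_le a b -> mdeg_le a c -> mdeg_le a (b + c).
Proof.
move=> Hb Hc m; rewrite mcoeffD; case: (eqVneq b@_m 0) => [->|/Hb] //.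
by rewrite add0r => /Hc.
Qed.

Lemma mbN a c : mdeg_le a c -> mdeg_le a (- c).
Proof. by move=> H m; rewrite mcoeffN oppr_eq0 => /H. Qed.

Lemma mbM a b c e : mdeg_le a c -> mdeg_le b e -> mdeg_le (a + b) (c * e).
Proof.
move=> Hc He m; rewrite -mcoeff_msupp => /msuppM_le/allpairsP[[m1 m2] /= [m1c m2e ->]].
rewrite mdegD; apply: leq_add; first by apply: Hc; rewrite -mcoeff_msupp.
by apply: He; rewrite -mcoeff_msupp.
Qed.

Lemma mb_sum a (I : Type) (r : seq I) (P : pred I) (F : I -> S) :
  (forall i, P i -> mdeg_le a (F i)) -> mdeg_le a (\sum_(i <- r | P i) F i).
Proof.
move=> H; apply: (big_ind (mdeg_le a)) => //; first exact: mb0.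
by move=> x y; apply: mbD.
Qed.

Lemma mb_exists c : exists a, mdeg_le a c.
Proof.
exists (msize c) => m; rewrite -mcoeff_msupp => /msize_mdeg_lt; exact: ltnW.
Qed.

Lemma mb_exp a c k : mdeg_le a c -> mdeg_le (a * k) (c ^+ k).
Proof.
move=> H; elim: k => [|k IH]; first by rewrite expr0; apply: mbC.
by rewrite exprS mulnS; apply: mbM.
Qed.

Lemma mb_hd a i k c : mdeg_le a c -> mdeg_le a (hasse i k c).
Proof.
move=> H; rewrite (mpolyE c) hd_sum big_seq_cond; apply: mb_sum => m /andP[mc _].
rewrite -mul_mpolyC hdCM hd_mon -mul_mpolyC -[a]add0n; apply: mbM; first exact: mbC.
rewrite -[a]add0n; apply: mbM; first exact: mbC; apply: mbX.
by rewrite (leq_trans (mdegB _ _)) // H // -mcoeff_msupp.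
Qed.

(** [s] bounds the pole order, that is the degree in [u], and [a] the degree in the variables of
    [S]. *)
Definition Phi s a (q : {poly S}) := (size q <= s.+1)%N /\ forall j, mdeg_le a q`_j.

Lemma PhiW s a s' a' q : (s <= s')%N -> (a <= a')%N -> Phi s a q -> Phi s' a' q.
Proof.
move=> ss aa [sq Hq]; split=> [|j]; first exact: leq_trans sq _.
exact: mbW (Hq j).
Qed.

Lemma Phi0 s a : Phi s a 0.
Proof. by split=> [|j]; rewrite ?size_poly0 // coef0; apply: mb0. Qed.

Lemma PhiD s a p q : Phi s a p -> Phi s a q -> Phi s a (p + q).
Proof.
move=> [sp Hp] [sq Hq]; split=> [|j]; last by rewrite coefD; apply: mbD.
by rewrite (leq_trans (size_polyD _ _)) // geq_max sp.
Qed.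

Lemma PhiC s a c : mdeg_le a c -> Phi s a c%:P.
Proof.
move=> H; split=> [|j]; first by rewrite (leq_trans (size_polyC_leq1 _)).
by rewrite coefC; case: eqP => _ //; apply: mb0.
Qed.

Lemma PhiX : Phi 1 0 'X.
Proof. by split=> [|j]; rewrite ?size_polyX // coefX; case: eqP => _; apply: (mbC 0). Qed.

Lemma PhiM s a s' a' p q : Phi s a p -> Phi s' a' q -> Phi (s + s') (a + a') (p * q).
Proof.
move=> [sp Hp] [sq Hq]; split=> [|j]; last by rewrite coefM; apply: mb_sum => i _; apply: mbM.
rewrite (leq_trans (size_polyMleq _ _)) //.
by rewrite -ltnS -addSn -addnS; case: (size p + size q)%N (leq_add sp sq).
Qed.

Variable d : nat.

(** As in the quotient rule, each order of differentiation costs one more factor [1/g] and up to [d]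
    in the degree of the numerator. *)
Definition Psi s a (Q : {poly {poly S}}) := forall k, Phi (s + k) (a + d * k) Q`_k.

Lemma PsiW s a s' a' Q : (s <= s')%N -> (a <= a')%N -> Psi s a Q -> Psi s' a' Q.
Proof. by move=> ss aa H k; apply: PhiW (H k); rewrite leq_add2r. Qed.

Lemma Psi0 s a : Psi s a 0.
Proof. by move=> k; rewrite coef0; apply: Phi0. Qed.

Lemma PsiD s a P Q : Psi s a P -> Psi s a Q -> Psi s a (P + Q).
Proof. by move=> HP HQ k; rewrite coefD; apply: PhiD. Qed.

Lemma Psi_sum s a (I : Type) (r : seq I) (P : pred I) F :
  (forall i, P i -> Psi s a (F i)) -> Psi s a (\sum_(i <- r | P i) F i).
Proof.
move=> H; apply: (big_ind (Psi s a)) => //; first exact: Psi0.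
by move=> x y; apply: PsiD.
Qed.

Lemma PsiC s a q : Phi s a q -> Psi s a q%:P.
Proof.
move=> H k; rewrite coefC; case: eqP => [->|_]; last exact: Phi0.
by rewrite muln0 !addn0.
Qed.

Lemma PsiM s a s' a' P Q : Psi s a P -> Psi s' a' Q -> Psi (s + s') (a + a') (P * Q).
Proof.
move=> HP HQ k; rewrite coefM; apply: (big_ind (Phi (s + s' + k) (a + a' + d * k))).
- exact: Phi0.
- by move=> x y; apply: PhiD.
move=> j _; have jk : (j <= k)%N by rewrite -ltnS.
have -> : (s + s' + k = (s + j) + (s' + (k - j)))%N by rewrite addnACA subnKC.
have -> : (a + a' + d * k = (a + d * j) + (a' + d * (k - j)))%N.
  by rewrite addnACA -mulnDr subnKC.
exact: PhiM.
Qed.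

Lemma Psi_exp s a Q k : Psi s a Q -> Psi (s * k) (a * k) (Q ^+ k).
Proof.
move=> H; elim: k => [|k IH]; last by rewrite exprS !mulnS; apply: PsiM.
rewrite !muln0 expr0 -polyC1; apply: PsiC; rewrite -polyC1; apply: PhiC.
by rewrite -mpolyC1; apply: mbC.
Qed.

Lemma Psi_inc i a c : mdeg_le a c -> Psi 0 a (inc i c).
Proof.
move=> H k; rewrite coef_inc; apply: PhiC; apply: (mbW (leq_addr _ _)).
exact: mb_hd.
Qed.

Lemma Psi_Uinv t i g : mdeg_le d g -> Psi 1 0 (Uinv t i g).
Proof.
move=> Hg; rewrite /Uinv -[X in Psi X]addn0 -[X in Psi _ X]addn0; apply: PsiM.
  by apply: PsiC; apply: PhiX.
apply: Psi_sum => j _.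
suff H : Psi 0 0 (dev i g) by have := Psi_exp j H; rewrite !mul0n.
move=> [|k].
  by rewrite dev0; apply: Phi0.
rewrite /dev coefCM coefB coefC coef_inc /= sub0r.
have -> : (0 + k.+1 = 1 + k)%N by [].
apply: (@PhiW (1 + 0) (0 + d)); [by rewrite leq_add2l | by rewrite !add0n mulnS leq_addr | ].
apply: PhiM; first exact: PhiX.
by rewrite -polyCN; apply: PhiC; apply: mbN; apply: mb_hd.
Qed.

Lemma Psi_T t i g s a q : mdeg_le d g -> Phi s a q -> Psi s a (T t i g q).
Proof.
move=> Hg [sq Hq]; rewrite /T (horner_coef_wide _ (n := s.+1)).
  apply: Psi_sum => j _.
  suff : Psi (0 + s) (a + 0) ((map_poly (inc i) q)`_j * Uinv t i g ^+ j) by rewrite addn0.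
  apply: PsiM.
    by rewrite coef_map; apply: Psi_inc.
  have := Psi_exp j (Psi_Uinv t i Hg); rewrite mul1n mul0n; apply: PsiW => //.
  by rewrite -ltnS.
by rewrite (leq_trans (size_poly _ _)).
Qed.

Lemma Phi_DD t i k g s a q : mdeg_le d g -> Phi s a q -> Phi (s + k) (a + d * k) (loc_hasse t i g k q).
Proof. by move=> Hg Hq; apply: Psi_T. Qed.

End Degree.

Section NormalForm.
Variables (R : comNzRingType) (n : nat).
Local Notation S := {mpoly R[n]}.
Local Notation Su := ({poly S} : lmodType S).

(** The numerator of [q] over the common denominator [g^M]. *)
Definition lam M (g : S) (q : Su) : S := \sum_(j < M.+1) (q : {poly S})`_j * g ^+ (M - j).

Lemma rel_pow (g : S) j k (c : S) : loc_rel g (c *: 'X^j - (c * g ^+ k) *: 'X^(j + k)).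
Proof.
have -> : c *: 'X^j - (c * g ^+ k) *: 'X^(j + k) = (c *: 'X^j) * (1 - (g *: 'X) ^+ k).
  by rewrite -!mul_polyC polyCM polyC_exp exprMn exprD; ring.
have [_ _ rM] := rel_ideal g; apply: rM.
rewrite -[X in X - _](expr1n _ k) subrXX; eexists; reflexivity.
Qed.

Lemma rel_lam M (g : S) (q : Su) : (size (q : {poly S}) <= M.+1)%N ->
  loc_rel g (q - lam M g q *: 'X^M).
Proof.
move=> sq; have {1}-> : q = \sum_(j < M.+1) (q : {poly S})`_j *: 'X^j.
  rewrite -[LHS]coefK poly_def (big_ord_widen _ (fun j => (q : {poly S})`_j *: 'X^j) sq).
  rewrite [RHS](bigID (fun j : 'I_M.+1 => (j < size (q : {poly S}))%N)) /=.
  rewrite [X in _ + X]big1 ?addr0 // => j; rewrite -leqNgt => sj.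
  by rewrite nth_default // scale0r.
rewrite /lam scaler_suml -sumrB; have [r0 rD _] := rel_ideal g.
apply: (big_ind (loc_rel g)) => // j _; have jM : (j <= M)%N by rewrite -ltnS.
by have := rel_pow g j (M - j) (q : {poly S})`_j; rewrite subnKC.
Qed.

Lemma mb_lam a d s g (q : Su) : mdeg_le d g -> Phi s a q -> mdeg_le (a + d * s) (lam s g q).
Proof.
move=> Hg [_ Hq]; apply: mb_sum => j _; apply: mbM => //.
by apply: (@mbW _ _ (d * (s - j))); [rewrite leq_mul2l leq_subr orbT | apply: mb_exp].
Qed.

End NormalForm.

Section Levels.
Variables (R : comNzRingType) (n : nat).
Local Notation S := {mpoly R[n]}.
Local Notation Su := ({poly S} : lmodType S).
Implicit Types (fs : seq S) (g : S).

Fixpoint KPhi fs s a : set (K fs Su) :=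
  match fs with
  | [::] => Phi s a
  | _ :: fs' => fun z => KPhi s a z.1 /\ KPhi s a z.2
  end.

Fixpoint gb fs g d : Prop :=
  if fs is f :: fs' then gb fs' g d /\ gb fs' (g * f) d else mdeg_le d g.

Lemma gb_exists fs g : exists d, gb fs g d.
Proof.
have gbW fs' g' d d' : (d <= d')%N -> gb fs' g' d -> gb fs' g' d'.
  move=> dd; elim: fs' g' => [|f fs' IH] g' /=; first exact: mbW.
  by move=> [/IH ? /IH ?].
elim: fs g => [|f fs IH] g /=; first exact: mb_exists.
have [d Hd] := IH g; have [d' Hd'] := IH (g * f); exists (maxn d d').
by split; [apply: gbW Hd; apply: leq_maxl | apply: gbW Hd'; apply: leq_maxr].
Qed.

Lemma KPhiW fs s a s' a' (z : K fs Su) : (s <= s')%N -> (a <= a')%N ->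
  KPhi s a z -> KPhi s' a' z.
Proof.
move=> ss aa; elim: fs z => [|f fs IH] z /=; first exact: PhiW.
by move=> [/IH ? /IH ?].
Qed.

Lemma KPhi_exists fs (z : K fs Su) : exists s a, KPhi s a z.
Proof.
elim: fs z => [|f fs IH] z /=.
  exists (size (z : {poly S})).
  have [a Ha] : exists a, forall j, (j < size (z : {poly S}))%N -> mdeg_le a (z : {poly S})`_j.
    elim: (size _) => [|k [a Ha]]; first by exists 0%N.
    have [b Hb] := mb_exists (z : {poly S})`_k; exists (maxn a b) => j.
    rewrite ltnS leq_eqVlt => /predU1P[->|/Ha].
      by apply: mbW Hb; apply: leq_maxr.
    by apply: mbW; apply: leq_maxl.
  exists a; split=> // j; case: (ltnP j (size (z : {poly S}))) => [/Ha //|sj].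
  by rewrite nth_default //; apply: mb0.
have [s [a H]] := IH z.1; have [s' [a' H']] := IH z.2.
exists (maxn s s'), (maxn a a'); split.
  by apply: KPhiW H; apply: leq_maxl.
by apply: KPhiW H'; apply: leq_maxr.
Qed.

Lemma KPhi_KD t i k fs g d s a (z : K fs Su) : gb fs g d -> KPhi s a z ->
  KPhi (s + k) (a + d * k) (cech_hasse t i k g z).
Proof.
elim: fs g z => [|f fs IH] g z /=; first exact: Phi_DD.
by move=> [g1 g2] [z1 z2]; split; apply: IH.
Qed.

Lemma KPhi_X fs s a b m (z : K fs Su) : (mdeg m <= b)%N -> KPhi s a z ->
  KPhi s (a + b) (('X_[m] : S) *: z).
Proof.
move=> mb_; elim: fs z => [|f fs IH] z /=; last by move=> [z1 z2]; split; apply: IH.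
move=> Hz; rewrite -mul_polyC addnC; exact: (PhiM (PhiC 0 (mbX mb_)) Hz).
Qed.

Variable V : set R.
Hypothesis idV : is_ideal V.

(* gb fs g d bounds by d the degrees of all denominators, so modulo cech_rel every element
   of u-degree s and x-degree a can be rewritten as u^s times a polynomial of degree
   at most a + d s. *)
Definition Lev fs s a := gen (M := res (K fs Su))
  [set x | exists r z, [/\ V r, KPhi s a z & x = (r%:MP : S) *: z]].

Lemma Lev_map fs s a s' a' (h : K fs Su -> K fs Su) :
  (forall x y, h (x + y) = h x + h y) ->
  (forall r x, h ((r%:MP : S) *: x) = (r%:MP : S) *: h x) ->
  (forall z, KPhi s a z -> KPhi s' a' (h z)) -> forall z, Lev s a z -> Lev s' a' (h z).
Proof.
move=> hD hZ hP; have [L0 LD LZ] := submod_gen (M := res (K fs Su))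
  [set x | exists r z, [/\ V r, KPhi s' a' z & x = (r%:MP : S) *: z]].
apply: (gen_min (M := res (K fs Su)) (K := [set z | Lev s' a' (h z)])).
  split=> /= [|x y Hx Hy|r x Hx].
  - have -> : h 0 = 0 by apply: (addrI (h 0)); rewrite -hD !addr0.
    exact: L0.
  - by rewrite hD; apply: LD.
  - by rewrite resZ hZ; apply: (LZ r).
move=> _ [r [z [Vr Hz ->]]] /=; rewrite hZ => L _; apply; exists r, (h z).
by split=> //; apply: hP.
Qed.

Lemma LevW fs s a s' a' (z : K fs Su) : (s <= s')%N -> (a <= a')%N ->
  Lev s a z -> Lev s' a' z.
Proof. by move=> ss aa; apply: (Lev_map (h := id)) => // x; apply: KPhiW. Qed.

(** The [n] derivatives, each of order below [t], cost at most [n t] in pole order and [d n t] in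
    degree; the monomial adds at most [n t] to the degree. *)
Lemma Lev_weyl t fs d s a (b : {ffun 'I_n -> 'I_t} * {ffun 'I_n -> 'I_t}) (z : K fs Su) :
  gb fs 1 d -> Lev s a z ->
  Lev (s + n * t) (a + (d * (n * t) + n * t)) (weyl_op (fun i k => @cech_hasse R n t i k fs 1) b z : K fs Su).
Proof.
move=> gd Hz; rewrite /weyl_op addnA.
have H1 (l : seq 'I_n) : Lev (s + size l * t) (a + d * (size l * t))
    (dseq (fun i k => @cech_hasse R n t i k fs 1) l (bmon b.2) z : K fs Su).
  elim: l => [|i l IH] /=; first by rewrite mul0n muln0 !addn0.
  rewrite mulSnr mulnDr !addnA.
  have kt : (bmon b.2 i <= t)%N by apply: ltnW; apply: box_bmon.
  apply: (@LevW _ (s + size l * t + bmon b.2 i) (a + d * (size l * t) + d * bmon b.2 i)).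
  - by rewrite leq_add2l.
  - by rewrite leq_add2l leq_mul2l kt orbT.
  apply: Lev_map IH => [x y|r x|x]; first exact: KD_add.
    exact: (@D_const _ _ _ (fun i k => @cech_hasse R n t i k fs 1) (fun i k f w => KD_leib t i k 1 f w)).
  exact: KPhi_KD.
have := H1 (enum 'I_n); rewrite size_enum_ord.
apply: (Lev_map (h := fun x : K fs Su => ('X_[bmon b.1] : S) *: x)) => [x y|r x|x].
- exact: scalerDr.
- by rewrite !scalerA mulrC.
- apply: KPhi_X; rewrite mdegE -[n in (n * t)%N]card_ord -sum_nat_const.
  by apply: leq_sum => i _; apply: ltnW; apply: box_bmon.
Qed.

Fixpoint Kgens fs s b : seq (K fs Su) :=
  match fs with
  | [::] => [seq ('X_[bmon m] : S) *: ('X^s : {poly S}) | m <- enum {ffun 'I_n -> 'I_b}]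
  | _ :: fs' => [seq (x, 0) | x <- Kgens fs' s b] ++ [seq (0, x) | x <- Kgens fs' s b]
  end.

Lemma size_Kgens fs s b : size (Kgens fs s b) = (2 ^ size fs * b ^ n)%N.
Proof.
elim: fs => [|f fs IH] /=; first by rewrite size_map -cardE card_ffun !card_ord mul1n.
by rewrite size_cat !size_map IH expnS -mulnA mul2n addnn.
Qed.

Lemma KPhi_span fs g d s a b (Q : set (K fs Su)) (z : K fs Su) : (a + d * s < b)%N ->
  submod (M := res (K fs Su)) Q -> @cech_rel R n fs g `<=` Q -> (forall e, e \in Kgens fs s b -> Q e) ->
  gb fs g d -> KPhi s a z -> Q z.
Proof.
move=> lb; elim: fs g Q z => [|f fs IH] g Q z sQ NQ gQ /=.
  move=> Hg Hz; have [sz _] := Hz; have [Q0 QD QZ] := sQ.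
  rewrite -[z](subrK (lam s g z *: 'X^s)); apply: (QD); first by apply: NQ; apply: rel_lam.
  have Hl := mb_lam Hg Hz.
  rewrite (mpolyE (lam s g z)) scaler_suml big_seq.
  apply: (big_ind Q) => [||m mc]; [exact: Q0 | exact: QD | ].
  rewrite -mul_mpolyC -scalerA; apply: (QZ (lam s g z)@_m).
  have ml : (mdeg m <= a + d * s)%N by apply: Hl; rewrite -mcoeff_msupp.
  have [m' em] : exists m' : {ffun 'I_n -> 'I_b}, m = bmon m'.
    apply: box_bmonP => i; apply: leq_ltn_trans lb; apply: leq_trans ml.
    by rewrite mdegE (bigD1 i) //= leq_addr.
  by rewrite em; apply: gQ; apply: map_f; rewrite mem_enum.
move=> [g1 g2] [z1 z2]; have [Q0 QD QZ] := sQ.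
have -> : z = (z.1, 0) + (0, z.2).
  by rewrite {1}(surjective_pairing z); congr (_, _); rewrite /= ?addr0 ?add0r.
have [N10 _ _] := KN_submod fs g; have [N20 _ _] := KN_submod fs (g * f).
apply: (QD).
  apply: (IH g (fun x => Q (x, 0))) => // [|x Nx|e eg].
  - split=> [|x y Qx Qy|r x Qx]; first exact: Q0.
      by have := QD _ _ Qx Qy; congr Q; congr (_, _); apply: addr0.
    by have := QZ r _ Qx; congr Q; congr (_, _); apply: scaler0.
  - by apply: NQ; split.
  - by apply: gQ; rewrite mem_cat map_f.
apply: (IH (g * f) (fun x => Q (0, x))) => // [|x Nx|e eg].
- split=> [|x y Qx Qy|r x Qx]; first exact: Q0.
    by have := QD _ _ Qx Qy; congr Q; congr (_, _); apply: addr0.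
  by have := QZ r _ Qx; congr Q; congr (_, _); apply: scaler0.
- by apply: NQ; split.
- by apply: gQ; rewrite mem_cat map_f ?orbT.
Qed.

(** Over a common pole order the level is spanned, with coefficients in [V], by the monomials in
    each of the [2 ^ size fs] components, and each monomial contributes at most the length [c] of
    [V/U]. *)
Lemma plen_Lev (p U : set R) fs d s a c (Y : set (K fs Su)) : is_prime p -> gb fs 1 d ->
  submod Y -> @cech_rel R n fs 1 `<=` Y -> (forall u x, U u -> Y ((u%:MP : S) *: x)) ->
  plen p (M := R^o) U V c ->
  plen p (M := res (K fs Su)) Y (Lev s a) (c * (2 ^ size fs * (a + d * s).+1 ^ n)).
Proof.
move=> pp gd sY NY UY plV; have sYr := submod_res sY; have [Y0 YD YZ] := sY.
rewrite -(size_Kgens fs s).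
have := @plen_vadjs R p (res (K fs Su)) pp U V Y (Kgens fs s (a + d * s).+1) c idV sYr
  (fun e u _ Uu => UY u e Uu) plV.
apply: plenW => //.
have sL := submod_vadjs (M := res (K fs Su)) (Kgens fs s (a + d * s).+1) idV sYr.
have [L0 LD LZ] := sL.
apply: (gen_min sL) => _ [r [z [Vr Hz ->]]].
pose Q : set (K fs Su) := [set z | forall r, V r ->
  foldl (vadj (M := res (K fs Su)) V) Y (Kgens fs s (a + d * s).+1) ((r%:MP : S) *: z)].
suff : Q z by apply.
apply: (@KPhi_span fs 1 d s a (a + d * s).+1) => //.
- split=> [r' _|x y Qx Qy r' Vr'|r1 x Qx r' Vr'].
  + by rewrite scaler0.
  + by rewrite scalerDr; apply: LD; [apply: Qx | apply: Qy].
  + rewrite resZ scalerA mulrC -scalerA; apply: (LZ r1); exact: Qx.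
- move=> x /NY Yx r' _; apply: (sub_vadjs (M := res (K fs Su)) _ idV).
  exact: YZ.
- by move=> e eg r' Vr'; apply: (mem_vadjs (M := res (K fs Su)) idV sYr eg Vr').
Qed.

End Levels.

(** Sort the indices by the number of sets that contain the given one: passing to a strictly larger
    set lowers this number. *)
Lemma order_sets (T : Type) (f : nat -> set T) l : injective f ->
  exists idx : nat -> nat, (forall i j, (i < j)%N -> (j < l)%N -> ~ (f (idx i) `<=` f (idx j))).
Proof.
move=> finj; pose s := iota 0 l.
pose h i := count (fun k => `[< f i `<=` f k >]) s.
pose s' := sort (relpre h leq) s.
have ps : perm_eq s' s by rewrite perm_sort.
have us : uniq s' by rewrite sort_uniq iota_uniq.
have szs : size s' = l by rewrite size_sort size_iota.
exists (nth 0%N s') => i j ij jl sub.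
have il : (i < l)%N by apply: ltn_trans jl.
set a := nth 0%N s' i in sub; set b := nth 0%N s' j in sub.
have hab : (h a <= h b)%N.
  have srt : sorted (relpre h leq) s' by apply: sort_sorted => x y; apply: leq_total.
  have tr : transitive (relpre h leq) by move=> y x z; apply: leq_trans.
  by have := sorted_ltn_nth tr 0%N srt; apply; rewrite ?inE ?szs.
have neq : a <> b.
  by move/eqP; rewrite nth_uniq ?szs // => /eqP eij; rewrite eij ltnn in ij.
have as_ : a \in s by rewrite -(perm_mem ps) mem_nth ?szs.
have : (h b < h a)%N.
  rewrite /h (permP (perm_to_rem as_)) [X in (_ < X)%N](permP (perm_to_rem as_)) /=.
  have -> : `[< f b `<=` f a >] = false.
    by apply/asboolP => ba; apply: neq; apply: finj; apply/seteqP.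
  have -> : `[< f a `<=` f a >] = true by apply/asboolP.
  rewrite add0n add1n ltnS; apply: sub_count => k /asboolP bk.
  by apply/asboolP; apply: subset_trans bk.
by rewrite ltnNge hab.
Qed.

(** * Finitely many annihilators over one prime [p] *)

Section FiniteAss.
Variables (R : comNzRingType) (n : nat).
Local Notation S := {mpoly R[n]}.
Local Notation Su := ({poly S} : lmodType S).
Variables (p : set R) (fs : seq S).
Local Notation E := (K fs Su).

Definition VP (V : set R) : set E := gen (M := res E)
  [set x | exists r (z : E), V r /\ x = (r%:MP : S) *: z].

Lemma VP_Lev V y : VP V y -> exists s a, Lev V s a y.
Proof.
apply: (gen_min (M := res E) (K := [set y | exists s a, @Lev R n V fs s a y])) y.
  have sL s a := submod_gen (M := res E)
    [set x | exists r (z : E), [/\ V r, KPhi s a z & x = (r%:MP : S) *: z]].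
  split=> [|x y [s [a Hx]] [s' [a' Hy]]|r x [s [a Hx]]].
  - by exists 0%N, 0%N; case: (sL 0%N 0%N).
  - exists (maxn s s'), (maxn a a'); have [_ LD _] := sL (maxn s s') (maxn a a').
    by apply: LD; [apply: LevW Hx; apply: leq_maxl | apply: LevW Hy; apply: leq_maxr].
  - by exists s, a; have [_ _ LZ] := sL s a; apply: (LZ r).
move=> _ [r [z [Vr ->]]]; have [s [a Hz]] := KPhi_exists z.
by exists s, a => L _; apply; exists r, z.
Qed.

(* By chain_bound l such primes give l t^n <= c 2^r (C t)^n for large t. *)
Lemma finite_ann (U V : set R) (Y : set E) c : is_prime p -> is_ideal V -> submod Y ->
  (forall t, stable (fun i k => @cech_hasse R n t i k fs 1) t Y) -> @cech_rel R n fs 1 `<=` Y ->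
  (forall u x, U u -> Y ((u%:MP : S) *: x)) -> plen p (M := R^o) U V c ->
  finite_set [set P : set S | [/\ is_prime P, forall r, P r%:MP <-> p r &
    exists y, VP V y /\ forall a, Y (a *: y) <-> P a]].
Proof.
move=> pp idV sY stY NY UY plV; apply: contrapT => /infiniteP/ppcard_leP[f].
have [d gd] := gb_exists fs 1.
have finj : injective f by move=> i j /(@inj _ _ _ f); apply; rewrite in_setT.
have fX i : [set P : set S | [/\ is_prime P, forall r, P r%:MP <-> p r &
    exists y, VP V y /\ forall a, Y (a *: y) <-> P a]] (f i) by apply: funS.
(* Chosen so that [(a1 + d * s1).+1 <= C * t]. Two operators add [2dnt + 2nt] to the degree and
   [2nt] to the pole order, the latter weighted by [d]; the remaining [d + 1] absorbs [s0] and
   [a0 + 1], both at most [t]. *)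
pose C := (4 * d * n + 2 * n + d + 1)%N.
pose L := (c * (2 ^ size fs * C ^ n)).+1.
have [idx Hidx] := order_sets L finj.
have /choice [z Hz] : forall i, exists y, VP V y /\ forall a, Y (a *: y) <-> f (idx i) a.
  by move=> i; have [] := fX (idx i).
have [s0 [a0 H0]] : exists s0 a0, forall i, (i < L)%N -> Lev V s0 a0 (z i).
  elim: L {Hidx} => [|l [s0 [a0 H0]]]; first by exists 0%N, 0%N.
  have [Vz _] := Hz l; have [s [a Hl]] := VP_Lev Vz.
  exists (maxn s0 s), (maxn a0 a) => i; rewrite ltnS leq_eqVlt => /predU1P[->|/H0].
    by apply: LevW Hl; apply: leq_maxr.
  by apply: LevW; apply: leq_maxl.
(* From here on [t] dominates the levels of the finitely many chosen elements. *)
pose t := (s0 + a0).+1; have t0 : (0 < t)%N by [].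
pose s1 := (s0 + n * t + n * t)%N.
pose a1 := (a0 + (d * (n * t) + n * t) + (d * (n * t) + n * t))%N.
have bound : (L * t ^ n <= c * (2 ^ size fs * (a1 + d * s1).+1 ^ n))%N.
  apply: (@chain_bound R n p (K fs Su) (fun i k => @cech_hasse R n t i k fs 1) t _ _ _ pp t0 Y L
      (fun i => f (idx i)) z (@Lev R n V fs s1 a1) _ sY (stY t)).
  - by move=> i k x y; apply: KD_add.
  - by move=> i k g w; apply: KD_leib.
  - by move=> i w; apply: KD0.
  - by move=> i _; have [] := fX (idx i).
  - by move=> i r _; have [_ H _] := fX (idx i); apply: H.
  - by move=> i a _; have [_ H] := Hz i; apply: H.
  - exact: Hidx.
  - exact: submod_gen.
  - move=> i a b iL; apply: Lev_weyl => //; apply: Lev_weyl => //; exact: H0.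
  - exact: (plen_Lev idV pp gd sY NY UY plV).
have le_t : ((a1 + d * s1).+1 <= C * t)%N.
  have : (s0 + a0 + 1 <= t)%N by rewrite addn1.
  rewrite /C /a1 /s1; nia.
have : (L * t ^ n <= c * (2 ^ size fs * C ^ n) * t ^ n)%N.
  apply: leq_trans bound _; rewrite -!mulnA -expnMn; do 2!apply: leq_mul => //.
  by elim: (n) => // m IH; rewrite !expnS; apply: leq_mul.
by rewrite leq_pmul2r ?expn_gt0 ?t0 // ltnn.
Qed.

End FiniteAss.

(** * From Koszul classes to Cech classes *)

Section Bridge.
Variables (R : comNzRingType) (n : nat).
Local Notation S := {mpoly R[n]}.
Local Notation Su := ({poly S} : lmodType S).
Implicit Types (fs : seq S) (g f : S).

(* The class z / f^t in the Cech complex of a Koszul cochain z on the f^t. *)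
Definition lev t fs : K fs S^o -> K fs Su :=
  @Kmap S S^o Su (fun c => (c : S) *: ('X^t : {poly S})) fs.

Lemma lev1_lin t : lin (fun c : S^o => ((c : S) *: ('X^t : {poly S}) : Su)).
Proof. by move=> a x y; rewrite scalerDl scalerA. Qed.

Lemma lev_lin t fs : lin (@lev t fs).
Proof. exact/Kmap_lin/lev1_lin. Qed.

Lemma sig_Xn f t : sig f 'X^t = f ^+ t *: 'X^t.
Proof. by rewrite (rmorphXn (sig f)) /= sigX exprZn. Qed.

Lemma Kd_lev t fs (z : K fs S^o) : cech_diff (lev t z) = lev t (kd t z).
Proof.
apply/esym; apply: Kmap_diff; first exact: lev1_lin.
by move=> f x; rewrite (linZ _ _ (@sig_lin _ _ f)) sig_Xn scalerA mulrC.
Qed.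

(** Expanding fractions from exponent [t] to [t + s]; the factor [g ^+ s] belongs to the denominator
    [g] shared by all components. *)
Lemma lev_theta s t fs g (z : K fs S^o) :
  cech_rel g (lev t z - lev (t + s) (g ^+ s *: Ktheta s z)).
Proof.
elim: fs g z => [|f fs IH] g z.
  by rewrite /lev /= /GRing.scale /= mulrC; apply: rel_pow.
split; first exact: IH.
have := IH (g * f) z.2; congr (cech_rel _ (_ - lev _ _)).
by rewrite /= exprMn scalerA.
Qed.

Fixpoint klam M fs g : K fs Su -> K fs S^o :=
  match fs with
  | [::] => lam M g
  | f :: fs' => fun z => (klam M g z.1, klam M (g * f) z.2)
  end.

Lemma lam_lin M g : lin (lam M g : Su -> S^o).
Proof.
move=> a x y; rewrite /lam scaler_sumr -big_split; apply: eq_bigr => j _ /=.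
by rewrite coefD coefZ mulrDl /GRing.scale /= mulrA.
Qed.

Lemma klam_lin M fs g : lin (@klam M fs g).
Proof.
elim: fs g => [|f fs IH] g; first exact: lam_lin.
by move=> a x y; congr (_, _); apply: IH.
Qed.

Lemma lam_Xn M g c t : (t <= M)%N -> lam M g (c *: 'X^t) = c * g ^+ (M - t).
Proof.
move=> tM; rewrite /lam (bigD1 (Ordinal (tM : (t < M.+1)%N))) //= coefZ coefXn eqxx mulr1.
rewrite big1 ?addr0 // => j jt; rewrite coefZ coefXn.
have -> : (j == t :> nat) = false by apply/negbTE.
by rewrite mulr0 mul0r.
Qed.

Lemma klam_lev M t fs g (z : K fs S^o) : (t <= M)%N ->
  klam M g (lev t z) = g ^+ (M - t) *: Ktheta (M - t) z.
Proof.
move=> tM; elim: fs g z => [|f fs IH] g z /=.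
  by rewrite /lev /= lam_Xn // mulrC.
by rewrite !IH; congr (_, _); rewrite /= exprMn scalerA.
Qed.

Lemma lam_sig M g f (q : Su) : lam M (g * f) (sig f q) = f ^+ M * lam M g q.
Proof.
have e (j : nat) : (sig f q : {poly S})`_j = f ^+ j * (q : {poly S})`_j.
  have -> : sig f q = \poly_(j < size (q : {poly S})) (f ^+ j * (q : {poly S})`_j).
    rewrite poly_def /sig comp_polyE; apply: eq_bigr => k _.
    by rewrite exprZn scalerA mulrC.
  by rewrite coef_poly; case: ltnP => // sj; rewrite nth_default // mulr0.
rewrite /lam mulr_sumr; apply: eq_bigr => j _; rewrite e exprMn.
have jM : (j <= M)%N by rewrite -ltnS.
have -> : f ^+ M = f ^+ j * f ^+ (M - j) by rewrite -exprD subnKC.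
by ring.
Qed.

Lemma klam_sig M fs g f (z : K fs Su) : klam M (g * f) (Kmap (sig f) z) = f ^+ M *: klam M g z.
Proof.
elim: fs g z => [|h fs IH] g z /=; first exact: lam_sig.
by rewrite IH mulrAC IH.
Qed.

Lemma klam_d M fs g (z : K fs Su) : klam M g (cech_diff z) = kd M (klam M g z).
Proof.
elim: fs g z => [|f fs IH] g z.
  exact: (lin0 (@lam_lin M g)).
rewrite kdE /= -!IH -klam_sig; congr (_, _).
exact: (linB _ _ (@klam_lin M fs (g * f))).
Qed.

(** The sum telescopes, so a relation has numerator 0 over [g^M] as soon as [M] reaches the size of
    [h]. *)
Lemma lam_rel M g (h : {poly S}) : lam M g ((1 - g *: 'X) * h) = h`_M.
Proof.
have e j : ((1 - g *: 'X) * h)`_j = h`_j - (if j is j'.+1 then g * h`_j' else 0).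
  rewrite mulrBl mul1r -scalerAl coefB coefZ coefXM; case: j => //=.
  by rewrite mulr0.
elim: M => [|M IH]; first by rewrite /lam big_ord1 e subr0 mulr1.
rewrite /lam big_ord_recr /= subnn mulr1 e.
rewrite (eq_bigr (fun j : 'I_M.+1 => g * (((1 - g *: 'X) * h)`_j * g ^+ (M - j)))).
  by rewrite -mulr_sumr -/(lam M g _) IH addrCA subrr addr0.
by move=> j _; rewrite subSn ?exprS 1?mulrCA // -ltnS.
Qed.

Lemma klam_N fs g (z : K fs Su) : cech_rel g z -> exists M0, forall M, (M0 <= M)%N -> klam M g z = 0.
Proof.
elim: fs g z => [|f fs IH] g z /=.
  by move=> [h ->]; exists (size h) => M hM; rewrite lam_rel nth_default.
move=> [/IH[M1 H1] /IH[M2 H2]]; exists (maxn M1 M2) => M.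
by rewrite geq_max => /andP[/H1 -> /H2 ->].
Qed.

(** For the converse, numerators over a large common exponent [M] commute with the differentials and
    kill the relations, so a Cech primitive becomes a Koszul primitive at level [M]. *)
Lemma bridge t fs (z : K fs S^o) : triv t (fun=> True) z <-> cech_bound (lev t z).
Proof.
split=> [[s [w [_ e]]]|[w Nw]].
  exists (lev (s + t) w); rewrite Kd_lev -e addnC.
  by have := lev_theta s t 1 z; rewrite expr1n scale1r.
have [M0 H] := klam_N Nw; pose M := maxn M0 t.
have tM : (t <= M)%N by apply: leq_maxr.
have /eqP := H M (leq_maxl _ _).
rewrite (linB _ _ (@klam_lin _ _ _)) klam_lev // expr1n scale1r klam_d subr_eq0 => /eqP e.
by exists (M - t)%N, (klam M 1 w); rewrite e subnK.
Qed.

Variable tau : R.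

Lemma VP_pair (V : set R) f fs (y1 y2 : K fs Su) : VP V y1 -> VP V y2 ->
  VP V ((y1, y2) : K (f :: fs) Su).
Proof.
have sV : submod (M := res (K (f :: fs) Su)) (@VP R n (f :: fs) V) by apply: submod_gen.
have [V0 VD VZ] := sV.
have inl_ : VP V y1 -> VP V ((y1, 0) : K (f :: fs) Su).
  apply: (gen_min (M := res (K fs Su))
     (K := [set y | @VP R n (f :: fs) V ((y, 0) : K (f :: fs) Su)])).
    split=> [|x y Qx Qy|r x Qx]; first exact: V0.
      by have := VD _ _ Qx Qy; congr (VP _ _); congr (_, _); apply: addr0.
    by have := VZ r _ Qx; congr (VP _ _); congr (_, _); apply: scaler0.
  move=> _ [r [z [Vr ->]]] Q _; apply; exists r, (z, 0); split=> //.
  by congr (_, _); rewrite /= scaler0.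
have inr_ : VP V y2 -> VP V ((0, y2) : K (f :: fs) Su).
  apply: (gen_min (M := res (K fs Su))
     (K := [set y | @VP R n (f :: fs) V ((0, y) : K (f :: fs) Su)])).
    split=> [|x y Qx Qy|r x Qx]; first exact: V0.
      by have := VD _ _ Qx Qy; congr (VP _ _); congr (_, _); apply: addr0.
    by have := VZ r _ Qx; congr (VP _ _); congr (_, _); apply: scaler0.
  move=> _ [r [z [Vr ->]]] Q _; apply; exists r, (0, z); split=> //.
  by congr (_, _); rewrite /= scaler0.
move=> /inl_ H1 /inr_ H2; have := VD _ _ H1 H2; congr (VP _ _).
by congr (_, _); rewrite /= ?addr0 ?add0r.
Qed.

(* Exactness of localization: tau-torsion classes have coefficients in (0 : tau). *)
Lemma tau_torsion fs g (q : K fs Su) : cech_rel g ((tau%:MP : S) *: q) ->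
  exists y, VP [set r | r * tau = 0] y /\ cech_rel g (q - y).
Proof.
elim: fs g q => [|f fs IH] g q; last first.
  move=> [/IH[y1 [V1 N1]] /IH[y2 [V2 N2]]].
  by exists (y1, y2); split; [apply: VP_pair | split].
move=> Nq; have [M0 H] := klam_N (Nq : @cech_rel R n [::] g _).
pose M := maxn M0 (size (q : {poly S})).
have l0 : tau%:MP * lam M g q = 0.
  by rewrite -(H M (leq_maxl _ _)); apply/esym; apply: (linZ _ _ (@lam_lin M g)).
exists (lam M g q *: 'X^M); split; last first.
  by apply: rel_lam; rewrite ltnW // ltnS leq_maxr.
have [V0 VD VZ] := submod_gen (M := res Su)
  [set x | exists r (z : Su), r * tau = 0 /\ x = (r%:MP : S) *: z].
rewrite (mpolyE (lam M g q)) scaler_suml; apply: (big_ind (@VP R n [::] _)) => [||m _].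
- exact: V0.
- exact: VD.
move=> Q _; apply; exists (lam M g q)@_m, ('X_[m] *: 'X^M); split.
  by apply: (etrans (mulrC _ _)); rewrite -mcoeffCM l0 mcoeff0.
by rewrite -mul_mpolyC scalerA.
Qed.

(* A class z killed by tau, tau z = d w, either has a multiple outside P represented
   with coefficients in (0 : tau), or P is the annihilator of w modulo cocycles and
   multiples of tau. *)
Lemma finite_cech_ass (p : set R) fs : noeth R -> is_prime p -> p tau ->
  (exists s k, ~ p s /\ forall l : seq R, size l = k -> (forall x, x \in l -> p x) ->
     exists b, s * \prod_(x <- l) x = b * tau) ->
  finite_set [set P : set S | [/\ is_prime P, forall r, P r%:MP <-> p r &
    exists z : K fs Su, forall a, cech_bound (a *: z) <-> P a]].
Proof.
move=> nR pp ptau [s [k [ps Hk]]].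
pose A0 : set R := [set r | r * tau = 0].
pose tR : set R := [set x | exists b, x = b * tau].
have idA0 : is_ideal A0.
  split=> [|x y Ax Ay|a x Ax]; rewrite /A0 /=.
  - by rewrite mul0r.
  - by rewrite mulrDl Ax Ay addr0.
  - by rewrite -mulrA Ax mulr0.
have idtR : is_ideal tR.
  split=> [|_ _ [a ->] [b ->]|a _ [b ->]]; first by exists 0; rewrite mul0r.
    by exists (a + b); rewrite mulrDl.
  by exists (a * b); rewrite mulrA.
(* A product from [s p^k] is a multiple of [tau]: it acts as zero on [(0 : tau)] and maps [R] into
   [tau R]. Hence both coefficient modules have finite length at [p]. *)
have [c1 Hc1] : exists c, plen p (M := R^o) [set 0] A0 c.
  apply: (ideal_bound (s := s) (k := k) nR pp) => //.
    - exact: (submod0 R^o).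
    - by move=> _ ->; case: idA0.
  move=> l v sz lp Av; have [b e] := Hk l sz lp.
  by rewrite /= mulrA e -mulrA [tau * v]mulrC Av mulr0.
have [c2 Hc2] : exists c, plen p (M := R^o) tR setT c.
  apply: (ideal_bound (s := s) (k := k) nR pp) => // l v sz lp _.
  have [b e] := Hk l sz lp; exists (b * v); rewrite mulrA e; ring.
have sB := @KB_submod R n fs; have sZ := @KZ_submod R n fs tau.
have sN := KN_submod fs (1 : S); have [N0 ND NZ] := sN; have dl := @Kd_lin R n fs.
apply: (@sub_finite_set _ _ (
  [set P : set S | [/\ is_prime P, forall r, P r%:MP <-> p r &
    exists y, VP A0 y /\ forall a, @cech_bound R n fs (a *: y) <-> P a]] `|`
  [set P : set S | [/\ is_prime P, forall r, P r%:MP <-> p r &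
    exists y, VP setT y /\ forall a, @cech_cycle_mod R n fs tau (a *: y) <-> P a]])); last first.
  rewrite finite_setU; split.
    apply: (finite_ann pp idA0 sB _ (@KN_KB R n fs) _ Hc1) => [t|u x ->].
      exact: KB_stable.
    by rewrite mpolyC0 scale0r; case: sB.
  apply: (finite_ann pp _ sZ _ (@KN_KZ R n fs tau) _ Hc2) => // [t|u x [b ->]].
    exact: KZ_stable.
  exists ((b%:MP : S) *: x).
  by rewrite scalerA -mpolyCM mulrC subrr (lin0 dl).
move=> P [Pp Pc [z Pz]]; have [[P0 PD PZ] P1 PM] := Pp.
pose A' (x : K fs Su) := exists v y, VP A0 y /\ cech_rel 1 (x - cech_diff v - y).
case: (pselect (exists a, ~ P a /\ A' (a *: z))) => [[a [nPa [v [y [Vy Nxy]]]]]|none].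
  left; split=> //; exists y; split=> // b.
  (* Passing to the multiple by [a] keeps the annihilator, because [a] is outside the prime [P]. *)
  rewrite -(_ : cech_bound ((b * a) *: z) <-> cech_bound (b *: y)).
    rewrite Pz; split=> [/PM[]|Pb] //; by rewrite mulrC; apply: PZ.
  have Bzy : cech_bound (a *: z - y).
    by exists v; rewrite addrAC.
  have [_ BD BZ] := sB.
  have Bb : cech_bound (b *: (a *: z - y)) by apply: BZ.
  rewrite scalerBr scalerA in Bb; split=> H.
    have := submodB sB H Bb; by rewrite opprB addrC subrK.
  by have := BD _ _ Bb H; rewrite subrK.
right; split=> //.
have /Pz [w Nw] : P tau%:MP by apply/Pc.
exists w; split.
  by move=> Q _; apply; exists 1, w; rewrite mpolyC1 scale1r.
move=> a; split=> [[v Nv]|/Pz[v Nv]]; last first.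
  exists v; rewrite (linB _ _ dl) !(linZ _ _ dl).
  have -> : a *: cech_diff w - (tau%:MP : S) *: cech_diff v =
      (tau%:MP : S) *: (a *: z - cech_diff v) - a *: ((tau%:MP : S) *: z - cech_diff w).
    rewrite !scalerBr !scalerA [a * _]mulrC opprB.
    by rewrite [RHS]addrC addrA subrK.
  by apply: submodB => //; apply: NZ.
(* If [a w - tau v] is a cocycle, then [tau (a z - d v)] is a relation, so [a z - d v] has
   coefficients in [(0 : tau)] up to relations. For [a] outside [P] this is the case excluded by
   [none]. *)
apply: contrapT => nPa; apply: none; exists a; split=> //.
have /tau_torsion[y [Vy Ny]] : cech_rel 1 ((tau%:MP : S) *: (a *: z - cech_diff v)).
  have -> : (tau%:MP : S) *: (a *: z - cech_diff v) =
     a *: ((tau%:MP : S) *: z - cech_diff w) + cech_diff (a *: w - (tau%:MP : S) *: v).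
    rewrite (linB _ _ dl) !(linZ _ _ dl) !scalerBr !scalerA [a * _]mulrC addrA subrK.
    by [].
  by apply: ND => //; apply: NZ.
by exists v, y.
Qed.

End Bridge.

Theorem theorem3p4 (R : comNzRingType) (m : set R)
  (R_noeth : is_noetherian R) (R_local : is_local m)
  (R_dim : krull_dim_eq R 2)
  (n : nat) (sigma tau : R) (sop : is_sop2 m sigma tau)
  (J : set {mpoly R[n]}) (J_ideal : is_ideal J) (i : nat)
  (H : lmodType {mpoly R[n]})
  (H_loc : is_local_cohomology J ({mpoly R[n]}^o) i H) :
  finite_set [set P : set {mpoly R[n]} |
    [/\ Ass H P, P tau%:MP & ~ P sigma%:MP]].
Proof.
have nR : noeth R by apply/noethP.
have nS : noeth {mpoly R[n]} := @noeth_mpoly R n nR.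
have [fs [fsJ Jfs]] := nS J J_ideal.
pose X := [set p : set R | [/\ is_prime p, p tau & ~ p sigma]].
have kill p : X p -> exists s k, ~ p s /\
    forall l : seq R, size l = k -> (forall x, x \in l -> p x) ->
    exists b, s * \prod_(x <- l) x = b * tau.
  by move=> [pp pt ps]; apply: (krull_pit nR R_local sop).
have finX : finite_set X.
  by apply: (finite_primes_over nR _ kill) => p [].
pose F (p : set R) := [set P : set {mpoly R[n]} |
  [/\ is_prime P, forall r, P r%:MP <-> p r &
    exists z : K fs ({poly {mpoly R[n]}} : lmodType {mpoly R[n]}), forall a, cech_bound (a *: z) <-> P a]].
apply: (@sub_finite_set _ _ (\bigcup_(p in X) F p)); last first.
  apply: bigcup_finite => // p Xp; have [pp pt _] := Xp.
  exact: (finite_cech_ass fs nR pp pt (kill p Xp)).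
move=> P [[Pp [x Px]] Pt Ps].
have [[P0 PD PZ] P1 PM] := Pp.
exists [set r : R | P r%:MP].
  split=> //; split=> /=.
  - split=> /= [|a b Pa Pb|a b Pb]; first by rewrite mpolyC0.
      by rewrite mpolyCD; apply: PD.
    by rewrite mpolyCM; apply: PZ.
  - by rewrite mpolyC1.
  - by move=> a b; rewrite mpolyCM; apply: PM.
split=> //.
have [I [L [j [q [jinj jran qran qker]]]]] := H_loc.
have [y _ ey] : range q x by rewrite qran.
have Zy : @torsion_cocycles _ J _ I i (j y) by rewrite -jran; exists y.
have [t [zeta Hz]] := koszul_repr nS fsJ Jfs Zy.
(* The annihilator survives each passage: from [x] to a cocycle of the resolution by [qker], to the
   Koszul limit by [koszul_repr], and to the Cech complex by [bridge]. *)
exists (lev t zeta) => a.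
rewrite -(linZ _ _ (@lev_lin _ _ t fs)) -bridge -Hz Px /annihilator /= -ey -!linearZ.
by rewrite qker.
Qed.
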